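(* Let $X$ be a finite set of generators for the $\mathrm{II}_1$ factor $(M,\tau)$. Then $$\delta_0(X)\leq 1+2\,\mathcal I(X).$$
   Context: $\tau$ is the faithful normal trace on $M$ with $\tau(1)=1$; ''generators'' means generating $M$ as a von Neumann algebra. Let $\mathcal P(M)$ be the collection of all finite sets of mutually orthogonal projections in $M$ which sum to $1$. For $x\in M$ and $P\in\mathcal P(M)$ put $\mathcal I(x;P)=\sum_{p,q\in P,\ pxq\neq 0}\tau(p)\tau(q)$; for a finite subset $X\subset M$ put $\mathcal I(X;P)=\sum_{x\in X}\mathcal I(x;P)$ and $\mathcal I(X)=\inf_{P\in\mathcal P(M)}\mathcal I(X;P)$. Let $\mathrm{tr}_k$ be the trace on $\mathbb M_k(\mathbb C)$ with $\mathrm{tr}_k(1)=1$. For $X=\{x_1,\dots,x_n\}\subset M$, $\gamma>0$, $m,k\in\mathbb N$, $R>0$, the microstate space $\Gamma_R(X;m,k,\gamma)$ is the set of $n$-tuples $(a_1,\dots,a_n)$ of $k\times k$ matrices with operator norms $\|a_i\|\leq R$ and $$\left|\tau(x_{i_1}^{j_1}\cdots x_{i_p}^{j_p})-\mathrm{tr}_k(a_{i_1}^{j_1}\cdots a_{i_p}^{j_p})\right|<\gamma$$ for all $p\leq m$, $i_1,\dots,i_p\in\{1,\dots,n\}$, $j_1,\dots,j_p\in\{1,*\}$. Equip $(\mathbb M_k(\mathbb C))^n$ with the norm $\|(a_1,\dots,a_n)\|_2=\left(\sum_{l=1}^n\mathrm{tr}_k(a_l^*a_l)\right)^{1/2}$.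 For a metric space $Y$, $K_\varepsilon(Y)$ is the minimal cardinality of an $\varepsilon$-net for $Y$. Define $$\mathbb K_{\varepsilon,R}(X;m,\gamma)=\limsup_{k\to\infty}k^{-2}\log K_\varepsilon(\Gamma_R(X;m,k,\gamma)),\quad \mathbb K_{\varepsilon,R}(X)=\inf_{m\in\mathbb N,\gamma>0}\mathbb K_{\varepsilon,R}(X;m,\gamma),$$ $\mathbb K_\varepsilon(X)=\sup_{R>0}\mathbb K_{\varepsilon,R}(X)$ (with $\log 0=-\infty$). The modified free entropy dimension is $$\delta_0(X)=\limsup_{\varepsilon\to0}\frac{\mathbb K_\varepsilon(X)}{|\log\varepsilon|}.$$ *)

(* Defs.v *)
From HB Require Import structures.
From mathcomp Require Import all_boot all_order all_algebra.
From mathcomp Require Import finmap complex sesquilinear spectral.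
From mathcomp Require Import all_classical all_reals all_analysis.

Set Implicit Arguments.
Unset Strict Implicit.
Unset Printing Implicit Defensive.

Import Order.TTheory GRing.Theory Num.Theory.
Import numFieldNormedType.Exports.

Local Open Scope classical_set_scope.
Local Open Scope ring_scope.
Local Open Scope complex_scope.
Local Open Scope sesquilinear_scope.

(* A complex Hilbert space is a complete normed space H over R[i] together with
   an inner product [dot] such that [dot v v = `|v| ^+ 2].  Operators are plain
   functions H -> H, multiplied with \o, with unit [idfun]. *)

Section Operators.
Variables (R : realType) (H : completeNormedModType R[i]).
Variable dot : {dot H for (@conjc R)}.

Definition hilbert : Prop := forall v : H, dot v v = `|v| ^+ 2.

Definition bounded_op : set (H -> H) := [set T | linear T /\ continuous T].

(* On a Hilbert space, Riesz representation makes the adjoint of a bounded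
   operator exist and be unique, so the default value 0 is never used there. *)
Definition adj (T : H -> H) : H -> H :=
  xget 0 [set S | bounded_op S /\ forall u v, dot (T u) v = dot u (S v)].

Definition commutant (A : set (H -> H)) : set (H -> H) :=
  [set T | bounded_op T /\ forall S, A S -> T \o S = S \o T].

(* A self-adjoint set of operators equal to its bicommutant; being a unital
   subalgebra of the bounded operators follows, since every commutant is one. *)
Definition von_neumann_algebra (M : set (H -> H)) : Prop :=
  (forall T, M T -> M (adj T)) /\ commutant (commutant M) = M.

Definition is_factor (M : set (H -> H)) : Prop :=
  M `&` commutant M = range (fun c : R[i] => c *: (idfun : H -> H)).

Definition projection (M : set (H -> H)) (p : H -> H) : Prop :=
  [/\ M p, p \o p = p & adj p = p].

Definition abelian_projection (M : set (H -> H)) (e : H -> H) : Prop :=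
  projection M e /\
  forall x y, M x -> M y ->
    (e \o x \o e) \o (e \o y \o e) = (e \o y \o e) \o (e \o x \o e).

(* Murray-von Neumann type: the identity is a finite projection and there is no
   nonzero abelian projection. *)
Definition type_II1 (M : set (H -> H)) : Prop :=
  (forall u, M u -> adj u \o u = idfun -> u \o adj u = idfun) /\
  (forall e, abelian_projection M e -> e = 0).

Definition le_op (S T : H -> H) : Prop := forall v, dot (S v) v <= dot (T v) v.

Definition self_adjoint (M : set (H -> H)) : set (H -> H) :=
  [set T | M T /\ adj T = T].

Definition directed_ops (D : set (H -> H)) : Prop :=
  D !=set0 /\
  forall S T, D S -> D T -> exists U, [/\ D U, le_op S U & le_op T U].

Definition op_lub (M D : set (H -> H)) (s : H -> H) : Prop :=
  [/\ self_adjoint M s, forall T, D T -> le_op T s &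
      forall t, self_adjoint M t -> (forall T, D T -> le_op T t) -> le_op s t].

Definition normal_on (M : set (H -> H)) (tau : (H -> H) -> R[i]) : Prop :=
  forall (D : set (H -> H)) (s : H -> H),
    D `<=` self_adjoint M -> directed_ops D -> op_lub M D s ->
    complex.Re (tau s) = sup [set complex.Re (tau T) | T in D].

Definition linear_on (M : set (H -> H)) (tau : (H -> H) -> R[i]) : Prop :=
  forall (c : R[i]) (x y : H -> H), M x -> M y ->
    tau (c *: x + y) = c * tau x + tau y.

(* The values of [tau] outside [M] are irrelevant. *)
Definition faithful_normal_trace (M : set (H -> H))
    (tau : (H -> H) -> R[i]) : Prop :=
  [/\ linear_on M tau /\ tau idfun = 1,
      forall x, M x -> 0 <= tau (adj x \o x),
      forall x, M x -> tau (adj x \o x) = 0 -> x = 0,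
      forall x y, M x -> M y -> tau (x \o y) = tau (y \o x) &
      normal_on M tau].

Definition II1_factor (M : set (H -> H)) (tau : (H -> H) -> R[i]) : Prop :=
  [/\ von_neumann_algebra M, is_factor M, type_II1 M & faithful_normal_trace M tau].

Definition generates (X : {fset (H -> H)}) (M : set (H -> H)) : Prop :=
  [set` X] `<=` M /\
  forall N, von_neumann_algebra N -> [set` X] `<=` N -> M `<=` N.

End Operators.

Section Support.
Variables (R : realType) (H : completeNormedModType R[i]).
Variables (dot : {dot H for (@conjc R)}) (M : set (H -> H)).
Variable tau : (H -> H) -> R[i].

Definition projection_partition (P : {fset (H -> H)}) : Prop :=
  [/\ forall p, p \in P -> projection dot M p,
      forall p q, p \in P -> q \in P -> p != q -> p \o q = 0 &
      \sum_(p <- P) p = idfun].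

Definition calI_elt (x : H -> H) (P : {fset (H -> H)}) : R :=
  \sum_(p <- P) \sum_(q <- P | p \o x \o q != 0)
    complex.Re (tau p) * complex.Re (tau q).

Definition calI_part (X P : {fset (H -> H)}) : R :=
  \sum_(x <- X) calI_elt x P.

Definition calI (X : {fset (H -> H)}) : R :=
  inf [set calI_part X P | P in projection_partition].

End Support.

Section Microstates.
Variable R : realType.

Definition tr_norm k (a : 'M[R[i]]_k) : R[i] := \tr a / k%:R.

Definition l2norm k (v : 'cV[R[i]]_k) : R :=
  Num.sqrt (\sum_i ComplexField.Normc.normc (v i 0) ^+ 2).

Definition opnorm k (a : 'M[R[i]]_k) : R :=
  sup [set l2norm (a *m v) | v in [set v : 'cV[R[i]]_k | l2norm v <= 1]].

Definition norm2 (I : finType) k (a : {ffun I -> 'M[R[i]]_k}) : R :=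
  Num.sqrt (\sum_l complex.Re (tr_norm ((a l)^t* *m a l))).

Definition mx_word (I : finType) k (a : {ffun I -> 'M[R[i]]_k})
    (w : seq (I * bool)) : 'M[R[i]]_k :=
  foldr (fun l b => (if l.2 then (a l.1)^t* else a l.1) *m b) 1%:M w.

(* Nets are finite subsets of Y itself; the value is +oo when there is none. *)
Definition is_net (I : finType) k (e : R) (Y : set {ffun I -> 'M[R[i]]_k})
    (S : {fset {ffun I -> 'M[R[i]]_k}}) : Prop :=
  [set` S] `<=` Y /\ forall y, Y y -> exists2 s, s \in S & norm2 (y - s) < e.

Definition covering_number (I : finType) k (e : R)
    (Y : set {ffun I -> 'M[R[i]]_k}) : \bar R :=
  ereal_inf [set (#|` S|%:R)%:E | S in is_net e Y].

Variables (H : completeNormedModType R[i]) (dot : {dot H for (@conjc R)}).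
Variables (tau : (H -> H) -> R[i]) (X : {fset (H -> H)}).

(* Words in the letters x and x^*: the boolean [true] marks an adjoint. *)
Definition op_word (w : seq (X * bool)) : H -> H :=
  foldr (fun l T => (if l.2 then adj dot (val l.1) else val l.1) \o T) idfun w.

Definition microstates (r : R) (m k : nat) (g : R) :
    set {ffun X -> 'M[R[i]]_k} :=
  [set a : {ffun X -> _} | (forall x, opnorm (a x) <= r) /\
    forall w : seq (X * bool), (size w <= m)%N ->
      ComplexField.Normc.normc (tau (op_word w) - tr_norm (mx_word a w)) < g].

Definition K_mg (e r : R) (m : nat) (g : R) : \bar R :=
  limn_esup (fun k : nat =>
    ((k%:R ^- 2)%:E * lne (covering_number e (@microstates r m k g)))%E).

Definition K_er (e r : R) : \bar R :=
  ereal_inf [set K_mg e r mg.1 mg.2 | mg in [set mg : nat * R | 0 < mg.2]].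

Definition K_e (e : R) : \bar R :=
  ereal_sup [set K_er e r | r in [set r : R | 0 < r]].

Definition delta0 : \bar R :=
  limf_esup (fun e : R => (K_e e * (`|ln e|^-1)%:E)%E) 0^'+.

End Microstates.

(* Main.v *)
(* Fix a partition (p_i) of the identity into projections and a small e.  By strong density of
   polynomials in X and a Kaplansky-type approximation, every p_i is close in 2-norm to a
   self-adjoint noncommutative polynomial G_i(X) with a universal norm bound on all tuples of norm
   at most r.  On a microstate a, the matrices G_i(a) are then almost the spectral projections of the
   Hermitian matrix B(a) = sum_i i G_i(a).  Rounding the k^2 real coordinates of B(a) to a lattice
   costs k^2 |log e| and fixes genuine spectral projections Q_i close to the G_i(a).  As
   p_i x p_j = 0 forces Q_i a_x Q_j to be small, a is determined up to O(e) by the blocks Q_i a_x Q_j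
   with p_i x p_j <> 0, whose 2 k^2 tau(p_i) tau(p_j) real coordinates are rounded in turn.
   Altogether log K_e <= k^2 (C + (1 + 2 I(X; P) + eta) |log e|).  The constants must not depend on
   the cut-off r, so a_x is first replaced by a spectral truncation, controlled by moments. *)

(* The trace is only assumed normal and no vector is assumed to implement it, so strong
   approximation does not directly give 2-norm approximation. The bridge is a countable separating
   family of vectors for M and an absolute continuity property: a positive contraction in M that is
   small on finitely many of these vectors has small trace. The function 2t/(1+t^2) is bounded and
   fixes 0 and 1; a truncated Neumann series makes it a polynomial whose bound depends neither on
   its degree nor on the cut-off r, in M and on matrices alike. The polynomials do depend on r. This
   is harmless: for each r an infimum over m and gamma comes first, and only the constants must
   survive the supremum over r. Blocks of two microstates can be compared only in a common basis.
   The eigenbasis and the labels of eigenvalues are therefore read off one representative of the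
   lattice cell of B(a). This cell is what the summand 1 of the bound pays for. The scales are tied
   together: mesh c proportional to e, squared 2-norm precision d = c^2, rank error w proportional
   to c. *)
Require Import Defs.
From HB Require Import structures.
From mathcomp Require Import all_boot all_order all_algebra.
From mathcomp Require Import finmap complex sesquilinear spectral ring lra zify.
From mathcomp Require Import all_classical all_reals all_analysis.

Set Implicit Arguments.
Unset Strict Implicit.
Unset Printing Implicit Defensive.

Import Order.TTheory GRing.Theory Num.Theory.
Import numFieldNormedType.Exports.

Local Open Scope classical_set_scope.
Local Open Scope ring_scope.
Local Open Scope complex_scope.

(* Reflection for identities between linear combinations in a module. *)
Inductive lin_expr (K : Type) :=
  LVar of nat | LZero | LAdd of lin_expr K & lin_expr K | LOpp of lin_expr K
| LScale of K & lin_expr K.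
Arguments LVar {K}. Arguments LZero {K}.

Section LinExpr.
Variables (K : comNzRingType) (V : lmodType K).

Fixpoint lin_eval (env : seq V) (e : lin_expr K) : V :=
  match e with
  | LVar n => nth 0 env n | LZero => 0
  | LAdd a b => lin_eval env a + lin_eval env b
  | LOpp a => - lin_eval env a
  | LScale c a => c *: lin_eval env a
  end.

Fixpoint lin_coef (e : lin_expr K) (i : nat) : K :=
  match e with
  | LVar n => if n == i then 1 else 0 | LZero => 0
  | LAdd a b => lin_coef a i + lin_coef b i
  | LOpp a => - lin_coef a i
  | LScale c a => c * lin_coef a i
  end.

Lemma lin_evalE env e : lin_eval env e = \sum_(i < size env) lin_coef e i *: nth 0 env i.
Proof.
elim: e => /= [n||a -> b ->|a ->|c a ->].
- have [nlt|nge] := ltnP n (size env).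
    rewrite (bigD1 (Ordinal nlt)) //= eqxx scale1r big1 ?addr0 // => i ni.
    by rewrite -val_eqE /= eq_sym in ni; rewrite (negPf ni) scale0r.
  rewrite nth_default // big1 // => i _.
  by rewrite gtn_eqF ?scale0r // (leq_trans (ltn_ord i)).
- by rewrite big1 // => i _; rewrite scale0r.
- by rewrite -big_split; apply: eq_bigr => i _; rewrite scalerDl.
- by rewrite -sumrN; apply: eq_bigr => i _; rewrite scaleNr.
- by rewrite scaler_sumr; apply: eq_bigr => i _; rewrite scalerA.
Qed.

(** A nested conjunction rather than a quantified statement: it computes to one identity in [K] per
    atom, and these identities are the goals that [lin_solve] leaves for [ring] or [field]. *)
Fixpoint lin_coef_eq (n : nat) (a b : lin_expr K) : Prop :=
  if n is m.+1 then lin_coef a m = lin_coef b m /\ lin_coef_eq m a b else True.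

Lemma lin_eval_eq env a b : lin_coef_eq (size env) a b -> lin_eval env a = lin_eval env b.
Proof.
move=> h; rewrite !lin_evalE; apply: eq_bigr => i _; congr (_ *: _).
case: i => i /=; elim: (size env) h => // n IH /= [h1 h2].
by rewrite ltnS leq_eqVlt => /orP [/eqP -> //|]; exact: IH.
Qed.
End LinExpr.

Ltac lin_mem x l :=
  match l with
  | x :: _ => constr:(true)
  | _ :: ?l' => lin_mem x l'
  | _ => constr:(false)
  end.
Ltac lin_atoms l e :=
  match e with
  | (?a + ?b)%R => let l' := lin_atoms l a in lin_atoms l' b
  | (- ?a)%R => lin_atoms l a
  | (_ *: ?a)%R => lin_atoms l a
  | 0%R => l
  | _ => match lin_mem e l with true => l | false => constr:(e :: l) end
  end.
Ltac lin_index x l :=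
  match l with
  | x :: _ => constr:(0%N)
  | _ :: ?l' => let n := lin_index x l' in constr:(S n)
  end.
Ltac lin_reify K l e :=
  match e with
  | (?a + ?b)%R => let a' := lin_reify K l a in let b' := lin_reify K l b in constr:(LAdd a' b')
  | (- ?a)%R => let a' := lin_reify K l a in constr:(LOpp a')
  | (?c *: ?a)%R => let a' := lin_reify K l a in constr:(@LScale K c a')
  | 0%R => constr:(@LZero K)
  | _ => let n := lin_index e l in constr:(@LVar K n)
  end.
Ltac lin_solve K :=
  match goal with
  | |- @eq ?V ?a ?b =>
    let l0 := constr:(@nil V) in
    let l1 := lin_atoms l0 a in
    let l := lin_atoms l1 b in
    let a' := lin_reify K l a in
    let b' := lin_reify K l b in
    refine (@lin_eval_eq _ _ l a' b' _); rewrite /=; repeat split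
  end.

Tactic Notation "lmod_ring" constr(K) := lin_solve K; try by ring.
Tactic Notation "lmod_field" constr(K) := lin_solve K; try by field.

(** * Forms and Hilbert spaces *)

Section InnerProduct.
Variables (R : realType) (V : lmodType R[i]) (dot : V -> V -> R[i]).

(** The form is only semi-definite. The same lemmas then serve the Hilbert space, finite families of
    its vectors ([fdot]) and complex matrices ([dotm]); definiteness is a separate hypothesis where
    limits must be unique. *)
Definition prehilbert := [/\ forall c u v w, dot (c *: u + v) w = c * dot u w + dot v w,
  forall u v, dot v u = (dot u v)^* & forall u, 0 <= complex.Re (dot u u)].

(** Estimates are made on real parts and squared norms, so that they become polynomial inequalities
    over [R]; the imaginary part is recovered by [Im_dot]. *)
Definition re_dot u v : R := complex.Re (dot u v).
Definition sqnorm u : R := re_dot u u.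

Hypothesis hd : prehilbert.

Lemma ReD (x y : R[i]) : complex.Re (x + y) = complex.Re x + complex.Re y.
Proof. by case: x; case: y. Qed.

Lemma ReZ (t : R) (x : R[i]) : complex.Re (t%:C * x) = t * complex.Re x.
Proof. by case: x => a b /=; rewrite mul0r subr0. Qed.

Lemma rdotC u v : re_dot u v = re_dot v u.
Proof. by case: hd => _ h _; rewrite /re_dot (h u v); case: (dot u v). Qed.

Lemma rdotDl u v w : re_dot (u + v) w = re_dot u w + re_dot v w.
Proof. by case: hd => h _ _; rewrite /re_dot -[u]scale1r h mul1r scale1r ReD. Qed.

Lemma rdotDr u v w : re_dot u (v + w) = re_dot u v + re_dot u w.
Proof. by rewrite rdotC rdotDl !(rdotC u). Qed.

Lemma rdot0l w : re_dot 0 w = 0.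
Proof. by apply: (@addIr _ (re_dot 0 w)); rewrite -rdotDl !add0r. Qed.

Lemma rdot0r w : re_dot w 0 = 0.
Proof. by rewrite rdotC rdot0l. Qed.

Lemma dotZl c u w : dot (c *: u) w = c * dot u w.
Proof.
case: hd => h _ _; have h0 : dot 0 w = 0.
  by apply: (@addIr _ (dot 0 w)); have := h 1 0 0 w; rewrite scaler0 addr0 mul1r add0r => <-.
by rewrite -[c *: u]addr0 h h0 addr0.
Qed.

Lemma dotZr c u w : dot u (c *: w) = c^* * dot u w.
Proof.
case: hd => _ h _; rewrite (h (c *: w) u) dotZl (h w u).
by rewrite rmorphM.
Qed.

Lemma rdotZl (t : R) u w : re_dot (t%:C *: u) w = t * re_dot u w.
Proof. by rewrite /re_dot dotZl ReZ. Qed.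

Lemma rdotZr (t : R) u w : re_dot u (t%:C *: w) = t * re_dot u w.
Proof. by rewrite rdotC rdotZl rdotC. Qed.

Lemma rdotNl u w : re_dot (- u) w = - re_dot u w.
Proof. by apply/eqP; rewrite -subr_eq0 opprK -rdotDl addNr rdot0l. Qed.

Lemma rdotNr u w : re_dot u (- w) = - re_dot u w.
Proof. by rewrite rdotC rdotNl rdotC. Qed.

Lemma rdotBl u v w : re_dot (u - v) w = re_dot u w - re_dot v w.
Proof. by rewrite rdotDl rdotNl. Qed.

Lemma rdotBr u v w : re_dot u (v - w) = re_dot u v - re_dot u w.
Proof. by rewrite rdotDr rdotNr. Qed.

Lemma rdotiB u w : re_dot ('i *: u) w = - re_dot u ('i *: w).
Proof.
rewrite /re_dot dotZl dotZr; case: (dot u w) => a b /=.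
by rewrite !mul0r !mul1r !sub0r mulN1r opprK.
Qed.

Lemma Im_dot u v : complex.Im (dot u v) = re_dot u ('i *: v).
Proof.
rewrite /re_dot dotZr; case: (dot u v) => a b /=.
by rewrite mul0r sub0r mulN1r opprK.
Qed.

Lemma sqn_ge0 u : 0 <= sqnorm u.
Proof. by case: hd => _ _; exact. Qed.

Lemma sqnD u v : sqnorm (u + v) = sqnorm u + 2 * re_dot u v + sqnorm v.
Proof. by rewrite /sqnorm rdotDl !rdotDr (rdotC v u); ring. Qed.

Lemma sqnN u : sqnorm (- u) = sqnorm u.
Proof. by rewrite /sqnorm rdotNl rdotNr opprK. Qed.

Lemma sqnB u v : sqnorm (u - v) = sqnorm u - 2 * re_dot u v + sqnorm v.
Proof. by rewrite sqnD sqnN rdotNr; ring. Qed.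

Lemma sqnBC u v : sqnorm (u - v) = sqnorm (v - u).
Proof. by rewrite -sqnN opprB. Qed.

Lemma sqnZr (t : R) u : sqnorm (t%:C *: u) = t ^+ 2 * sqnorm u.
Proof. by rewrite /sqnorm rdotZl rdotZr; ring. Qed.

Lemma sqnZ c u : sqnorm (c *: u) = (complex.Re c ^+ 2 + complex.Im c ^+ 2) * sqnorm u.
Proof.
have Im0 : complex.Im (dot u u) = 0.
  case: hd => _ h _; have := h u u; case: (dot u u) => a b [] /=; lra.
rewrite /sqnorm /re_dot dotZl dotZr.
by case: (dot u u) Im0 => a b /= ->; case: c => x y /=; ring.
Qed.

Lemma sqn0 : sqnorm 0 = 0. Proof. exact: rdot0l. Qed.

Lemma sqnD_le u v : sqnorm (u + v) <= 2 * sqnorm u + 2 * sqnorm v.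
Proof. have := sqn_ge0 (u - v); rewrite sqnB sqnD; lra. Qed.

Lemma sqnB_le u v : sqnorm (u - v) <= 2 * sqnorm u + 2 * sqnorm v.
Proof. by rewrite -(sqnN v); apply: sqnD_le. Qed.

Lemma quad_nonneg (a b c : R) : (forall t, 0 <= a - 2 * t * b + t ^+ 2 * c) -> b ^+ 2 <= a * c.
Proof.
move=> h; have a0 : 0 <= a by have := h 0; lra.
have c0 : 0 <= c.
  rewrite leNgt; apply/negP => c0.
  (* Chosen so that t >= 1 and t (-c) >= |a| + 2|b| + 1, which makes the quadratic negative at t. *)
  pose t := (`|a| + 2 * `|b| + 1) / (- c) + 1.
  have t1 : 1 <= t.
    by rewrite lerDr; apply: divr_ge0; [have := normr_ge0 a; have := normr_ge0 b; lra|lra].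
  have tc : t * (- c) >= `|a| + 2 * `|b| + 1.
    have -> : t * (- c) = (`|a| + 2 * `|b| + 1) - c by rewrite /t; field; lra.
    by lra.
  have := h t; have := ler_norm a; have := ler_norm (- b); rewrite normrN => hb ha.
  have : t * (2 * (- b)) <= t * (2 * `|b|) by apply: ler_wpM2l; lra.
  have : t * (t * (- c)) >= t * (`|a| + 2 * `|b| + 1) by apply: ler_wpM2l; lra.
  have : t * `|a| >= `|a| by apply: ler_peMl.
  nra.
have [c00|cn0] := eqVneq c 0.
  rewrite c00 mulr0; suff -> : b = 0 by rewrite expr0n.
  (* With c = 0 the hypothesis is affine in t; at this point it reads 0 <= -1. *)
  apply/eqP/negP => /negP b0; have := h ((a + 1) / (2 * b)).
  rewrite c00 mulr0 addr0.
  have -> : 2 * ((a + 1) / (2 * b)) * b = a + 1 by field.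
  by lra.
have cp : 0 < c by rewrite lt_neqAle eq_sym cn0.
have := h (b / c); have -> : a - 2 * (b / c) * b + (b / c) ^+ 2 * c = a - b ^+ 2 / c by field.
by rewrite subr_ge0 ler_pdivrMr.
Qed.

Lemma cauchy_schwarz u v : re_dot u v ^+ 2 <= sqnorm u * sqnorm v.
Proof.
apply: quad_nonneg => t; have := sqn_ge0 (u - t%:C *: v).
by rewrite sqnB sqnZr rdotZr mulrA.
Qed.

Lemma sqn_eq0_rdot u v : sqnorm u = 0 -> re_dot u v = 0.
Proof.
move=> u0; have := cauchy_schwarz u v; rewrite u0 mul0r => h.
by apply/eqP; rewrite -sqrf_eq0 eq_le h sqr_ge0.
Qed.

Lemma sqn_sum (I : finType) (F : I -> V) :
  sqnorm (\sum_i F i) <= #|I|%:R * \sum_i sqnorm (F i).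
Proof.
have aux (s : seq I) (P : I -> V) :
    sqnorm (\sum_(i <- s) P i) <= (size s)%:R * \sum_(i <- s) sqnorm (P i).
  elim: s => [|i s IH]; first by rewrite !big_nil sqn0 mulr0.
  rewrite !big_cons sqnD.
  set S := \sum_(j <- s) P j in IH *; set T := \sum_(j <- s) sqnorm _ in IH *.
  have T0 : 0 <= T by apply: sumr_ge0 => j _; apply: sqn_ge0.
  have ga := sqn_ge0 (P i); rewrite /= -[(size s).+1%:R]natr1.
  set n := (size s)%:R in IH *; have n0 : 0 <= n by rewrite ler0n.
  have [nz|nz] := eqVneq n 0.
    have S0 : sqnorm S = 0 by apply: le_anti; rewrite sqn_ge0 andbT; move: IH; rewrite nz mul0r.
    by rewrite rdotC (sqn_eq0_rdot _ S0) S0 nz; nra.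
  have np : 0 < n by rewrite lt_neqAle eq_sym nz.
  have := sqn_ge0 ((n)%:C *: P i - S); rewrite sqnB sqnZr rdotZl => h.
  suff h2 : n * (2 * re_dot (P i) S) <= n * (n * sqnorm (P i) + T).
    by move: h2; rewrite ler_pM2l // => h2; lra.
  nra.
have := aux (index_enum I) F; rewrite -[index_enum I]enumT -cardE.
by rewrite !big_enum.
Qed.

(** [C] bounds the square of the operator norm. Such bounds multiply under composition, while a sum
    costs a factor 2. *)
Definition lbounded (C : R) (T : V -> V) := forall v, sqnorm (T v) <= C * sqnorm v.

Lemma lbounded_le C D T : C <= D -> lbounded C T -> lbounded D T.
Proof. by move=> CD h v; apply: le_trans (h v) _; rewrite ler_wpM2r ?sqn_ge0. Qed.

Lemma lbounded_comp C D S T : 0 <= C -> lbounded C S -> lbounded D T -> lbounded (C * D) (S \o T).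
Proof.
move=> C0 hS hT v /=; apply: le_trans (hS _) _.
by rewrite -mulrA ler_wpM2l.
Qed.

Lemma lboundedD C D S T : lbounded C S -> lbounded D T -> lbounded (2 * C + 2 * D) (S + T).
Proof.
move=> hS hT v; apply: le_trans (sqnD_le _ _) _.
by have := hS v; have := hT v; lra.
Qed.

Lemma lboundedZ C c T : lbounded C T ->
  lbounded ((complex.Re c ^+ 2 + complex.Im c ^+ 2) * C) (c *: T).
Proof.
move=> h v; rewrite sqnZ -mulrA ler_wpM2l //.
by rewrite addr_ge0 ?sqr_ge0.
Qed.

End InnerProduct.

Section Linear.
Variables (R : realType) (V W : lmodType R[i]) (T : V -> W).
Hypothesis lT : linear T.
Lemma lin0 : T 0 = 0.
Proof. by have := lT (-1) 0 0; rewrite scaleN1r scaleN1r addNr addNr. Qed.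
Lemma linD u v : T (u + v) = T u + T v.
Proof. by have := lT 1 u v; rewrite !scale1r. Qed.
Lemma linZ c u : T (c *: u) = c *: T u.
Proof. by have := lT c u 0; rewrite lin0 !addr0. Qed.
Lemma linN u : T (- u) = - T u.
Proof. by rewrite -scaleN1r linZ scaleN1r. Qed.
Lemma linB u v : T (u - v) = T u - T v.
Proof. by rewrite linD linN. Qed.
Lemma lin_sum (I : Type) (s : seq I) (P : pred I) (F : I -> V) :
  T (\sum_(i <- s | P i) F i) = \sum_(i <- s | P i) T (F i).
Proof. by apply: big_morph; [exact: linD|exact: lin0]. Qed.
End Linear.

Section LinearClosure.
Variables (R : realType) (V W X : lmodType R[i]).
Lemma linear_id : linear (idfun : V -> V). Proof. by []. Qed.
Lemma linear_comp (S : W -> X) (T : V -> W) : linear S -> linear T -> linear (S \o T).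
Proof. by move=> hS hT c u v /=; rewrite hT hS. Qed.
Lemma linear_add (S T : V -> W) : linear S -> linear T -> linear (S + T).
Proof. by move=> hS hT c u v; change (S (c *: u + v) + T (c *: u + v) = c *: (S u + T u) + (S v + T v)); rewrite hS hT scalerDr addrACA. Qed.
Lemma linear_scale (c : R[i]) (T : V -> W) : linear T -> linear (c *: T).
Proof.
move=> hT d u v; change (c *: T (d *: u + v) = d *: (c *: T u) + c *: T v).
by rewrite hT scalerDr !scalerA mulrC.
Qed.
End LinearClosure.

Section Projection.
Variables (R : realType) (V : lmodType R[i]) (dot : V -> V -> R[i]).
Hypothesis hd : prehilbert dot.
Local Notation sqn := (sqnorm dot).
Local Notation rdot := (re_dot dot).

Definition sqn_cvg (u : nat -> V) (l : V) :=
  forall e : R, 0 < e -> exists N, forall n, (N <= n)%N -> sqn (u n - l) <= e.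

Definition sqn_cauchy (u : nat -> V) :=
  forall e : R, 0 < e -> exists N, forall m n, (N <= m)%N -> (N <= n)%N -> sqn (u m - u n) <= e.

Definition sqn_complete := forall u, sqn_cauchy u -> exists l, sqn_cvg u l.

Definition invS (n : nat) : R := n.+1%:R^-1.

Lemma invS_small (e : R) : 0 < e -> exists N, forall n, (N <= n)%N -> invS n <= e.
Proof.
move=> e0; exists (Num.truncn e^-1) => n Nn; rewrite /invS.
rewrite -[e]invrK lef_pV2 ?posrE ?invr_gt0 ?ltr0n //.
apply: ltW; apply: lt_le_trans (truncnS_gt _) _.
by rewrite ler_nat ltnS.
Qed.

Lemma le0_small (a c : R) : 0 <= c -> (forall e : R, 0 < e -> a <= c * e) -> a <= 0.
Proof.
move=> c0 h; rewrite leNgt; apply/negP => a0.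
have := h (a / (2 * (c + 1))).
have c1 : 0 < 2 * (c + 1) by lra.
rewrite divr_gt0 // => /(_ isT).
rewrite mulrA ler_pdivlMr //.
by have : 0 <= a * c; [apply: mulr_ge0; lra|nra].
Qed.

Lemma half_double (x : V) : (2^-1)%:C *: (x + x) = x.
Proof.
rewrite scalerDr -scalerDl -rmorphD /=.
have -> : (2^-1 + 2^-1 : R) = 1 by field.
by rewrite rmorph1 scale1r.
Qed.

Definition rsubspace (W : set V) :=
  [/\ W 0, forall u v, W u -> W v -> W (u + v) & forall (t : R) u, W u -> W (t%:C *: u)].

(** Parallelogram law on a minimising sequence. [W] need not be closed, so [w] only lies in its
    closure, and it is only a real subspace: the lemma is applied to kernels of real functionals and
    to values of self-adjoint polynomials. *)
Lemma projection_theorem (W : set V) v : sqn_complete -> rsubspace W ->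
  exists w, (forall e : R, 0 < e -> exists2 w', W w' & sqn (w - w') <= e) /\
            forall w', W w' -> rdot (v - w) w' = 0.
Proof.
move=> hc [W0 WD WZ].
pose S := [set sqn (v - w) | w in W].
have hS : has_inf S.
  split; first by exists (sqn (v - 0)); exists 0.
  by exists 0 => _ [w _ <-]; apply: sqn_ge0.
pose d := inf S.
have dle w : W w -> d <= sqn (v - w).
  by move=> Ww; apply: ge_inf; [case: hS|exists w].
have ex n : exists w, W w /\ sqn (v - w) <= d + invS n.
  have n0 : 0 < invS n by rewrite invr_gt0 ltr0n.
  by have [_ [w Ww <-] /ltW h] := inf_adherent n0 hS; exists w.
have [w hw] := choice ex.
have cau : sqn_cauchy w.
  move=> e e0; have e4 : 0 < e / 4 by lra.
  have [N hN] := invS_small e4; exists N => m n Nm Nn.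
  have := hN _ Nm; have := hN _ Nn => h1 h2.
  have [Wm hm] := hw m; have [Wn hn] := hw n.
  (* The midpoint of w_m and w_n lies in [W], so its distance to v is at least the infimum; the
     parallelogram law then bounds |w_m - w_n|^2. *)
  have := dle _ (WZ (2^-1) _ (WD _ _ Wm Wn)).
  have -> : v - (2^-1)%:C *: (w m + w n) = (2^-1)%:C *: ((v - w m) + (v - w n)).
    by rewrite addrACA -opprD scalerBr half_double.
  have -> : w m - w n = (v - w n) - (v - w m) by rewrite opprB [RHS]addrC addrA subrK.
  move: hm hn; set A := v - w m; set B := v - w n => hm hn.
  rewrite (sqnZr hd) (sqnD hd A) (sqnB hd B) (rdotC hd B).
  have -> : (2^-1 : R) ^+ 2 = 1 / 4 by field.
  by lra.
have [l hl] := hc _ cau; exists l; split.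
  move=> e e0; have [N hN] := hl _ e0; exists (w N); first by case: (hw N).
  by rewrite (sqnBC hd) hN.
move=> w' Ww'.
suff h : rdot (v - l) w' ^+ 2 <= 0 by apply/eqP; rewrite -sqrf_eq0 eq_le h sqr_ge0.
apply: (@le0_small _ (4 * sqn w')); first by have := sqn_ge0 hd w'; lra.
move=> e e0; have [N1 hN1] := hl _ e0; have [N2 hN2] := invS_small e0.
pose n := maxn N1 N2.
have h1 := hN1 n (leq_maxl _ _); have h2 := hN2 n (leq_maxr _ _).
have [Wn hn] := hw n.
(* Moving from w_n along w' changes the squared distance by a quadratic in t, and w_n is minimal up
   to 1/(n+1); the discriminant gives almost orthogonality. *)
have b1 : rdot (v - w n) w' ^+ 2 <= invS n * sqn w'.
  apply: quad_nonneg => t; have := dle _ (WD _ _ Wn (WZ t _ Ww')).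
  rewrite opprD addrA (sqnB hd) (sqnZr hd) (rdotZr hd); lra.
have b2 := cauchy_schwarz hd (w n - l) w'.
have -> : v - l = (v - w n) + (w n - l) by rewrite addrA subrK.
rewrite (rdotDl hd); have s0 := sqn_ge0 hd w'.
have : invS n * sqn w' <= e * sqn w' by apply: ler_wpM2r.
have : sqn (w n - l) * sqn w' <= e * sqn w' by apply: ler_wpM2r.
have := sqr_ge0 (rdot (v - w n) w' - rdot (w n - l) w').
nra.
Qed.

End Projection.

Section Family.
Variables (R : realType) (V : lmodType R[i]) (dot : V -> V -> R[i]) (I : finType).
Hypothesis hd : prehilbert dot.

(** The inner product of a direct sum of copies of the space: approximation at finitely many vectors
    is approximation at one vector of the sum. *)
Definition fdot (u v : I -> V) : R[i] := \sum_i dot (u i) (v i).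

Lemma Re_sum (J : Type) (s : seq J) (P : pred J) (F : J -> R[i]) :
  complex.Re (\sum_(j <- s | P j) F j) = \sum_(j <- s | P j) complex.Re (F j).
Proof. by apply: big_morph => // x y; rewrite ReD. Qed.

Lemma rdot_fdot u v : re_dot fdot u v = \sum_i re_dot dot (u i) (v i).
Proof. exact: Re_sum. Qed.

Lemma prehilbert_fdot : prehilbert fdot.
Proof.
case: (hd) => h1 h2 h3; split.
- move=> c u v w; rewrite mulr_sumr -big_split; apply: eq_bigr => i _.
  exact: h1.
- by move=> u v; rewrite rmorph_sum; apply: eq_bigr => i _; exact: h2.
- by move=> u; rewrite Re_sum; apply: sumr_ge0 => i _; exact: h3.
Qed.

Lemma sqn_fdot_le u e : sqnorm fdot u <= e -> forall i, sqnorm dot (u i) <= e.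
Proof.
move=> h i; apply: le_trans h; rewrite /sqnorm rdot_fdot (bigD1 i) //= lerDl.
by apply: sumr_ge0 => j _; apply: (sqn_ge0 hd).
Qed.

Lemma complete_fdot : sqn_complete dot -> sqn_complete fdot.
Proof.
move=> hc u hu.
have /choice [l hl] : forall i, exists l, sqn_cvg dot (fun n => u n i) l.
  move=> i; apply: hc => e e0; have [N hN] := hu _ e0; exists N => m n Nm Nn.
  exact: (sqn_fdot_le (hN m n Nm Nn) i).
exists l => e e0.
pose e' := e / (#|I|%:R + 1).
have c0 : 0 < (#|I|%:R + 1 : R) by rewrite ltr_wpDl // ler0n.
have e'0 : 0 < e' by rewrite divr_gt0.
have /choice [N hN] : forall i, exists N, forall n, (N <= n)%N -> sqnorm dot (u n i - l i) <= e'.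
  by move=> i; apply: hl.
exists (\max_i N i) => n Nn; rewrite /sqnorm rdot_fdot.
apply: (@le_trans _ _ (\sum_(i : I) e')).
  apply: ler_sum => i _; apply: (hN i); apply: leq_trans Nn.
  by apply: (@leq_bigmax_cond _ _ N i).
rewrite sumr_const -mulr_natl /e' mulrA ler_pdivrMr // mulrC ler_wpM2l ?ltW //.
by rewrite ltrDl.
Qed.

End Family.

Section Hilbert.
Variables (R : realType) (H : completeNormedModType R[i]).
Variable dot : {dot H for (@conjc R)}.
Hypothesis hH : hilbert dot.
Local Notation sqn := (sqnorm dot).
Local Notation rdot := (re_dot dot).

Lemma nnegC (e : R[i]) : 0 <= e -> exists2 t : R, 0 <= t & e = t%:C.
Proof. by case: e => a b; rewrite lecE /= => /andP[/eqP -> a0]; exists a. Qed.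

Lemma prehilbert_dot : prehilbert dot.
Proof.
split.
- by move=> c u v w; rewrite linearPl.
- by move=> u v; rewrite hermitian_subproof expr0 mul1r.
- move=> u; rewrite (hH u).
  have [t t0 ->] := nnegC (normr_ge0 u).
  by rewrite -rmorphXn /= exprn_ge0.
Qed.
Local Notation hd := prehilbert_dot.

Lemma norm_sqn u : `|u| = (Num.sqrt (sqn u))%:C.
Proof.
rewrite /sqn /rdot (hH u).
have [t t0 ->] := nnegC (normr_ge0 u).
by rewrite -rmorphXn /= sqrtr_sqr ger0_norm.
Qed.

Lemma norm_le_sqn u (e : R) : 0 <= e -> (`|u| <= e%:C) = (sqn u <= e ^+ 2).
Proof.
move=> e0; rewrite norm_sqn lecR -[in RHS](sqr_sqrtr (sqn_ge0 hd u)).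
by rewrite ler_pXn2r // ?nnegrE ?sqrtr_ge0.
Qed.

Lemma norm_lt_sqn u (e : R) : 0 <= e -> (`|u| < e%:C) = (sqn u < e ^+ 2).
Proof.
move=> e0; rewrite norm_sqn ltcR -[in RHS](sqr_sqrtr (sqn_ge0 hd u)).
by rewrite ltr_pXn2r // ?nnegrE ?sqrtr_ge0.
Qed.

Lemma posC (e : R[i]) : 0 < e -> exists2 t : R, 0 < t & e = t%:C.
Proof. by case: e => a b; rewrite ltcE /= => /andP[/eqP -> a0]; exists a. Qed.

Lemma complete_dot : sqn_complete dot.
Proof.
move=> u hu.
have : cauchy (u @ \oo).
  apply: cauchy_exP => e /posC [t t0 ->].
  have t2 : 0 < (t / 2) ^+ 2 by rewrite exprn_gt0 // divr_gt0.
  have [N hN] := hu _ t2; exists (u N); exists N => // n /= Nn.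
  rewrite -ball_normE /= norm_lt_sqn ?ltW //.
  apply: le_lt_trans (hN _ _ (leqnn _) Nn) _.
  by rewrite ltr_pXn2r ?nnegrE //; lra.
move=> /cauchy_cvgP /cvg_ex [l hl]; exists l => e e0.
have s0 : 0 < (Num.sqrt e)%:C :> R[i] by rewrite ltcR sqrtr_gt0.
move/cvgrPdist_le : hl => /(_ _ s0) [N _ hN]; exists N => n Nn.
have := hN n Nn; rewrite norm_le_sqn ?sqrtr_ge0 // (sqr_sqrtr (ltW e0)).
by rewrite (sqnBC hd).
Qed.

Lemma bounded_opP (T : H -> H) : bounded_op T <-> linear T /\ exists C : R, lbounded dot C T.
Proof.
split.
- case=> lT cT; split => //.
  pose T' := HB.pack_for {linear H -> H} T (GRing.isLinear.Build _ _ _ _ T lT).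
  have /linear_boundedP [r [rr hr]] : bounded_near T' (nbhs (0 : H)).
    by apply: continuous_linear_bounded; exact: cT.
  have [k hk] : exists k : R, r < k%:C.
    have := rr; rewrite realE => /orP hr2; exists (complex.Re r + 1).
    case: r rr {hr hr2} => a b; rewrite complex_real => /eqP ->.
    by rewrite ltcR /= ltrDl.
  exists ((`|k| + 1) ^+ 2) => v.
  have := hr _ hk v; rewrite !norm_sqn -rmorphM lecR => h.
  rewrite -(sqr_sqrtr (sqn_ge0 hd (T v))) -(sqr_sqrtr (sqn_ge0 hd v)) -exprMn.
  rewrite ler_pXn2r ?nnegrE ?sqrtr_ge0 ?mulr_ge0 ?sqrtr_ge0 ?addr_ge0 //.
  apply: le_trans h _; rewrite ler_wpM2r ?sqrtr_ge0 //.
  by have := ler_norm k; lra.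
- case=> lT [C hC]; split => //.
  pose T' := HB.pack_for {linear H -> H} T (GRing.isLinear.Build _ _ _ _ T lT).
  apply: (@bounded_linear_continuous _ _ _ T').
  apply/linear_boundedP; exists (Num.sqrt `|C|)%:C; split.
    by apply/complex_realP; eexists.
  move=> x xr v; apply: (@le_trans _ _ ((Num.sqrt `|C|)%:C * `|v|)); last first.
    by apply: ler_wpM2r => //; apply: ltW.
  rewrite !norm_sqn -rmorphM lecR -sqrtrM ?normr_ge0 //.
  apply: ler_wsqrtr; apply: le_trans (hC v) _.
  by rewrite ler_wpM2r ?sqn_ge0 ?ler_norm //; exact: hd.
Qed.

Lemma bounded_linear (T : H -> H) : bounded_op T -> linear T. Proof. by case. Qed.

Lemma bounded_ex (T : H -> H) : bounded_op T -> exists2 C : R, 0 <= C & lbounded dot C T.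
Proof.
move=> /bounded_opP [_ [C hC]]; exists `|C| => //.
by apply: (lbounded_le hd _ hC); rewrite ler_norm.
Qed.

Lemma sqn_eq0 u : sqn u = 0 -> u = 0.
Proof.
by move=> h; apply/eqP; rewrite -normr_eq0 norm_sqn h sqrtr0.
Qed.

Lemma rdot_inj u v : (forall w, rdot u w = rdot v w) -> u = v.
Proof.
move=> h; apply/eqP; rewrite -subr_eq0; apply/eqP; apply: sqn_eq0.
by rewrite /sqnorm (rdotBl hd) h subrr.
Qed.

Lemma dot_rdot u v u' v' : rdot u v = rdot u' v' -> rdot u ('i *: v) = rdot u' ('i *: v') ->
  dot u v = dot u' v'.
Proof.
rewrite -!(Im_dot hd) /re_dot; case: (dot u v) => a b; case: (dot u' v') => c d /=.
by move=> -> ->.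
Qed.

(** Only the real part of [f] is represented. It is a real functional, and the vector is a multiple
    of the component of some u0 orthogonal to its kernel. *)
Lemma riesz (f : H -> R[i]) (C : R) : (forall c u v, f (c *: u + v) = c * f u + f v) ->
  (forall u, complex.Re (f u) ^+ 2 <= C * sqn u) ->
  exists w, forall u, complex.Re (f u) = rdot u w.
Proof.
move=> lf bf.
have fD u v : f (u + v) = f u + f v by rewrite -[u]scale1r lf mul1r scale1r.
have f0 : f 0 = 0 by apply: (@addIr _ (f 0)); rewrite -fD !add0r.
have fZ c u : f (c *: u) = c * f u by rewrite -[c *: u]addr0 lf f0 addr0.
have fN u : f (- u) = - f u by rewrite -scaleN1r fZ mulN1r.
pose g u := complex.Re (f u).
have gD u v : g (u + v) = g u + g v by rewrite /g fD ReD.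
have gN u : g (- u) = - g u by apply/eqP; rewrite -addr_eq0 -gD addNr /g f0.
have gZ (t : R) u : g (t%:C *: u) = t * g u by rewrite /g fZ ReZ.
have g0 : g 0 = 0 by rewrite /g f0.
have gE u : complex.Re (f u) = g u by [].
have bg u : g u ^+ 2 <= C * sqn u by exact: bf.
move: g gD gN gZ g0 gE bg => g gD gN gZ g0 gE bg.
have [[u0 gu0]|hn] := pselect (exists u, g u != 0); last first.
  exists 0 => u; rewrite (rdot0r hd) gE; apply/eqP/negP => /negP h; apply: hn.
  by exists u.
pose W := [set u | g u = 0].
have sW : rsubspace W.
  split; first by rewrite /W /= g0.
  - by move=> u v /= hu hv; rewrite /W /= gD hu hv addr0.
  - by move=> t u /= hu; rewrite /W /= gZ hu mulr0.
have [w [h1 h2]] := projection_theorem hd u0 complete_dot sW.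
have gw : g w = 0.
  suff h : g w ^+ 2 <= 0 by apply/eqP; rewrite -sqrf_eq0 eq_le h sqr_ge0.
  apply: (@le0_small _ _ `|C|) => // e e0; have [w' Ww' hw'] := h1 _ e0.
  have -> : g w = g (w - w') by rewrite gD gN Ww' subr0.
  apply: le_trans (bg _) _; apply: (@le_trans _ _ (`|C| * sqn (w - w'))).
    by rewrite ler_wpM2r ?sqn_ge0 ?ler_norm //; exact: hd.
  by rewrite ler_wpM2l.
pose z := u0 - w.
have gz : g z = g u0 by rewrite gD gN gw subr0.
have z0 : sqn z != 0.
  apply/eqP => /sqn_eq0 zz; move: gz; rewrite zz g0 => h.
  by rewrite -h eqxx in gu0.
have gz0 : g z != 0 by rewrite gz.
exists ((g z / sqn z)%:C *: z) => u.
have : W (u - (g u / g z)%:C *: z).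
  rewrite /W /= gD gN gZ divfK ?subrr //.
move=> /h2; rewrite -/z (rdotC hd) (rdotBl hd) (rdotZl hd) => /eqP; rewrite subr_eq0 => /eqP.
rewrite (rdotZr hd) => ->; rewrite -/(sqn z) gE.
field; by rewrite ?gz0 ?z0.
Qed.

Lemma adj_exists (T : H -> H) : bounded_op T ->
  exists S, bounded_op S /\ forall u v, dot (T u) v = dot u (S v).
Proof.
move=> bT; have [C C0 hC] := bounded_ex bT; have lT := bounded_linear bT.
have /choice [S hS] : forall v, exists w, forall u, rdot (T u) v = rdot u w.
  move=> v; apply: (@riesz (fun u => dot (T u) v) (C * sqn v)).
    by move=> c u w; rewrite lT; case: hd.
  move=> u; apply: le_trans (cauchy_schwarz hd _ _) _.
  by rewrite mulrAC ler_wpM2r ?sqn_ge0 //; exact: hd.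
(* Only real inner products with [S v] are prescribed; compatibility with complex scalars comes from
   applying the prescription to i times a vector as well. *)
have lS : linear S.
  move=> c u v; apply: rdot_inj => w.
  rewrite (rdotC hd) -hS (rdotDr hd) (rdotDl hd) ![rdot _ w](rdotC hd) -hS; congr (_ + _).
  rewrite /re_dot !(dotZr hd).
  have -> : dot (T w) u = dot w (S u); last by [].
  apply: dot_rdot => //.
  by apply: oppr_inj; rewrite -!(rdotiB hd) -(linZ lT) hS.
exists S; split.
  apply/bounded_opP; split => //; exists C => v.
  have [->|nz] := eqVneq (sqn (S v)) 0; first by rewrite mulr_ge0 ?sqn_ge0 //; exact: hd.
  have p : 0 < sqn (S v) by rewrite lt_neqAle eq_sym nz sqn_ge0 //; exact: hd.
  rewrite -(ler_pM2l p) -expr2 {1}/sqnorm -hS.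
  apply: le_trans (cauchy_schwarz hd _ _) _.
  by rewrite mulrA [_ * C]mulrC ler_wpM2r ?sqn_ge0 //; exact: hd.
move=> u v; apply: dot_rdot => //.
by rewrite hS (linZ lS).
Qed.

Lemma adjP (T : H -> H) : bounded_op T -> bounded_op (adj dot T) /\ forall u v, dot (T u) v = dot u (adj dot T v).
Proof.
move=> bT; have [S hS] := adj_exists bT.
apply: (@xgetPex _ 0 [set S | bounded_op S /\ forall u v, dot (T u) v = dot u (S v)]).
by exists S.
Qed.

Lemma rdot_adj T u v : bounded_op T -> rdot (T u) v = rdot u (adj dot T v).
Proof. by move=> /adjP [_ h]; rewrite /re_dot h. Qed.

Lemma adj_unique T S : bounded_op T -> (forall u v, rdot (T u) v = rdot u (S v)) -> adj dot T = S.
Proof.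
move=> bT h; apply/funext => v; apply: rdot_inj => w.
by rewrite (rdotC hd) -rdot_adj // h (rdotC hd).
Qed.

End Hilbert.

(** * Polynomial approximation of projections *)

Section Kaplansky.
Variables (R : realType) (V : lmodType R[i]) (dot : V -> V -> R[i]).
Hypothesis hd : prehilbert dot.
Local Notation sqn := (sqnorm dot).
Local Notation rdot := (re_dot dot).
Variables (a : V -> V) (L : R).

(* [kap_r] is 1 - (1 + a^2) / (1 + L) and [kap_q N] a partial Neumann sum for (1 + a^2)^-1, so
   [kap_g N] approximates 2 a / (1 + a^2), which is bounded by 1 and equals a when a is a
   projection. *)
Definition kap_r v := v - ((1 + L)^-1)%:C *: (v + a (a v)).
Definition kap_q N v := ((1 + L)^-1)%:C *: \sum_(k < N) iter k kap_r v.
Definition kap_g N v := 2%:C *: a (kap_q N v).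
(** Since a^2 <= L, the spectrum of (1 + a^2) / (1 + L) lies between 1 / (1 + L) and 1; this is the
    resulting bound on the squared norm of [kap_r]. *)
Definition kap_rho : R := (1 - (1 + L)^-1) ^+ 2.

Hypotheses (L0 : 0 <= L) (la : linear a) (ba : lbounded dot L a).
Hypothesis sa : forall u v, rdot (a u) v = rdot u (a v).

Let c1 : 0 < 1 + L. Proof. by rewrite ltr_wpDr. Qed.

Lemma kap_rho_ge0 : 0 <= kap_rho. Proof. exact: sqr_ge0. Qed.

Lemma kap_rho_lt1 : kap_rho < 1.
Proof.
rewrite /kap_rho expr_lt1 //.
  by rewrite gtrDl oppr_lt0 invr_gt0.
by rewrite subr_ge0 invf_le1 // lerDl.
Qed.

Lemma sqn_one_add_sq w : sqn (w + a (a w)) = sqn w + 2 * sqn (a w) + sqn (a (a w)).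
Proof. by rewrite (sqnD hd) -sa. Qed.

Lemma kap_r_bound v : sqn (kap_r v) <= kap_rho * sqn v.
Proof.
rewrite /kap_r (sqnB hd) (sqnZr hd) (rdotZr hd) (rdotDr hd) -sa sqn_one_add_sq.
rewrite -/(sqnorm dot v) -/(sqnorm dot (a v)) /kap_rho.
have := ba (a v); set s := sqn v; set t := sqn (a v); set x := sqn (a (a v)) => hx.
have t0 : 0 <= t by exact: sqn_ge0.
rewrite -(ler_pM2l (exprn_gt0 2 c1)).
have -> : (1 + L) ^+ 2 * (s - 2 * ((1 + L)^-1 * (s + t)) + (1 + L)^-1 ^+ 2 * (s + 2 * t + x))
  = (1 + L) ^+ 2 * s - 2 * (1 + L) * (s + t) + (s + 2 * t + x) by field; rewrite lt0r_neq0.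
have -> : (1 + L) ^+ 2 * ((1 - (1 + L)^-1) ^+ 2 * s) = L ^+ 2 * s by field; rewrite lt0r_neq0.
have : 0 <= L * t by rewrite mulr_ge0.
nra.
Qed.

Lemma kap_r_iter k v : sqn (iter k kap_r v) <= kap_rho ^+ k * sqn v.
Proof.
elim: k => [|k IH]; first by rewrite expr0 mul1r.
rewrite iterS; apply: le_trans (kap_r_bound _) _.
by rewrite exprS -mulrA ler_wpM2l ?kap_rho_ge0.
Qed.

Lemma kap_r_lin : linear kap_r.
Proof.
move=> c u v; rewrite /kap_r !la.
by lmod_ring R[i].
Qed.

Lemma kap_rE u : u + a (a u) = (1 + L)%:C *: (u - kap_r u).
Proof.
rewrite /kap_r opprB [u + (_ - u)]addrC addrNK scalerA -rmorphM /= divff ?scale1r //.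
by apply: lt0r_neq0.
Qed.

Lemma iter_lin k : linear (iter k kap_r).
Proof.
elim: k => [|k IH] c u v //.
by rewrite !iterS IH kap_r_lin.
Qed.

(** The Neumann series telescopes, because [kap_rE] writes 1 + a^2 as (1 + L) (1 - kap_r). *)
Lemma kap_qE N v : kap_q N v + a (a (kap_q N v)) = v - iter N kap_r v.
Proof.
rewrite kap_rE /kap_q (linZ kap_r_lin) -scalerBr scalerA -rmorphM /= mulfV ?lt0r_neq0 //.
rewrite rmorph1 scale1r (lin_sum kap_r_lin) -sumrB.
elim: N => [|N IH]; first by rewrite big_ord0 subrr.
by rewrite big_ord_recr /= IH addrA subrK.
Qed.

Lemma kap_res_bound N v : sqn (v - iter N kap_r v) <= 4 * sqn v.
Proof.
apply: le_trans (sqnB_le hd _ _) _.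
have h := kap_r_iter N v.
have : kap_rho ^+ N * sqn v <= 1 * sqn v.
  apply: ler_wpM2r; first exact: sqn_ge0.
  by apply: exprn_ile1; [exact: kap_rho_ge0|apply: ltW; exact: kap_rho_lt1].
lra.
Qed.

Lemma kap_q_bound N : lbounded dot 4 (kap_q N).
Proof.
move=> v; have := kap_res_bound N v; rewrite -kap_qE sqn_one_add_sq.
have := sqn_ge0 hd (a (kap_q N v)); have := sqn_ge0 hd (a (a (kap_q N v))).
lra.
Qed.

(** The bound involves neither [L] nor [N]. For q = [kap_q N v], |q|^2 + 2 |a q|^2 + |a^2 q|^2 = |q
    + a^2 q|^2 <= 4 |v|^2, hence |2 a q|^2 <= 8 |v|^2. *)
Lemma kap_g_bound N : lbounded dot 8 (kap_g N).
Proof.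
move=> v; have := kap_res_bound N v; rewrite -kap_qE sqn_one_add_sq /kap_g [sqn (2%:C *: _)](sqnZr hd).
have := sqn_ge0 hd (kap_q N v); have := sqn_ge0 hd (a (a (kap_q N v))).
lra.
Qed.

Lemma kap_q_lin N : linear (kap_q N).
Proof.
move=> c u v; rewrite /kap_q scalerA [c * _]mulrC -scalerA -scalerDr; congr (_ *: _).
rewrite scaler_sumr -big_split; apply: eq_bigr => k _; exact: iter_lin.
Qed.

Lemma kap_g_lin N : linear (kap_g N).
Proof.
move=> c u v; rewrite /kap_g kap_q_lin la scalerDr; congr (_ + _).
by rewrite !scalerA mulrC.
Qed.

Lemma a_kap_r v : a (kap_r v) = kap_r (a v).
Proof. by rewrite /kap_r (linB la) (linZ la) (linD la). Qed.

Lemma a_kap_q N v : a (kap_q N v) = kap_q N (a v).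
Proof.
rewrite /kap_q (linZ la) (lin_sum la); congr (_ *: _); apply: eq_bigr => k _.
by elim: (nat_of_ord k) => // m IH; rewrite !iterS a_kap_r IH.
Qed.

Lemma kap_r_sa u v : rdot (kap_r u) v = rdot u (kap_r v).
Proof.
by rewrite /kap_r (rdotBl hd) (rdotBr hd) (rdotZl hd) (rdotZr hd) (rdotDl hd) (rdotDr hd) !sa.
Qed.

Lemma rdot_sum_l (J : Type) (s : seq J) (F : J -> V) v :
  rdot (\sum_(j <- s) F j) v = \sum_(j <- s) rdot (F j) v.
Proof.
apply: (big_morph (rdot^~ v)) => [x y|]; [exact: rdotDl|exact: rdot0l].
Qed.

Lemma kap_q_sa N u v : rdot (kap_q N u) v = rdot u (kap_q N v).
Proof.
rewrite /kap_q (rdotZl hd) (rdotZr hd); congr (_ * _).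
rewrite (rdotC hd u) !rdot_sum_l; apply: eq_bigr => k _; rewrite [RHS](rdotC hd).
elim: (nat_of_ord k) u v => // m IH u v; by rewrite iterSr IH kap_r_sa.
Qed.

Lemma kap_g_sa N u v : rdot (kap_g N u) v = rdot u (kap_g N v).
Proof.
by rewrite /kap_g (rdotZl hd) (rdotZr hd) sa kap_q_sa -a_kap_q.
Qed.

(** For a = p the function 2 a / (1 + a^2) is p. The error is measured against p at the two vectors
    [v] and [p v] only, which is what strong density can provide. *)
Lemma kap_g_sub N p v (d : R) : linear p -> (forall u, p (p u) = p u) ->
  sqn (a v - p v) <= d -> sqn (a (p v) - p v) <= d ->
  sqn (kap_g N v - p v) <= 88 * d + 4 * kap_rho ^+ N * sqn (p v).
Proof.
move=> lp pp d1 d2.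
pose w := (2^-1)%:C *: p v; have [u hu] : exists u, u = v - w by exists (v - w).
have w2 : w + w = p v by rewrite /w -scalerDr half_double.
have pw : p w = w by rewrite /w (linZ lp) pp.
have pu : p u = w by rewrite hu (linB lp) pw -w2 addrK.
have uv : u + w = v by rewrite hu subrK.
pose q := kap_q N; have lq : linear q by exact: kap_q_lin.
have aq x : a (q x) = q (a x) by exact: a_kap_q.
have qE x : q x = x - iter N kap_r x - a (a (q x)) by rewrite -kap_qE addrK.
have gE x : kap_g N x = 2%:C *: a (q x) by [].
have bq x : sqn (q x) <= 4 * sqn x by exact: kap_q_bound.
clearbody q.
(* Here u = (1 + p^2)^-1 v and w = p u = p v / 2, so this is a resolvent identity whose remainder is
   the truncation term of the Neumann series. Its three terms contribute 80 d, 8 d and 4 rho^N |p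
   v|^2. *)
have E : kap_g N v - p v = 2%:C *: q (a u - p u) - (kap_g N (a w - w) + 2%:C *: iter N kap_r w).
  rewrite !gE.
  have -> : p v = 2%:C *: w by rewrite -w2; lmod_ring R[i].
  rewrite -{1}uv pu (linD lq) (linD la) !(linB lq) (linB la) !aq.
  have h := qE w; rewrite !aq in h.
  have h' : q (a (a w)) = w - iter N kap_r w - q w by rewrite h; lmod_ring R[i].
  rewrite h'; lmod_ring R[i].
rewrite E; apply: le_trans (sqnB_le hd _ _) _.
have lk := linZ (kap_g_lin N) (2^-1)%:C.
have b1 := bq (a u - p u).
have b2 := kap_g_bound N (a w - w).
have b3 := sqnD_le hd (kap_g N (a w - w)) (2%:C *: iter N kap_r w).
have b4 := kap_r_iter N w.
have ws : sqn w = (1/4) * sqn (p v) by rewrite /w (sqnZr hd); congr (_ * _); field.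
have b5 : sqn (a w - w) <= (1/4) * d.
  have -> : a w - w = (2^-1)%:C *: (a (p v) - p v) by rewrite /w (linZ la) scalerBr.
  by rewrite (sqnZr hd) (_ : 2^-1 ^+ 2 = 1/4 :> R); [lra|field].
have b6 : sqn (a u - p u) <= 2 * d + 2 * ((1/4) * d).
  have -> : a u - p u = (a v - p v) - (a w - w).
    by rewrite pu hu (linB la) -w2; lmod_ring R[i].
  apply: le_trans (sqnB_le hd _ _) _; lra.
rewrite [sqn (2%:C *: iter _ _ _)](sqnZr hd) in b3.
rewrite [sqn (2%:C *: q _)](sqnZr hd).
rewrite ws in b4; lra.
Qed.
End Kaplansky.

(** * Noncommutative polynomials *)

Section NCPoly.
Variables (R : realType) (I : Type).

(** An unreduced list of monomials: only evaluations matter, so no quotient is taken. The boolean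
    [true] marks an adjoint. *)
Definition ncpoly := seq (R[i] * seq (I * bool)).
Implicit Types (P Q : ncpoly) (w : seq (I * bool)).

Definition nc_one : ncpoly := [:: (1, [::])].
Definition nc_scale (c : R[i]) P : ncpoly := [seq (c * t.1, t.2) | t <- P].
Definition nc_mul P Q : ncpoly := [seq (s.1 * t.1, s.2 ++ t.2) | s <- P, t <- Q].
Definition word_adj w : seq (I * bool) := rev [seq (l.1, ~~ l.2) | l <- w].
Definition nc_adj P : ncpoly := [seq (t.1^*, word_adj t.2) | t <- P].
Definition nc_var i : ncpoly := [:: (1, [:: (i, false)])].
Definition nc_sym P : ncpoly := nc_scale (2^-1)%:C (P ++ nc_adj P).
Definition nc_deg P := \max_(t <- P) size t.2.

Definition nsq (c : R[i]) : R := complex.Re c ^+ 2 + complex.Im c ^+ 2.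

Lemma nsq_ge0 c : 0 <= nsq c. Proof. by rewrite addr_ge0 ?sqr_ge0. Qed.

(** Bounds the squared norm of an evaluation in every representation whose letters have squared norm
    at most [L]; the factors 2 come from [sqnD_le]. *)
Fixpoint nc_bound (L : R) P : R :=
  if P is t :: P' then 2 * (nsq t.1 * L ^+ size t.2) + 2 * nc_bound L P' else 0.

Lemma nc_bound_ge0 L P : 0 <= L -> 0 <= nc_bound L P.
Proof.
move=> L0; elim: P => //= t P IH.
by rewrite addr_ge0 // mulr_ge0 // mulr_ge0 ?nsq_ge0 ?exprn_ge0.
Qed.

Definition nc_r L P : ncpoly := nc_one ++ nc_scale (- ((1 + L)^-1)%:C) (nc_one ++ nc_mul P P).
Fixpoint nc_pow P k : ncpoly := if k is k'.+1 then nc_mul P (nc_pow P k') else nc_one.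
Fixpoint nc_geo P N : ncpoly := if N is n.+1 then nc_geo P n ++ nc_pow P n else [::].
Definition nc_q L N P : ncpoly := nc_scale ((1 + L)^-1)%:C (nc_geo (nc_r L P) N).
Definition nc_g L N P : ncpoly := nc_scale 2%:C (nc_mul P (nc_q L N P)).

(** The syntactic form of [kap_g] at the symmetrised polynomial, so that one polynomial can be
    evaluated both in M and on microstates. *)
Definition nc_kap L N P : ncpoly := nc_g (nc_bound L (nc_sym P)) N (nc_sym P).

End NCPoly.

Section Rep.
Variables (R : realType) (I : Type) (V : lmodType R[i]) (x xs : I -> V -> V).
Implicit Types (P Q : ncpoly R I) (w : seq (I * bool)).

Definition word_ev w : V -> V :=
  foldr (fun l T => (if l.2 then xs l.1 else x l.1) \o T) idfun w.

(** The letters act by arbitrary families [x] and [xs] on an arbitrary space: the operators of the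
    generating set and the matrices of a microstate are the two instances. *)
Definition nc_ev P (v : V) : V := \sum_(t <- P) t.1 *: word_ev t.2 v.

Hypotheses (lx : forall i, linear (x i)) (lxs : forall i, linear (xs i)).

Lemma word_ev_lin w : linear (word_ev w).
Proof.
elim: w => [|[i b] w IH] //=.
by apply: linear_comp => //; case: b.
Qed.

Lemma word_ev_cat w1 w2 v : word_ev (w1 ++ w2) v = word_ev w1 (word_ev w2 v).
Proof. by elim: w1 => //= l w ->. Qed.

Lemma nc_ev_lin P : linear (nc_ev P).
Proof.
move=> c u v; rewrite /nc_ev scaler_sumr -big_split; apply: eq_bigr => t _.
by rewrite word_ev_lin scalerDr !scalerA mulrC.
Qed.

Lemma nc_ev_one v : nc_ev (nc_one R I) v = v.
Proof. by rewrite /nc_ev big_seq1 scale1r. Qed.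

Lemma nc_ev_var i v : nc_ev (nc_var R i) v = x i v.
Proof. by rewrite /nc_ev big_seq1 scale1r. Qed.

Lemma nc_ev_cat P Q v : nc_ev (P ++ Q) v = nc_ev P v + nc_ev Q v.
Proof. by rewrite /nc_ev big_cat. Qed.

Lemma nc_ev_scale c P v : nc_ev (nc_scale c P) v = c *: nc_ev P v.
Proof. by rewrite /nc_ev big_map scaler_sumr; apply: eq_bigr => t _; rewrite scalerA. Qed.

Lemma nc_ev_mul P Q v : nc_ev (nc_mul P Q) v = nc_ev P (nc_ev Q v).
Proof.
rewrite /nc_ev big_allpairs_dep; apply: eq_bigr => s _.
rewrite (lin_sum (word_ev_lin _)) scaler_sumr; apply: eq_bigr => t _.
by rewrite (linZ (word_ev_lin _)) scalerA word_ev_cat.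
Qed.

Lemma nc_ev_r L P v : nc_ev (nc_r L P) v = kap_r (nc_ev P) L v.
Proof.
by rewrite /nc_r nc_ev_cat nc_ev_scale nc_ev_cat nc_ev_mul !nc_ev_one scaleNr.
Qed.

Lemma nc_ev_g L N P v : nc_ev (nc_g L N P) v = kap_g (nc_ev P) L N v.
Proof.
rewrite nc_ev_scale nc_ev_mul nc_ev_scale; congr (_ *: nc_ev _ (_ *: _)).
elim: N => [|N IH]; first by rewrite big_ord0 /nc_ev big_nil.
rewrite /= nc_ev_cat IH big_ord_recr; congr (_ + _).
by elim: (N) => [|k IHk] /=; rewrite ?nc_ev_one // nc_ev_mul IHk nc_ev_r.
Qed.

Variable dot : V -> V -> R[i].
Hypothesis hd : prehilbert dot.
Hypothesis adjx : forall i u v, re_dot dot (x i u) v = re_dot dot u (xs i v).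

Lemma word_ev_adj w u v : re_dot dot (word_ev w u) v = re_dot dot u (word_ev (word_adj w) v).
Proof.
elim: w u v => [|[i b] w IH] u v //=.
rewrite /word_adj /= rev_cons -cats1 word_ev_cat -IH /=.
case: b => /=; last by rewrite adjx.
by rewrite (rdotC hd) -adjx (rdotC hd).
Qed.

Lemma nc_ev_adj P u v : re_dot dot (nc_ev P u) v = re_dot dot u (nc_ev (nc_adj P) v).
Proof.
rewrite (rdotC hd) /nc_ev big_map.
have -> : re_dot dot v (\sum_(t <- P) t.1 *: word_ev t.2 u) =
   \sum_(t <- P) re_dot dot v (t.1 *: word_ev t.2 u).
  by apply: (big_morph (re_dot dot v)) => [y z|]; [exact: rdotDr|exact: rdot0r].
have -> : re_dot dot u (\sum_(t <- P) t.1^* *: word_ev (word_adj t.2) v) =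
   \sum_(t <- P) re_dot dot u (t.1^* *: word_ev (word_adj t.2) v).
  by apply: (big_morph (re_dot dot u)) => [y z|]; [exact: rdotDr|exact: rdot0r].
apply: eq_bigr => t _; rewrite (rdotC hd).
have -> : re_dot dot (t.1 *: word_ev t.2 u) v = re_dot dot (word_ev t.2 u) (t.1^* *: v).
  by rewrite /re_dot (dotZl hd) (dotZr hd) conjCK.
by rewrite word_ev_adj (linZ (word_ev_lin _)).
Qed.

Lemma nc_ev_sym P u v : re_dot dot (nc_ev (nc_sym P) u) v = re_dot dot u (nc_ev (nc_sym P) v).
Proof.
rewrite !nc_ev_scale !nc_ev_cat (rdotZl hd) (rdotZr hd) (rdotDl hd) (rdotDr hd).
have h : re_dot dot (nc_ev (nc_adj P) u) v = re_dot dot u (nc_ev P v) by rewrite (rdotC hd) -nc_ev_adj (rdotC hd).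
by rewrite h nc_ev_adj addrC.
Qed.

Variable L : R.
Hypotheses (L0 : 0 <= L) (bx : forall i, lbounded dot L (x i)) (bxs : forall i, lbounded dot L (xs i)).

Lemma word_ev_bound w : lbounded dot (L ^+ size w) (word_ev w).
Proof.
elim: w => [|[i b] w IH] /=; first by move=> v; rewrite mul1r.
by rewrite exprS; apply: lbounded_comp => //; case: b.
Qed.

Lemma nc_ev_bound P : lbounded dot (nc_bound L P) (nc_ev P).
Proof.
elim: P => [|t P IH] v /=; first by rewrite /nc_ev big_nil (sqn0 hd) mul0r.
have -> : nc_ev (t :: P) v = t.1 *: word_ev t.2 v + nc_ev P v by rewrite /nc_ev big_cons.
apply: le_trans (sqnD_le hd _ _) _; have h1 := IH v.
have h2 : sqnorm dot (t.1 *: word_ev t.2 v) <= nsq t.1 * (L ^+ size t.2 * sqnorm dot v).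
  rewrite (sqnZ hd); apply: ler_wpM2l; [exact: nsq_ge0|exact: word_ev_bound].
move: h1 h2; set y := sqnorm dot v; set a := nc_bound L P; set b := nsq _; set c := L ^+ _ => h1 h2.
have -> : (2 * (b * c) + 2 * a) * y = 2 * (b * (c * y)) + 2 * (a * y) by ring.
by lra.
Qed.

Lemma nc_kap_bound N P : lbounded dot 8 (nc_ev (nc_kap L N P)).
Proof.
move=> v; rewrite nc_ev_g; apply: kap_g_bound => //.
- exact: nc_bound_ge0.
- exact: nc_ev_lin.
- exact: nc_ev_bound.
- exact: nc_ev_sym.
Qed.

Lemma nc_kap_sa N P u v :
  re_dot dot (nc_ev (nc_kap L N P) u) v = re_dot dot u (nc_ev (nc_kap L N P) v).
Proof.
rewrite !nc_ev_g; apply: kap_g_sa => //.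
- exact: nc_ev_lin.
- exact: nc_ev_sym.
Qed.

Lemma nc_kap_sub N P p v (d : R) : linear p -> (forall u, p (p u) = p u) ->
  sqnorm dot (nc_ev (nc_sym P) v - p v) <= d -> sqnorm dot (nc_ev (nc_sym P) (p v) - p v) <= d ->
  sqnorm dot (nc_ev (nc_kap L N P) v - p v)
    <= 88 * d + 4 * kap_rho (nc_bound L (nc_sym P)) ^+ N * sqnorm dot (p v).
Proof.
move=> lp pp h1 h2; rewrite nc_ev_g; apply: kap_g_sub => //.
- exact: nc_bound_ge0.
- exact: nc_ev_lin.
- exact: nc_ev_bound.
- exact: nc_ev_sym.
Qed.

End Rep.

(** * Commutants and density *)

Section OrthoProjection.
Variables (R : realType) (V : lmodType R[i]) (dot : V -> V -> R[i]).
Hypothesis hd : prehilbert dot.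
Hypothesis hc : sqn_complete dot.
Hypothesis nd : forall u, sqnorm dot u = 0 -> u = 0.
Local Notation sqn := (sqnorm dot).
Local Notation rdot := (re_dot dot).

Definition csubspace (W : set V) :=
  W 0 /\ forall c u v, W u -> W v -> W (c *: u + v).

Definition sqn_closure (W : set V) z := forall e : R, 0 < e -> exists2 w, W w & sqn (z - w) <= e.

Variable W : set V.
Hypothesis sW : csubspace W.

Lemma sqn_closure_self w : W w -> sqn_closure W w.
Proof. by move=> Ww e e0; exists w; rewrite // subrr (sqn0 hd) ltW. Qed.

Lemma sqn_closure_lin c u v : sqn_closure W u -> sqn_closure W v -> sqn_closure W (c *: u + v).
Proof.
move=> hu hv e e0; have n0 := nsq_ge0 c.
have c0 : 0 < 4 * (nsq c + 1) by lra.
have e1 : 0 < e / (4 * (nsq c + 1)) by rewrite divr_gt0.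
have e2 : 0 < e / 4 by lra.
have [u' Wu' h1] := hu _ e1; have [v' Wv' h2] := hv _ e2.
exists (c *: u' + v'); first by case: sW => _; apply.
have -> : c *: u + v - (c *: u' + v') = c *: (u - u') + (v - v') by lmod_ring R[i].
apply: le_trans (sqnD_le hd _ _) _; rewrite (sqnZ hd) -/(nsq c).
have : nsq c * sqn (u - u') <= nsq c * (e / (4 * (nsq c + 1))) by rewrite ler_wpM2l.
have : nsq c * (e / (4 * (nsq c + 1))) <= e / 4.
  rewrite mulrA ler_pdivrMr //; nra.
lra.
Qed.

Lemma rdot0_sqn z w : rdot z w = 0 -> sqn z <= sqn (z - w).
Proof. by move=> h; rewrite (sqnB hd) h mulr0 subr0 lerDl; exact: sqn_ge0. Qed.

Lemma sqn_closure_ortho z : sqn_closure W z -> (forall w, W w -> rdot z w = 0) -> z = 0.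
Proof.
move=> hz ho; apply: nd; apply: le_anti; rewrite (sqn_ge0 hd) andbT.
apply: (@le0_small _ _ 1) => // e e0; have [w Ww hw] := hz _ e0.
by rewrite mul1r; apply: le_trans hw; apply: rdot0_sqn; exact: ho.
Qed.

(** The last clause, uniqueness of the point of the closure, is the tool by which linearity and
    commutation are later read off. *)
Lemma ortho_projection : exists E : V -> V,
  [/\ linear E, forall v, sqn_closure W (E v), forall v w, W w -> rdot (v - E v) w = 0 &
      forall v y, sqn_closure W y -> (forall w, W w -> rdot (v - y) w = 0) -> E v = y].
Proof.
have rW : rsubspace W.
  case: sW => W0 WL; split => //.
    by move=> u v Wu Wv; rewrite -[u]scale1r; apply: WL.
  by move=> t u Wu; rewrite -[_ *: _]addr0; apply: WL.
have /choice [E hE] : forall v, exists w, sqn_closure W w /\ forall w', W w' -> rdot (v - w) w' = 0.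
  by move=> v; exact: projection_theorem.
have uniq v y : sqn_closure W y -> (forall w, W w -> rdot (v - y) w = 0) -> E v = y.
  move=> hy ho; have [h1 h2] := hE v; apply/eqP; rewrite -subr_eq0; apply/eqP.
  apply: sqn_closure_ortho.
    have -> : E v - y = (-1) *: y + E v by lmod_ring R[i].
    exact: sqn_closure_lin.
  move=> w Ww; have -> : E v - y = (v - y) - (v - E v) by lmod_ring R[i].
  by rewrite (rdotBl hd) ho // h2 // subrr.
exists E; split => //; last 2 first.
- by move=> v; case: (hE v).
- by move=> v; case: (hE v).
move=> c u v; apply: uniq.
  by apply: sqn_closure_lin; case: (hE u); case: (hE v).
move=> w Ww.
have -> : c *: u + v - (c *: E u + E v) = c *: (u - E u) + (v - E v) by lmod_ring R[i].
have [_ h1] := hE u; have [_ h2] := hE v.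
rewrite (rdotDl hd) h2 // addr0.
(* The scalar is moved to the side of the subspace, because orthogonality is known for real parts
   only. *)
have -> : rdot (c *: (u - E u)) w = rdot (u - E u) (c^* *: w).
  by rewrite /re_dot (dotZl hd) (dotZr hd) conjCK.
by apply: h1; rewrite -[_ *: _]addr0; case: sW => W0; apply.
Qed.

Variable E : V -> V.
Hypothesis hE : [/\ linear E, forall v, sqn_closure W (E v), forall v w, W w -> rdot (v - E v) w = 0 &
      forall v y, sqn_closure W y -> (forall w, W w -> rdot (v - y) w = 0) -> E v = y].

Lemma oproj_id w : W w -> E w = w.
Proof.
case: hE => _ _ _ h Ww; apply: h; first exact: sqn_closure_self.
by move=> w' _; rewrite subrr (rdot0l hd).
Qed.

Lemma oproj_closure z : sqn_closure W z -> E z = z.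
Proof.
case: hE => _ _ _ h Ww; apply: h => // w' _; by rewrite subrr (rdot0l hd).
Qed.

Lemma closure_ortho z y : sqn_closure W z -> (forall w, W w -> rdot y w = 0) -> rdot y z = 0.
Proof.
move=> hz ho; apply/eqP; rewrite -sqrf_eq0; apply/eqP; apply: le_anti; rewrite sqr_ge0 andbT.
apply: (@le0_small _ _ (sqn y)); first exact: sqn_ge0.
move=> e e0; have [w Ww hw] := hz _ e0.
have -> : rdot y z = rdot y (z - w) by rewrite (rdotBr hd) (ho w Ww) subr0.
apply: le_trans (cauchy_schwarz hd _ _) _; apply: ler_wpM2l => //; exact: sqn_ge0.
Qed.

Lemma oproj_pyth v z : sqn_closure W z -> rdot (v - E v) z = 0.
Proof. by case: hE => _ _ h _ hz; apply: closure_ortho => // w; exact: h. Qed.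

Lemma oproj_sa u v : rdot (E u) v = rdot u (E v).
Proof.
case: hE => _ hcl _ _.
have h1 := oproj_pyth u (hcl v); have h2 := oproj_pyth v (hcl u).
by move: h1 h2; rewrite !(rdotBl hd) (rdotC hd (E v)) (rdotC hd v); lra.
Qed.

Lemma oproj_idem v : E (E v) = E v.
Proof. by case: hE => _ hcl _ _; apply: oproj_closure. Qed.

Lemma oproj_sqn v : sqn v = sqn (E v) + sqn (v - E v).
Proof.
case: hE => _ hcl _ _.
have h := sqnD hd (v - E v) (E v); rewrite subrK oproj_pyth ?mulr0 ?addr0 in h => //.
by rewrite h addrC.
Qed.

Lemma oproj_contract v : sqn (E v) <= sqn v.
Proof. by rewrite (oproj_sqn v) lerDl; exact: sqn_ge0. Qed.

(** [a] maps the closure of [W] into itself, and a (v - E v) is orthogonal to [W] because the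
    adjoint [s] also preserves [W]; uniqueness identifies a (E v) with the projection of a v. *)
Lemma oproj_comm (a s : V -> V) (C : R) : linear a -> lbounded dot C a ->
  (forall u v, rdot (a u) v = rdot u (s v)) ->
  (forall w, W w -> W (a w)) -> (forall w, W w -> W (s w)) -> forall v, E (a v) = a (E v).
Proof.
move=> la ba as_ Wa Ws v; case: hE => _ h1 h2 h3; apply: h3.
  move=> e e0; have n0 : 0 < `|C| + 1 by have := normr_ge0 C; lra.
  have e1 : 0 < e / (`|C| + 1) by rewrite divr_gt0.
  have [w Ww hw] := h1 v _ e1; exists (a w); first exact: Wa.
  rewrite -(linB la); apply: le_trans (ba _) _.
  have : C * sqn (E v - w) <= (`|C| + 1) * sqn (E v - w).
    by apply: ler_wpM2r; [exact: sqn_ge0|have := ler_norm C; lra].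
  move/le_trans; apply; by rewrite mulrC -ler_pdivlMr.
by move=> w Ww; rewrite -(linB la) as_ h2 //; exact: Ws.
Qed.

End OrthoProjection.

Section VonNeumann.
Variables (R : realType) (H : completeNormedModType R[i]).
Variable dot : {dot H for (@conjc R)}.
Hypothesis hH : hilbert dot.
Local Notation sqn := (sqnorm dot).
Local Notation rdot := (re_dot dot).
Let hd := prehilbert_dot hH.
Implicit Types (A M : set (H -> H)) (S T : H -> H).

Lemma bounded_lbounded T C : linear T -> lbounded dot C T -> bounded_op T.
Proof. by move=> lT bT; apply/(bounded_opP hH); split => //; exists C. Qed.

Lemma bounded_id : bounded_op (idfun : H -> H).
Proof. by apply: (@bounded_lbounded _ 1) => [|v]; [exact: linear_id|rewrite mul1r]. Qed.

Lemma bounded_comp S T : bounded_op S -> bounded_op T -> bounded_op (S \o T).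
Proof.
move=> bS bT; have [C C0 hC] := bounded_ex hH bS; have [D D0 hD] := bounded_ex hH bT.
apply: (@bounded_lbounded _ (C * D)); first by apply: linear_comp; apply: bounded_linear.
exact: lbounded_comp.
Qed.

Lemma bounded_add S T : bounded_op S -> bounded_op T -> bounded_op (S + T).
Proof.
move=> bS bT; have [C C0 hC] := bounded_ex hH bS; have [D D0 hD] := bounded_ex hH bT.
apply: (@bounded_lbounded _ (2 * C + 2 * D)); first by apply: linear_add; apply: bounded_linear.
exact: lboundedD.
Qed.

Lemma bounded_scale c T : bounded_op T -> bounded_op (c *: T).
Proof.
move=> bT; have [D D0 hD] := bounded_ex hH bT.
apply: (@bounded_lbounded _ (nsq c * D)); first by apply: linear_scale; apply: bounded_linear.
exact: lboundedZ.
Qed.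

Lemma bounded_adj T : bounded_op T -> bounded_op (adj dot T).
Proof. by move=> /(adjP hH) []. Qed.

Lemma adjK T : bounded_op T -> adj dot (adj dot T) = T.
Proof.
move=> bT; apply: (adj_unique hH); first exact: bounded_adj.
by move=> u v; rewrite (rdotC hd) -(rdot_adj hH) // (rdotC hd).
Qed.

Lemma adj_comp S T : bounded_op S -> bounded_op T -> adj dot (S \o T) = adj dot T \o adj dot S.
Proof.
move=> bS bT; apply: (adj_unique hH); first exact: bounded_comp.
by move=> u v /=; rewrite (rdot_adj hH) // (rdot_adj hH).
Qed.

Lemma adj_id : adj dot (idfun : H -> H) = idfun.
Proof. by apply: (adj_unique hH); first exact: bounded_id. Qed.

Lemma commutantP A T : commutant A T <-> bounded_op T /\ forall S, A S -> forall v, T (S v) = S (T v).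
Proof.
split=> [[bT h]|[bT h]]; split => // S AS; last by apply/funext => v /=; exact: h.
by move=> v; rewrite -[T (S v)]/((T \o S) v) h.
Qed.

Lemma commutant_id A : (forall S, A S -> linear S) -> commutant A idfun.
Proof. by move=> lA; apply/commutantP; split => //; exact: bounded_id. Qed.

Lemma commutant_lin A c S T : (forall U, A U -> linear U) ->
  commutant A S -> commutant A T -> commutant A (c *: S + T).
Proof.
move=> lA /commutantP [bS hS] /commutantP [bT hT]; apply/commutantP; split.
  by apply: bounded_add => //; exact: bounded_scale.
move=> U AU v; rewrite -![(c *: S + T) _]/(c *: S _ + T _) (hS _ AU) (hT _ AU).
by rewrite (lA _ AU).
Qed.

Lemma commutant_comp A S T : commutant A S -> commutant A T -> commutant A (S \o T).
Proof.
move=> /commutantP [bS hS] /commutantP [bT hT]; apply/commutantP; split; first exact: bounded_comp.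
by move=> U AU v /=; rewrite (hT _ AU) (hS _ AU).
Qed.

Lemma commutant_adj A S : (forall U, A U -> bounded_op U) -> (forall U, A U -> A (adj dot U)) ->
  commutant A S -> commutant A (adj dot S).
Proof.
move=> bA aA /commutantP [bS hS]; apply/commutantP; split; first exact: bounded_adj.
move=> U AU v; apply: (rdot_inj hH) => w.
have bU := bA _ AU; have h := hS _ (aA _ AU) w.
have hU x y : rdot (adj dot U x) y = rdot x (U y).
  by rewrite (rdotC hd) -(rdot_adj hH) // (rdotC hd).
by rewrite (rdotC hd) [RHS](rdotC hd) -(rdot_adj hH) // -!hU -(rdot_adj hH) // h.
Qed.

Lemma commutant_sub A B : A `<=` B -> commutant B `<=` commutant A.
Proof. by move=> AB T [bT h]; split => // S /AB; exact: h. Qed.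

Lemma sub_bicommutant A : (forall T, A T -> bounded_op T) -> A `<=` commutant (commutant A).
Proof. move=> bA T AT; apply/commutantP; split; [exact: bA|move=> S /commutantP [_ h] v; by rewrite h]. Qed.

Lemma commutant3 A : (forall T, A T -> bounded_op T) ->
  commutant (commutant (commutant A)) = commutant A.
Proof.
move=> bA; apply/seteqP; split; first by apply: commutant_sub; exact: sub_bicommutant.
by apply: sub_bicommutant => T [].
Qed.

Lemma bicommutant_vn A : (forall T, A T -> bounded_op T) -> (forall T, A T -> A (adj dot T)) ->
  von_neumann_algebra dot (commutant (commutant A)).
Proof.
move=> bA aA; split; last by rewrite (commutant3 bA).
move=> T; apply: commutant_adj; first by move=> U [].
by move=> U; apply: commutant_adj.
Qed.

End VonNeumann.

Section Density.
Variables (R : realType) (H : completeNormedModType R[i]).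
Variable dot : {dot H for (@conjc R)}.
Hypothesis hH : hilbert dot.
Local Notation sqn := (sqnorm dot).
Local Notation rdot := (re_dot dot).
Let hd := prehilbert_dot hH.

Lemma sqn_fdot_eq0 (I : finType) (u : I -> H) : sqnorm (fdot dot (I := I)) u = 0 -> u = 0.
Proof.
move=> h; apply/funext => i; apply: (sqn_eq0 hH); apply: le_anti; rewrite (sqn_ge0 hd) andbT.
by apply: (sqn_fdot_le hd); rewrite h.
Qed.

(** Von Neumann's amplification argument: project, in the direct sum over [I], onto the closure of
    the orbit of [xi] under [A]. *)
Lemma bicommutant_density (A : set (H -> H)) (I : finType) (xi : I -> H) (T : H -> H) (e : R) :
  (forall a, A a -> bounded_op a) -> (forall a, A a -> A (adj dot a)) ->
  A idfun -> (forall c a b, A a -> A b -> A (c *: a + b)) ->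
  (forall a b, A a -> A b -> A (a \o b)) ->
  commutant (commutant A) T -> 0 < e ->
  exists2 a, A a & forall i, sqn (T (xi i) - a (xi i)) <= e.
Proof.
move=> bA aA Aid Alin Amul /commutantP [bT hT] e0.
pose W := [set (fun i => a (xi i)) | a in A] : set (I -> H).
have hf := prehilbert_fdot I hd.
have sW : csubspace W.
  split; last by move=> c _ _ [a Aa <-] [b Ab <-]; exists (c *: a + b); first exact: Alin.
  exists ((-1) *: idfun + idfun); first exact: Alin.
  apply/funext => i; rewrite -[LHS]/((-1) *: xi i + xi i).
  by rewrite scaleN1r addNr.
have [E hE] := ortho_projection hf (complete_fdot hd (complete_dot hH)) (@sqn_fdot_eq0 I) sW.
have [lE cE _ _] := hE.
pose inj j (u : H) : I -> H := fun i => if i == j then u else 0.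
have injZ j c u v : inj j (c *: u + v) = c *: inj j u + inj j v.
  apply/funext => i; rewrite -[RHS]/(c *: inj j u i + inj j v i) /inj.
  by case: eqP => // _; rewrite scaler0 addr0.
have inj_sqn j u : sqnorm (fdot dot (I := I)) (inj j u) = sqn u.
  rewrite /sqnorm rdot_fdot (bigD1 j) //= /inj eqxx big1 ?addr0 // => i /negPf ->.
  by rewrite (rdot0l hd).
(* The matrix entries of [E]. They lie in the commutant of [A], so the amplification of T commutes
   with [E]. *)
pose Em i j u := E (inj j u) i.
have bEm i j : bounded_op (Em i j).
  apply: (@bounded_lbounded _ _ _ hH _ 1); first by move=> c u v; rewrite /Em injZ lE.
  move=> u; rewrite mul1r -(inj_sqn j u).
  apply: (sqn_fdot_le hd); exact: (oproj_contract hf hE).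
have cEm i j : commutant A (Em i j).
  apply/commutantP; split => // a Aa v.
  pose da (u : I -> H) := fun k => a (u k).
  pose ds (u : I -> H) := fun k => adj dot a (u k).
  have ba := bA _ Aa; have [C C0 hC] := bounded_ex hH ba.
  have la := bounded_linear ba.
  have -> : Em i j (a v) = E (da (inj j v)) i.
    rewrite /Em; congr (E _ i); apply/funext => k; rewrite /da /inj.
    by case: eqP => // _; rewrite (lin0 la).
  rewrite (oproj_comm hf hE (a := da) (s := ds) (C := C)) //.
  - move=> c u w; apply/funext => k.
    by rewrite -[RHS]/(c *: da u k + da w k) /da -la.
  - move=> u; rewrite /sqnorm !rdot_fdot mulr_sumr; apply: ler_sum => k _; exact: hC.
  - by move=> u w; rewrite !rdot_fdot; apply: eq_bigr => k _; exact: rdot_adj.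
  - move=> _ [b Ab <-]; exists (a \o b) => //; exact: Amul.
  - by move=> _ [b Ab <-]; exists (adj dot a \o b) => //; apply: Amul => //; exact: aA.
have lT := bounded_linear bT.
have inj_sum (v : I -> H) : v = \sum_j inj j (v j).
  apply/funext => i; rewrite fct_sumE (bigD1 i) //= /inj eqxx big1 ?addr0 // => j /negPf ji.
  by rewrite eq_sym ji.
have E_sum v i : E v i = \sum_j Em i j (v j).
  by rewrite {1}(inj_sum v) (lin_sum lE) fct_sumE.
have ET (v : I -> H) : E (fun k => T (v k)) = fun k => T (E v k).
  apply/funext => i; rewrite !E_sum (lin_sum lT); apply: eq_bigr => j _.
  by rewrite (hT _ (cEm i j)).
(* [A] contains the identity, so E xi = xi; hence T xi = T E xi = E T xi lies in the closure of the
   orbit. *)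
have Wxi : W xi by exists idfun.
have := cE (fun k => T (xi k)); rewrite ET (oproj_id hf hE Wxi) => /(_ e e0) [_ [a Aa <-] h].
by exists a => // i; have := sqn_fdot_le hd h i.
Qed.

End Density.

Section NCDensity.
Variables (R : realType) (H : completeNormedModType R[i]).
Variable dot : {dot H for (@conjc R)}.
Hypothesis hH : hilbert dot.
Local Notation sqn := (sqnorm dot).
Local Notation rdot := (re_dot dot).
Let hd := prehilbert_dot hH.
Variables (X : {fset (H -> H)}).
Hypothesis bX : forall x : X, bounded_op (val x).

Definition letter (x : X) : H -> H := val x.
Definition letter_adj (x : X) : H -> H := adj dot (val x).
Local Notation ev := (nc_ev letter letter_adj).

Lemma letter_lin x : linear (letter x). Proof. exact: bounded_linear. Qed.
Lemma letter_adj_lin x : linear (letter_adj x).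
Proof. by apply: bounded_linear; exact: bounded_adj. Qed.

Lemma letter_adjP x u v : rdot (letter x u) v = rdot u (letter_adj x v).
Proof. exact: rdot_adj. Qed.

Lemma letter_bound : exists2 L : R, 0 <= L &
  forall x, lbounded dot L (letter x) /\ lbounded dot L (letter_adj x).
Proof.
have /choice [L hL] : forall x : X, exists L : R, 0 <= L /\
    (lbounded dot L (letter x) /\ lbounded dot L (letter_adj x)).
  move=> x; have [C C0 hC] := bounded_ex hH (bX x).
  have [D D0 hD] := bounded_ex hH (bounded_adj hH (bX x)).
  exists (C + D); split; first exact: addr_ge0.
  split; [apply: (lbounded_le hd _ hC)|apply: (lbounded_le hd _ hD)]; lra.
exists (\sum_x L x); first by apply: sumr_ge0 => x _; case: (hL x).
move=> x; have le : L x <= \sum_x L x.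
  by rewrite (bigD1 x) //= lerDl sumr_ge0 // => y _; case: (hL y).
by have [_ [h1 h2]] := hL x; split; [exact: (lbounded_le hd le)|exact: (lbounded_le hd le)].
Qed.

Lemma nc_ev_bounded P : bounded_op (ev P).
Proof.
have [L L0 hL] := letter_bound.
apply: (@bounded_lbounded _ _ _ hH _ (nc_bound L P)).
  by apply: nc_ev_lin => x; [exact: letter_lin|exact: letter_adj_lin].
by apply: nc_ev_bound => // x; case: (hL x).
Qed.

Lemma nc_ev_adjE P : adj dot (ev P) = ev (nc_adj P).
Proof.
apply: (adj_unique hH); first exact: nc_ev_bounded.
by apply: nc_ev_adj => //; [exact: letter_lin|exact: letter_adj_lin|exact: letter_adjP].
Qed.

Definition nc_alg : set (H -> H) := range ev.

Lemma nc_density (I : finType) (xi : I -> H) (T : H -> H) (e : R) :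
  commutant (commutant nc_alg) T -> 0 < e -> exists P, forall i, sqn (T (xi i) - ev P (xi i)) <= e.
Proof.
move=> hT e0.
have [_ [P _ <-] h] : exists2 a, nc_alg a & forall i, sqn (T (xi i) - a (xi i)) <= e.
  apply: (bicommutant_density hH) => //.
  - by move=> _ [P _ <-]; exact: nc_ev_bounded.
  - by move=> _ [P _ <-]; rewrite nc_ev_adjE; exists (nc_adj P).
  - by exists (nc_one R X) => //; apply/funext => v; rewrite nc_ev_one.
  - move=> c _ _ [P _ <-] [Q _ <-]; exists (nc_scale c P ++ Q) => //.
    by apply/funext => v; rewrite nc_ev_cat nc_ev_scale.
  - move=> _ _ [P _ <-] [Q _ <-]; exists (nc_mul P Q) => //.
    by apply/funext => v; rewrite nc_ev_mul //; [exact: letter_lin|exact: letter_adj_lin].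
by exists P.
Qed.

Lemma rdot_nc_sym P u v :
  rdot (ev (nc_sym P) u) v = 2^-1 * (rdot (ev P u) v + rdot u (ev P v)).
Proof.
rewrite nc_ev_scale nc_ev_cat (rdotZl hd) (rdotDl hd); congr (_ * (_ + _)).
rewrite (rdotC hd) -nc_ev_adj ?(rdotC hd u) //.
- exact: letter_lin.
- exact: letter_adj_lin.
- exact: letter_adjP.
Qed.

(* Strong density of the self-adjoint part: project onto the real subspace of the values of
   self-adjoint polynomials; the residual is orthogonal to the target by weak density. *)
Lemma nc_sym_density (I : finType) (xi : I -> H) (T : H -> H) (e : R) :
  commutant (commutant nc_alg) T -> (forall u v, rdot (T u) v = rdot u (T v)) -> 0 < e ->
  exists P, forall i, sqn (ev (nc_sym P) (xi i) - T (xi i)) <= e.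
Proof.
move=> hT sT e0.
pose W := [set (fun i => ev (nc_sym P) (xi i)) | P in [set: ncpoly R X]] : set (I -> H).
have hf := prehilbert_fdot I hd.
have sW : rsubspace W.
  split.
  - exists [::] => //; apply/funext => i; by rewrite /nc_ev big_nil.
  - move=> _ _ [P _ <-] [Q _ <-]; exists (P ++ Q) => //; apply/funext => i.
    rewrite -[RHS]/(ev (nc_sym P) (xi i) + ev (nc_sym Q) (xi i)).
    by rewrite !nc_ev_scale /nc_adj map_cat !nc_ev_cat; lmod_ring R[i].
  - move=> t _ [P _ <-]; exists (nc_scale t%:C P) => //; apply/funext => i.
    rewrite -[RHS]/(t%:C *: ev (nc_sym P) (xi i)).
    rewrite /nc_sym !nc_ev_scale !nc_ev_cat !nc_ev_scale.
    have -> : nc_adj (nc_scale t%:C P) = nc_scale t%:C (nc_adj P).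
      rewrite /nc_adj /nc_scale -!map_comp; apply: eq_map => s /=.
      by rewrite rmorphM; congr (_ * _, _); exact: conjc_real.
    by rewrite !nc_ev_scale; lmod_ring R[i].
pose v i := T (xi i).
have [w [hw ho]] := projection_theorem hf v (complete_fdot hd (complete_dot hH)) sW.
pose z := v - w.
have zi i : z i = v i - w i by [].
suff zw : re_dot (fdot dot (I:=I)) z v = 0.
  have z0 : z = 0.
    apply: (sqn_fdot_eq0 hH).
    have h : re_dot (fdot dot (I:=I)) z w = 0 by apply: (closure_ortho hf (W := W)).
    by rewrite /sqnorm {2}/z (rdotBr hf) zw h subrr.
  have [_ [P _ <-] h] := hw _ e0; exists P => i.
  have := sqn_fdot_le hd h i.
  have -> : (w - (fun i => ev (nc_sym P) (xi i))) i = v i - ev (nc_sym P) (xi i) - z i.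
    by rewrite zi -[LHS]/(w i - ev (nc_sym P) (xi i)); lmod_ring R[i].
  by rewrite z0 subr0 (sqnBC hd).
apply/eqP; rewrite -sqrf_eq0; apply/eqP; apply: le_anti; rewrite sqr_ge0 andbT.
pose S1 := sqnorm (fdot dot (I:=I)) z; pose S2 := sqnorm (fdot dot (I:=I)) xi.
have S10 : 0 <= S1 by exact: sqn_ge0.
have S20 : 0 <= S2 by exact: sqn_ge0.
apply: (@le0_small _ _ ((#|I|%:R) * (S1 + S2))); first by rewrite mulr_ge0 ?addr_ge0.
move=> d d0.
(* The residual z joins the test vectors, because symmetrising P moves it to the other side of the
   inner product. *)
pose eta (s : I + I) := match s with inl i => xi i | inr i => z i end.
have [P hP] := nc_density eta hT d0.
have h0 : re_dot (fdot dot (I:=I)) z (fun i => ev (nc_sym P) (xi i)) = 0 by apply: ho; exists P.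
pose f1 i := v i - ev P (xi i); pose f2 i := T (z i) - ev P (z i).
have small (f : I -> H) : (forall i, sqn (f i) <= d) -> sqnorm (fdot dot (I:=I)) f <= #|I|%:R * d.
  move=> hf1; rewrite /sqnorm rdot_fdot mulr_natl -sumr_const; apply: ler_sum => i _; exact: hf1.
have c1 := cauchy_schwarz hf f1 z; have c2 := cauchy_schwarz hf xi f2.
have s1 : sqnorm (fdot dot (I:=I)) f1 <= #|I|%:R * d by apply: small => i; exact: (hP (inl i)).
have s2 : sqnorm (fdot dot (I:=I)) f2 <= #|I|%:R * d by apply: small => i; exact: (hP (inr i)).
(* Orthogonality of z to the values of [nc_sym P] removes P, and the two errors of P, at xi and at
   z, remain. *)
have key : 2 * re_dot (fdot dot (I:=I)) z v = re_dot (fdot dot (I:=I)) f1 z + re_dot (fdot dot (I:=I)) xi f2.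
  have -> : re_dot (fdot dot (I:=I)) f1 z + re_dot (fdot dot (I:=I)) xi f2 =
    re_dot (fdot dot (I:=I)) f1 z + re_dot (fdot dot (I:=I)) xi f2
     + 2 * re_dot (fdot dot (I:=I)) z (fun i => ev (nc_sym P) (xi i)) by rewrite h0 mulr0 addr0.
  rewrite !rdot_fdot !mulr_sumr -!big_split; apply: eq_bigr => i _ /=.
  have e1 : rdot (f1 i) (z i) = rdot (v i) (z i) - rdot (ev P (xi i)) (z i) by rewrite (rdotBl hd).
  have e2 : rdot (xi i) (f2 i) = rdot (v i) (z i) - rdot (xi i) (ev P (z i)).
    by rewrite (rdotBr hd) -(sT (xi i) (z i)).
  by rewrite e1 e2 [rdot (z i) (ev _ _)](rdotC hd) rdot_nc_sym [rdot (z i) (v i)](rdotC hd); field.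
have : sqnorm (fdot dot (I:=I)) f1 * S1 <= #|I|%:R * d * S1 by apply: ler_wpM2r.
have : S2 * sqnorm (fdot dot (I:=I)) f2 <= S2 * (#|I|%:R * d) by apply: ler_wpM2l.
move: c1 c2 key; rewrite -/S1 -/S2.
move: (re_dot _ z v) (re_dot _ f1 z) (re_dot _ xi f2) => A B C c1 c2 key h1 h2.
have := sqr_ge0 (B - C).
have -> : A = (B + C) / 2 by lra.
nra.
Qed.
End NCDensity.

(** * Strong limits *)

Section Limits.
Variables (R : realType) (V : lmodType R[i]) (dot : V -> V -> R[i]).
Hypothesis hd : prehilbert dot.
Local Notation sqn := (sqnorm dot).
Local Notation rdot := (re_dot dot).
Local Notation cvg := (sqn_cvg dot).

Lemma sqn_cvg_lin c u v a b : cvg u a -> cvg v b -> cvg (fun n => c *: u n + v n) (c *: a + b).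
Proof.
move=> hu hv e e0; have n0 := nsq_ge0 c.
have c0 : 0 < 4 * (nsq c + 1) by lra.
have e1 : 0 < e / (4 * (nsq c + 1)) by rewrite divr_gt0.
have e2 : 0 < e / 4 by lra.
have [N1 h1] := hu _ e1; have [N2 h2] := hv _ e2.
exists (maxn N1 N2) => n; rewrite geq_max => /andP[/h1 {}h1 /h2 {}h2].
have -> : c *: u n + v n - (c *: a + b) = c *: (u n - a) + (v n - b) by lmod_ring R[i].
apply: le_trans (sqnD_le hd _ _) _; rewrite (sqnZ hd) -/(nsq c).
have : nsq c * sqn (u n - a) <= nsq c * (e / (4 * (nsq c + 1))) by rewrite ler_wpM2l.
have : nsq c * (e / (4 * (nsq c + 1))) <= e / 4.
  rewrite mulrA ler_pdivrMr //; nra.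
lra.
Qed.

Lemma sqn_cvg_map (T : V -> V) C u a : linear T -> lbounded dot C T -> cvg u a -> cvg (T \o u) (T a).
Proof.
move=> lT bT hu e e0; have n0 := normr_ge0 C; have c0 : 0 < `|C| + 1 by lra.
have e1 : 0 < e / (`|C| + 1) by rewrite divr_gt0.
have [N h] := hu _ e1; exists N => n /h {}h /=.
rewrite -(linB lT); apply: le_trans (bT _) _.
have : C * sqn (u n - a) <= (`|C| + 1) * sqn (u n - a).
  by apply: ler_wpM2r; [exact: sqn_ge0|have := ler_norm C; lra].
by move/le_trans; apply; rewrite mulrC -ler_pdivlMr.
Qed.

Lemma sqn_cvg_unique u a b : (forall x, sqn x = 0 -> x = 0) -> cvg u a -> cvg u b -> a = b.
Proof.
move=> nd ha hb; apply/eqP; rewrite -subr_eq0; apply/eqP; apply: nd.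
apply: le_anti; rewrite (sqn_ge0 hd) andbT; apply: (@le0_small _ _ 4) => // e e0.
have [N1 h1] := ha _ e0; have [N2 h2] := hb _ e0; pose n := maxn N1 N2.
have {}h1 := h1 n (leq_maxl _ _); have {}h2 := h2 n (leq_maxr _ _).
have -> : a - b = (u n - b) - (u n - a) by lmod_ring R[i].
by apply: le_trans (sqnB_le hd _ _) _; lra.
Qed.

Lemma sqn_cvg_rdot_le u a w (c : R) N0 : cvg u a ->
  (forall n, (N0 <= n)%N -> rdot (u n) w <= c) -> rdot a w <= c.
Proof.
move=> hu hle; rewrite leNgt; apply/negP => lt.
pose g := rdot a w - c; have g0 : 0 < g by rewrite subr_gt0.
have s0 := sqn_ge0 hd w; have s1 : 0 < 2 * (sqn w + 1) by lra.
have e0 : 0 < g ^+ 2 / (2 * (sqn w + 1)) by rewrite divr_gt0 // exprn_gt0.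
have [N h] := hu _ e0; pose n := maxn N N0.
have {}h := h n (leq_maxl _ _); have {}hle := hle n (leq_maxr _ _).
have := cauchy_schwarz hd (u n - a) w; rewrite (rdotBl hd) => cs.
have b : (rdot (u n) w - rdot a w) ^+ 2 >= g ^+ 2.
  have h1 : g <= rdot a w - rdot (u n) w by rewrite /g; lra.
  rewrite -[leRHS]sqrrN opprB; apply: lerXn2r => //; rewrite nnegrE; lra.
have : sqn (u n - a) * sqn w <= g ^+ 2 / (2 * (sqn w + 1)) * sqn w by rewrite ler_wpM2r.
have : g ^+ 2 / (2 * (sqn w + 1)) * sqn w <= g ^+ 2 / 2.
  rewrite mulrAC ler_pdivrMr //.
  have -> : g ^+ 2 / 2 * (2 * (sqn w + 1)) = g ^+ 2 * sqn w + g ^+ 2 by field.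
  have := exprn_gt0 2 g0; lra.
have := exprn_gt0 2 g0; lra.
Qed.

Lemma sqn_cvg_rdot u a w : cvg u a ->
  forall e : R, 0 < e -> exists N, forall n, (N <= n)%N -> (rdot (u n) w - rdot a w) ^+ 2 <= e.
Proof.
move=> hu e e0; have s0 := sqn_ge0 hd w; have s1 : 0 < sqn w + 1 by lra.
have e1 : 0 < e / (sqn w + 1) by rewrite divr_gt0.
have [N hN] := hu _ e1; exists N => n /hN h; rewrite -(rdotBl hd).
apply: le_trans (cauchy_schwarz hd _ _) _.
apply: (@le_trans _ _ (e / (sqn w + 1) * sqn w)); first by rewrite ler_wpM2r.
by rewrite mulrAC ler_pdivrMr //; lra.
Qed.

Lemma sqn_cvgN u a : cvg u a -> cvg (fun n => - u n) (- a).
Proof.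
move=> h e e0; have [N hN] := h _ e0; exists N => n /hN.
by have -> : - u n - - a = - (u n - a); [lmod_ring R[i]|rewrite (sqnN hd)].
Qed.

Lemma sqn_cvg_rdot_ge u a w (c : R) N0 : cvg u a ->
  (forall n, (N0 <= n)%N -> c <= rdot (u n) w) -> c <= rdot a w.
Proof.
move=> h hc; rewrite -lerN2 -(rdotNl hd); apply: (sqn_cvg_rdot_le (N0 := N0) (sqn_cvgN h)).
by move=> n nN; rewrite (rdotNl hd) lerN2 hc.
Qed.

End Limits.

(** * Order, resolvents and traces *)

Section Order.
Variables (R : realType) (H : completeNormedModType R[i]).
Variable dot : {dot H for (@conjc R)}.
Hypothesis hH : hilbert dot.
Local Notation sqn := (sqnorm dot).
Local Notation rdot := (re_dot dot).
Let hd := prehilbert_dot hH.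
Variable M : set (H -> H).
Hypothesis hM : von_neumann_algebra dot M.
Implicit Types (S T x : H -> H).
Local Notation sa := (self_adjoint dot M).

(** The real version of [le_op]; the two agree on self-adjoint operators of M, by [sa_le_op] and
    [le_op_fle]. *)
Definition fle S T := forall v, rdot (S v) v <= rdot (T v) v.

Lemma M_bounded T : M T -> bounded_op T.
Proof. by case: hM => _ <- []. Qed.

Lemma M_linear T : M T -> linear T.
Proof. by move=> /M_bounded; exact: bounded_linear. Qed.

Lemma M_adj T : M T -> M (adj dot T). Proof. by case: hM => h _; exact: h. Qed.

Let lC U : commutant M U -> linear U. Proof. by case=> bU _; exact: bounded_linear. Qed.

Lemma M_id : M idfun.
Proof. by case: hM => _ <-; apply: commutant_id. Qed.

Lemma M_lin c S T : M S -> M T -> M (c *: S + T).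
Proof. by case: hM => _ <-; apply: commutant_lin. Qed.

Lemma M_comp S T : M S -> M T -> M (S \o T).
Proof. by case: hM => _ <-; apply: commutant_comp. Qed.

Lemma M_zero : M 0.
Proof.
have := M_lin (-1) M_id M_id.
by rewrite (_ : -1 *: _ + _ = 0) // scaleN1r addNr.
Qed.

Lemma M_scale c S : M S -> M (c *: S).
Proof. by move=> h; have := M_lin c h M_zero; rewrite addr0. Qed.

Lemma M_add S T : M S -> M T -> M (S + T).
Proof. by move=> hS hT; have := M_lin 1 hS hT; rewrite scale1r. Qed.

Lemma M_opp S : M S -> M (- S).
Proof. by move=> h; have := M_scale (-1) h; rewrite scaleN1r. Qed.

Lemma M_sub S T : M S -> M T -> M (S - T).
Proof. by move=> hS hT; apply: M_add => //; apply: M_opp. Qed.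

Lemma in_M T : bounded_op T -> (forall S, commutant M S -> forall v, T (S v) = S (T v)) -> M T.
Proof. by move=> bT h; case: hM => _ <-; apply/commutantP. Qed.

Lemma saP T : M T -> (forall u v, rdot (T u) v = rdot u (T v)) -> sa T.
Proof. by move=> MT h; split => //; apply: (adj_unique hH) => //; exact: M_bounded. Qed.

Lemma sa_rdot T u v : sa T -> rdot (T u) v = rdot u (T v).
Proof. by case=> MT aT; rewrite (rdot_adj hH) ?aT //; exact: M_bounded. Qed.

Lemma sa_lin (t : R) S T : sa S -> sa T -> sa (t%:C *: S + T).
Proof.
move=> hS hT; apply: saP; first by apply: M_lin; [case: hS|case: hT].
move=> u v; rewrite -![(t%:C *: S + T) _]/(t%:C *: S _ + T _).
by rewrite (rdotDl hd) (rdotDr hd) (rdotZl hd) (rdotZr hd) (sa_rdot _ _ hS) (sa_rdot _ _ hT).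
Qed.

Lemma sa_id : sa idfun. Proof. by apply: saP => //; exact: M_id. Qed.
Lemma sa_zero : sa 0.
Proof. by apply: saP; [exact: M_zero|move=> u v; rewrite (rdot0l hd) (rdot0r hd)]. Qed.
Lemma sa_add S T : sa S -> sa T -> sa (S + T).
Proof. by move=> hS hT; have := sa_lin 1 hS hT; rewrite rmorph1 scale1r. Qed.
Lemma sa_opp S : sa S -> sa (- S).
Proof. by move=> hS; have := sa_lin (-1) hS sa_zero; rewrite rmorphN1 scaleN1r addr0. Qed.
Lemma sa_sub S T : sa S -> sa T -> sa (S - T).
Proof. by move=> hS hT; apply: sa_add => //; exact: sa_opp. Qed.

Lemma form_cs T u v : sa T -> fle 0 T -> rdot (T u) v ^+ 2 <= rdot (T u) u * rdot (T v) v.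
Proof.
move=> hT pT; apply: quad_nonneg => t; have := pT (u - t%:C *: v).
have lT : linear T by case: hT => /M_linear.
rewrite (rdot0l hd) (linB lT) (linZ lT) !(rdotBl hd, rdotBr hd, rdotZl hd, rdotZr hd).
rewrite (sa_rdot v u hT) (rdotC hd v); lra.
Qed.

(** This is T^2 <= T: [form_cs] against T v gives |T v|^4 <= <T v, v> <T T v, T v>, and the last
    factor is at most |T v|^2. *)
Lemma contraction_sqn T v : sa T -> fle 0 T -> fle T idfun -> sqn (T v) <= rdot (T v) v.
Proof.
move=> hT pT cT; have := form_cs v (T v) hT pT; rewrite -/(sqn (T v)) => h.
have h2 := cT (T v); have p := pT v; rewrite (rdot0l hd) in p.
have s0 := sqn_ge0 hd (T v).
have [->//|nz] := eqVneq (sqn (T v)) 0.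
have sp : 0 < sqn (T v) by rewrite lt_neqAle eq_sym nz.
rewrite -(ler_pM2r sp) -expr2; apply: le_trans h _.
by rewrite ler_wpM2l.
Qed.

(** Differences y_n - y_m are again between 0 and 1, so [contraction_sqn] turns convergence of the
    bounded increasing quadratic forms into strong convergence. The limit commutes with the
    commutant, hence lies in M. *)
Lemma monotone_limit (y : nat -> H -> H) : (forall n, sa (y n)) -> (forall n, fle 0 (y n)) ->
  (forall n, fle (y n) idfun) -> (forall m n, (m <= n)%N -> fle (y m) (y n)) ->
  exists s, [/\ sa s, forall v, sqn_cvg dot (fun n => y n v) (s v) & forall n, fle (y n) s].
Proof.
move=> ysa y0 y1 ym.
have cau v : sqn_cauchy dot (fun n => y n v).
  move=> e e0.
  pose A := [set rdot (y n v) v | n in [set: nat]].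
  have hA : has_sup A.
    split; first by exists (rdot (y 0%N v) v); exists 0%N.
    by exists (sqn v) => _ [n _ <-]; exact: y1.
  have [_ [N _ <-] hN] := sup_adherent e0 hA.
  have ub n : rdot (y n v) v <= sup A by apply: (sup_upper_bound hA); exists n.
  have aux m n : (N <= m)%N -> (m <= n)%N -> sqn (y n v - y m v) <= e.
    move=> Nm mn; have h := ym _ _ mn; have h' := ym _ _ Nm v.
    have sD := sa_sub (ysa n) (ysa m).
    have := @contraction_sqn (y n - y m) v sD.
    have E w : (y n - y m) w = y n w - y m w by [].
    have p : fle 0 (y n - y m).
      by move=> w; rewrite E (rdot0l hd) (rdotBl hd) subr_ge0 h.
    have q : fle (y n - y m) idfun.
      move=> w; rewrite E (rdotBl hd); have := y1 n w; have := y0 m w.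
      rewrite (rdot0l hd); lra.
    move=> /(_ p q); rewrite E (rdotBl hd); have := ub n; lra.
  exists N => m n Nm Nn; case: (leqP m n) => [mn|/ltnW nm]; last exact: aux.
  by rewrite (sqnBC hd); exact: aux.
have /choice [s hs] : forall v, exists l, sqn_cvg dot (fun n => y n v) l.
  by move=> v; apply: (complete_dot hH); exact: cau.
have uq := sqn_cvg_unique hd (@sqn_eq0 _ _ _ hH).
have ly n : linear (y n) by apply: M_linear; case: (ysa n).
have ls : linear s.
  move=> c u v; apply: (uq _ _ _ (hs _)).
  rewrite (_ : (fun n => y n (c *: u + v)) = fun n => c *: y n u + y n v).
    by apply: (sqn_cvg_lin hd).
  by apply/funext => n; rewrite ly.
have bs : lbounded dot 2 s.
  move=> v; rewrite -subr_le0; apply: (@le0_small _ _ 2) => // e e0.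
  have [N hN] := hs v _ e0; have {}hN := hN N (leqnn N).
  have -> : s v = y N v - (y N v - s v) by lmod_ring R[i].
  have := sqnB_le hd (y N v) (y N v - s v).
  have := contraction_sqn v (ysa N) (y0 N) (y1 N); have := y1 N v; rewrite -/(sqn v); lra.
have Ms : M s.
  apply: in_M; first exact: (bounded_lbounded hH ls bs).
  move=> T /commutantP [bT hT] v; apply: (uq _ _ _ (hs _)).
  have [C _ hC] := bounded_ex hH bT.
  rewrite (_ : (fun n => y n (T v)) = T \o (fun n => y n v)).
    by apply: (sqn_cvg_map hd (bounded_linear bT) hC).
  by apply/funext => n /=; rewrite hT //; case: (ysa n).
have ssa : sa s.
  apply: saP => // u v; apply/eqP; rewrite -subr_eq0 -sqrf_eq0; apply/eqP.
  apply: le_anti; rewrite sqr_ge0 andbT; apply: (@le0_small _ _ 4) => // e e0.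
  have [N1 h1] := sqn_cvg_rdot hd v (hs u) e0.
  have [N2 h2] := sqn_cvg_rdot hd u (hs v) e0; pose n := maxn N1 N2.
  have {}h1 := h1 n (leq_maxl _ _); have {}h2 := h2 n (leq_maxr _ _).
  rewrite [rdot u _](rdotC hd); move: h1 h2; rewrite (sa_rdot u v (ysa n)) (rdotC hd u).
  move: (rdot (y n v) u) (rdot (s u) v) (rdot (s v) u) => A B C h1 h2.
  have := sqr_ge0 ((A - B) + (A - C)); nra.
exists s; split => // n v; apply: (sqn_cvg_rdot_ge hd (N0 := n) (hs v)) => m nm.
exact: ym.
Qed.

(** The inverse of 1 + S without spectral theory: 1 + S is bounded below by 1, and its range is
    dense because a vector orthogonal to the range is in the kernel. *)
Lemma resolvent_exists S : sa S -> fle 0 S ->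
  exists Q, [/\ sa Q, forall v, Q v + S (Q v) = v & forall v, Q (v + S v) = v].
Proof.
move=> sS pS.
have lS : linear S by case: sS => /M_linear.
pose T v := v + S v.
have lT : linear T by move=> c u v; rewrite /T lS; lmod_ring R[i].
have lower v : sqn v <= sqn (T v).
  rewrite /T (sqnD hd); have := pS v; rewrite (rdot0l hd) (rdotC hd); have := sqn_ge0 hd (S v); lra.
have Tsa u v : rdot (T u) v = rdot u (T v).
  by rewrite (rdotDl hd) (rdotDr hd) (sa_rdot _ _ sS).
have inj u v : T u = T v -> u = v.
  move=> h; apply/eqP; rewrite -subr_eq0; apply/eqP; apply: (sqn_eq0 hH).
  apply: le_anti; rewrite (sqn_ge0 hd) andbT; apply: le_trans (lower _) _.
  by rewrite (linB lT) h subrr (sqn0 hd).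
have [D D0 bD] : exists2 D : R, 0 <= D & lbounded dot D T.
  have [C C0 hC] := bounded_ex hH (M_bounded (proj1 sS)); exists (2 + 2 * C); first lra.
  by move=> v; apply: le_trans (sqnD_le hd _ _) _; have := hC v; lra.
have surj v : exists u, T u = v.
  have sW : csubspace (range T).
    split; first by exists 0 => //; rewrite (lin0 lT).
    by move=> c _ _ [a _ <-] [b _ <-]; exists (c *: a + b) => //; rewrite lT.
  have [E [lE cE oE uE]] := ortho_projection hd (complete_dot hH) (@sqn_eq0 _ _ _ hH) sW.
  have Ev : E v = v.
    apply/eqP; rewrite eq_sym -subr_eq0; apply/eqP; apply: inj; rewrite (lin0 lT).
    apply: (rdot_inj hH) => w; rewrite (rdot0l hd) Tsa; apply: oE; by exists w.
  have ex n : exists u, sqn (v - T u) <= invS R n.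
    have n0 : 0 < invS R n by rewrite invr_gt0 ltr0n.
    by have [_ [u _ <-] h] := cE v _ n0; exists u; rewrite -{1}Ev.
  have [u hu] := choice ex.
  have [l hl] : exists l, sqn_cvg dot u l.
    apply: (complete_dot hH) => e e0; have e4 : 0 < e / 4 by lra.
    have [N hN] := invS_small e4; exists N => m n Nm Nn.
    apply: le_trans (lower _) _; rewrite (linB lT).
    have -> : T (u m) - T (u n) = (v - T (u n)) - (v - T (u m)) by lmod_ring R[i].
    apply: le_trans (sqnB_le hd _ _) _.
    have := hu m; have := hu n; have := hN _ Nm; have := hN _ Nn; lra.
  exists l; apply: (sqn_cvg_unique hd (@sqn_eq0 _ _ _ hH) (sqn_cvg_map hd lT bD hl)).
  move=> e e0; have [N hN] := invS_small e0; exists N => n /hN h.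
  by rewrite (sqnBC hd); apply: le_trans (hu n) h.
have [Q hQ] := choice surj.
have QT v : Q (T v) = v by apply: inj; rewrite hQ.
have lQ : linear Q by move=> c u v; apply: inj; rewrite lT !hQ.
exists Q; split => //; apply: saP.
  apply: in_M.
    apply: (bounded_lbounded hH lQ (C := 1)) => v.
    by rewrite mul1r; apply: le_trans (lower _) _; rewrite hQ.
  move=> U /commutantP [bU hU] v; apply: inj; rewrite hQ /T -hU; last by case: sS.
  by rewrite -(linD (bounded_linear bU)) -/(T (Q v)) hQ.
by move=> u v; rewrite -{1}(hQ v) -Tsa hQ.
Qed.

End Order.

Section Resolvent.
Variables (R : realType) (H : completeNormedModType R[i]).
Variable dot : {dot H for (@conjc R)}.
Hypothesis hH : hilbert dot.
Local Notation sqn := (sqnorm dot).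
Local Notation rdot := (re_dot dot).
Let hd := prehilbert_dot hH.
Variable M : set (H -> H).
Hypothesis hM : von_neumann_algebra dot M.
Implicit Types (S T x Q : H -> H).
Local Notation sa := (self_adjoint dot M).
Local Notation fle := (fle dot).

Definition resolvent S Q :=
  [/\ sa Q, forall v, Q v + S (Q v) = v & forall v, Q (v + S v) = v].

(** The variational formula for <(1 + S)^-1 v, v> as a maximum over u, attained at u = Q v. It
    yields antitonicity in S and the bound below by 1 - S. *)
Lemma resolvent_var S Q u v : sa S -> fle 0 S -> resolvent S Q ->
  2 * rdot u v - rdot (u + S u) u <= rdot (Q v) v.
Proof.
move=> sS pS [sQ h1 h2]; have lS : linear S by case: sS => /(M_linear hM).
set w := Q v; have -> : v = w + S w by rewrite h1.
have := sqn_ge0 hd (w - u); have := pS (w - u); rewrite (rdot0l hd) (linB lS) (sqnB hd) /sqnorm.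
rewrite !(rdotBl hd, rdotBr hd, rdotDl hd, rdotDr hd) (sa_rdot hH hM u w sS).
rewrite (rdotC hd w (S w)) (rdotC hd u w) (rdotC hd (S w) u); lra.
Qed.

Lemma resolvent_anti S T Q Q' : sa S -> fle 0 S -> fle S T -> resolvent S Q -> resolvent T Q' ->
  fle Q' Q.
Proof.
move=> sS pS le hQ [sQ' h1 h2] v; apply: le_trans (resolvent_var (Q' v) v sS pS hQ).
have e : rdot (Q' v) v = 2 * rdot (Q' v) v - rdot (Q' v + T (Q' v)) (Q' v).
  by rewrite h1 (rdotC hd v); ring.
rewrite {1}e; have := le (Q' v); rewrite !(rdotDl hd); lra.
Qed.

Lemma resolvent_ge0 S Q : fle 0 S -> resolvent S Q -> fle 0 Q.
Proof.
move=> pS [sQ h1 h2] v; have := pS (Q v); rewrite !(rdot0l hd) => p.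
rewrite -{2}(h1 v) (rdotDr hd) (rdotC hd _ (S _)); have := sqn_ge0 hd (Q v); rewrite /sqnorm; lra.
Qed.

Lemma resolvent_le1 S Q : fle 0 S -> resolvent S Q -> fle Q idfun.
Proof.
move=> pS [sQ h1 h2] v; have := pS (Q v); rewrite !(rdot0l hd) => p.
rewrite -[rdot (idfun v) v]/(sqn v) -{2 3}(h1 v) (sqnD hd) (rdotDr hd) (rdotC hd _ (S _)).
have := sqn_ge0 hd (Q v); have := sqn_ge0 hd (S (Q v)); rewrite -/(sqn (Q v)); lra.
Qed.

Lemma resolvent_ge S Q v : sa S -> fle 0 S -> resolvent S Q ->
  sqn v - rdot (S v) v <= rdot (Q v) v.
Proof.
move=> sS pS hQ; apply: le_trans (resolvent_var v v sS pS hQ).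
rewrite (rdotDl hd) -/(sqn v); lra.
Qed.

(** The operator form of 1 / (1 + t) <= 1 - t/2 on [0, 1]: the transform 1 - (1 + x)^-1 loses at
    most a factor 2. *)
Lemma resolvent_half x Q v : sa x -> fle 0 x -> fle x idfun -> resolvent x Q ->
  rdot (Q v) v <= sqn v - 2^-1 * rdot (x v) v.
Proof.
move=> sx px cx [sQ h1 h2]; set u := Q v; have -> : v = u + x u by rewrite h1.
have lx : linear x by case: sx => /(M_linear hM).
have b := contraction_sqn hH hM u sx px cx; have c := cx (x u).
rewrite (sqnD hd) (linD lx) !(rdotDl hd, rdotDr hd) (sa_rdot hH hM (x u) u sx).
rewrite (rdotC hd u (x u)) -!/(sqn _) in c b *; lra.
Qed.

End Resolvent.

Section Trace.
Variables (R : realType) (H : completeNormedModType R[i]).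
Variable dot : {dot H for (@conjc R)}.
Hypothesis hH : hilbert dot.
Local Notation sqn := (sqnorm dot).
Local Notation rdot := (re_dot dot).
Let hd := prehilbert_dot hH.
Variable M : set (H -> H).
Hypothesis hM : von_neumann_algebra dot M.
Variable tau : (H -> H) -> R[i].
Hypothesis ht : faithful_normal_trace dot M tau.
Implicit Types (S T x y : H -> H).
Local Notation sa := (self_adjoint dot M).
Local Notation fle := (fle dot).

Definition re_trace x : R := complex.Re (tau x).
(** The squared 2-norm attached to the trace. *)
Definition trace_sq x : R := re_trace (adj dot x \o x).

Lemma tau_lin c x y : M x -> M y -> tau (c *: x + y) = c * tau x + tau y.
Proof. by case: ht => [[h _] _ _ _ _]; exact: h. Qed.

Lemma tau_zero : tau 0 = 0.
Proof.
have m0 := M_zero hH hM; have := tau_lin 1 m0 m0.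
by rewrite scale1r addr0 mul1r => /eqP; rewrite addrC -subr_eq subrr => /eqP <-.
Qed.

Lemma rtauD x y : M x -> M y -> re_trace (x + y) = re_trace x + re_trace y.
Proof. by move=> hx hy; have := tau_lin 1 hx hy; rewrite scale1r mul1r /re_trace => ->; rewrite ReD. Qed.

Lemma rtauZ (t : R) x : M x -> re_trace (t%:C *: x) = t * re_trace x.
Proof.
move=> hx; have := tau_lin t%:C hx (M_zero hH hM).
by rewrite addr0 tau_zero addr0 /re_trace => ->; rewrite ReZ.
Qed.

Lemma rtauN x : M x -> re_trace (- x) = - re_trace x.
Proof. by move=> hx; have := rtauZ (-1) hx; rewrite rmorphN1 scaleN1r mulN1r. Qed.

Lemma rtauB x y : M x -> M y -> re_trace (x - y) = re_trace x - re_trace y.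
Proof. by move=> hx hy; rewrite rtauD ?rtauN //; exact: M_opp. Qed.

Lemma rtau_id : re_trace idfun = 1.
Proof. by case: ht => [[_ h] _ _ _ _]; rewrite /re_trace h. Qed.

Lemma rtau_comm x y : M x -> M y -> re_trace (x \o y) = re_trace (y \o x).
Proof. by move=> hx hy; case: ht => _ _ _ h _; rewrite /re_trace h. Qed.

Lemma sa_le_op S T : sa S -> sa T -> fle S T -> le_op dot S T.
Proof.
move=> sS sT le v.
have Im0 (U : H -> H) : sa U -> complex.Im (dot (U v) v) = 0.
  move=> sU; rewrite (Im_dot hd) (rdotC hd) (rdotiB hd) (rdotC hd).
  have lU : linear U by case: sU => /(M_linear hM).
  have := sa_rdot hH hM ('i *: v) v sU; rewrite (linZ lU) (rdotiB hd) => h1.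
  have h2 := rdotiB hd (U v) v.
  by move: h1 h2; rewrite ![rdot ('i *: v) _](rdotC hd) ![rdot ('i *: U v) _](rdotC hd); lra.
by rewrite lecE !Im0 //= eqxx /=; exact: le.
Qed.

Lemma le_op_fle S T : le_op dot S T -> fle S T.
Proof. by move=> h v; have := h v; rewrite lecE => /andP[]. Qed.

(** Normality is formulated with least upper bounds; the strong limit of an increasing sequence is
    one, because the order is tested vector by vector. *)
Lemma rtau_sup (y : nat -> H -> H) s : (forall n, sa (y n)) -> sa s -> (forall n, fle (y n) s) ->
  (forall m n, (m <= n)%N -> fle (y m) (y n)) ->
  (forall v, sqn_cvg dot (fun n => y n v) (s v)) ->
  re_trace s = sup [set re_trace T | T in range y].
Proof.
move=> ysa ssa ys ym hs; case: ht => _ _ _ _; apply.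
- by move=> _ [n _ <-].
- split; first by exists (y 0%N), 0%N.
  move=> _ _ [m _ <-] [n _ <-]; exists (y (maxn m n)); split.
  + by exists (maxn m n).
  + by apply: sa_le_op => //; apply: ym; exact: leq_maxl.
  + by apply: sa_le_op => //; apply: ym; exact: leq_maxr.
- split => //; first by move=> _ [n _ <-]; apply: sa_le_op.
  move=> t tsa ht'; apply: sa_le_op => // v.
  apply: (sqn_cvg_rdot_le hd (N0 := 0%N) (hs v)) => n _.
  by apply: le_op_fle; apply: ht'; exists n.
Qed.

(* A two-element chain is directed, so normality contains monotonicity. *)
Lemma rtau_mono S T : sa S -> sa T -> fle S T -> re_trace S <= re_trace T.
Proof.
move=> sS sT le; pose y (n : nat) := if n is 0 then S else T.
have ysa n : sa (y n) by case: n.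
have yT n : fle (y n) T by case: n => [|n] //= v.
have := @rtau_sup y T ysa sT yT.
have -> : [set re_trace U | U in range y] = [set re_trace S; re_trace T].
  apply/seteqP; split => [_ [_ [n _ <-] <-]|r /= [->|->]].
  - by case: n => [|n]; [left|right].
  - by exists S => //; exists 0%N.
  - by exists T => //; exists 1%N.
move=> -> //.
- apply: sup_upper_bound; last by left.
  split; first by exists (re_trace S); left.
  exists (Num.max (re_trace S) (re_trace T)) => r /= [->|->]; first by rewrite le_max lexx.
  by rewrite le_max lexx orbT.
- by case=> [|m] [|n] //= _ v; try exact: lexx; exact: le.
- by move=> v e e0; exists 1%N => -[|n] //= _; rewrite subrr (sqn0 hd) ltW.
Qed.

Lemma rtau_limit (y : nat -> H -> H) s : (forall n, sa (y n)) -> sa s -> (forall n, fle (y n) s) ->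
  (forall m n, (m <= n)%N -> fle (y m) (y n)) ->
  (forall v, sqn_cvg dot (fun n => y n v) (s v)) ->
  forall e : R, 0 < e -> exists n, re_trace s <= re_trace (y n) + e.
Proof.
move=> ysa ssa ys ym hs e e0; have hsup := rtau_sup ysa ssa ys ym hs.
have hS : has_sup [set re_trace T | T in range y].
  split; first by exists (re_trace (y 0%N)), (y 0%N) => //; exists 0%N.
  by exists (re_trace s) => _ [_ [n _ <-] <-]; apply: rtau_mono.
have [_ [_ [n _ <-] <-] h] := sup_adherent e0 hS; exists n.
by rewrite hsup; lra.
Qed.

Lemma tsq_sa x : M x -> sa (adj dot x \o x).
Proof.
move=> Mx; have ax := M_adj hM Mx.
apply: (saP hH hM); first exact: M_comp.
move=> u v /=; have bx := M_bounded hM Mx.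
by rewrite (rdotC hd) -(rdot_adj hH) // (rdotC hd) (rdot_adj hH).
Qed.

Lemma tsq_form x v : M x -> rdot ((adj dot x \o x) v) v = sqn (x v).
Proof.
by move=> Mx /=; rewrite (rdotC hd) -(rdot_adj hH) //; exact: M_bounded hM _ Mx.
Qed.

Lemma tsq_ge0 x : M x -> 0 <= trace_sq x.
Proof.
by move=> Mx; case: ht => _ h _ _ _; have := h _ Mx; rewrite lecE => /andP[].
Qed.

Lemma tsq_eq0 x : M x -> trace_sq x = 0 -> x = 0.
Proof.
move=> Mx h0; case: ht => _ hp hf _ _; apply: hf => //.
have := hp _ Mx; move: h0; rewrite /trace_sq /re_trace; case: (tau _) => a b /= ->.
by rewrite lecE => /andP[/eqP /= -> _].
Qed.

(** The pointwise hypothesis is an operator inequality between adj x o x and c times adj y o y. *)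
Lemma tsq_fle x y (c : R) : M x -> M y -> (forall v, sqn (x v) <= c * sqn (y v)) ->
  trace_sq x <= c * trace_sq y.
Proof.
move=> Mx My h; rewrite /trace_sq -rtauZ; last by case: (tsq_sa My).
apply: rtau_mono; [exact: tsq_sa| |].
- have := sa_lin hH hM c (tsq_sa My) (sa_zero hH hM); by rewrite addr0.
- by move=> v; rewrite tsq_form // -[(_ *: _) v]/(c%:C *: (adj dot y \o y) v) (rdotZl hd) tsq_form.
Qed.

Lemma tsq_add_le x y : M x -> M y -> trace_sq (x + y) <= 2 * trace_sq x + 2 * trace_sq y.
Proof.
move=> Mx My; have sx := tsq_sa Mx; have sy := tsq_sa My.
rewrite /trace_sq -!rtauZ; [|by case: sy|by case: sx].
have sx2 := sa_lin hH hM 2 sx (sa_zero hH hM); have sy2 := sa_lin hH hM 2 sy (sa_zero hH hM).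
rewrite !addr0 in sx2 sy2.
rewrite -rtauD; [|by case: sx2|by case: sy2].
apply: rtau_mono; [by apply: tsq_sa; exact: M_add|exact: sa_add|].
move=> v; rewrite tsq_form; last exact: M_add.
rewrite -[(_ + _) v in leRHS]/(2%:C *: (adj dot x \o x) v + 2%:C *: (adj dot y \o y) v).
by rewrite (rdotDl hd) !(rdotZl hd) !tsq_form //; exact: sqnD_le.
Qed.

Lemma tsq_adj x : M x -> trace_sq (adj dot x) = trace_sq x.
Proof.
move=> Mx; rewrite /trace_sq (adjK hH); last exact: M_bounded hM _ Mx.
by rewrite rtau_comm //; exact: M_adj.
Qed.

Lemma tsq_mul_l x y C : M x -> M y -> lbounded dot C x -> trace_sq (x \o y) <= C * trace_sq y.
Proof. by move=> Mx My bx; apply: tsq_fle => //; [exact: M_comp|move=> v; exact: bx]. Qed.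

(** Reduced to left multiplication by passing to adjoints; through [tsq_adj] this uses the trace
    property. *)
Lemma tsq_mul_r x y C : M x -> M y -> lbounded dot C (adj dot y) -> trace_sq (x \o y) <= C * trace_sq x.
Proof.
move=> Mx My b; rewrite -tsq_adj; last exact: M_comp.
rewrite (adj_comp hH) -?[trace_sq x]tsq_adj //; try exact: M_bounded hM _ _.
by apply: tsq_mul_l => //; exact: M_adj.
Qed.

(** Nonnegativity of the variance: expand [trace_sq] of x - tau(x). *)
Lemma rtau_sqr_le x : sa x -> re_trace x ^+ 2 <= trace_sq x.
Proof.
move=> sx; have [Mx ax] := sx; pose t := re_trace x.
have M1 := M_id hH hM.
have := tsq_ge0 (M_sub hH hM Mx (M_scale hH hM t%:C M1)).
have sd : sa (x - t%:C *: idfun).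
  apply: (sa_sub hH hM) => //.
  by have := sa_lin hH hM t (sa_id hH hM) (sa_zero hH hM); rewrite addr0.
rewrite /trace_sq (proj2 sd) ax.
have lx := M_linear hM Mx.
have -> : (x - t%:C *: idfun) \o (x - t%:C *: idfun) = (x \o x) + ((- (2 * t))%:C *: x + (t ^+ 2)%:C *: idfun).
  apply/funext => v; rewrite -[LHS]/(x (x v - t%:C *: v) - t%:C *: (x v - t%:C *: v)).
  rewrite -[RHS]/(x (x v) + ((- (2 * t))%:C *: x v + (t ^+ 2)%:C *: v)).
  by rewrite (linB lx) (linZ lx); lmod_ring R[i].
have Mxx := M_comp hH hM Mx Mx.
have Ma := M_scale hH hM (- (2 * t))%:C Mx; have Mb := M_scale hH hM (t ^+ 2)%:C M1.
rewrite !rtauD ?rtauZ ?rtau_id //; last exact: M_add.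
rewrite -/t; nra.
Qed.

End Trace.

(** * A countable separating family of vectors *)

Section Separating.
Variables (R : realType) (H : completeNormedModType R[i]).
Variable dot : {dot H for (@conjc R)}.
Hypothesis hH : hilbert dot.
Local Notation sqn := (sqnorm dot).
Local Notation rdot := (re_dot dot).
Let hd := prehilbert_dot hH.
Variable M : set (H -> H).
Hypothesis hM : von_neumann_algebra dot M.
Variable tau : (H -> H) -> R[i].
Hypothesis ht : faithful_normal_trace dot M tau.
Local Notation sa := (self_adjoint dot M).
Local Notation fle := (fle dot).
Local Notation rtau := (re_trace tau).

Let hc := complete_dot hH.
Let nd := @sqn_eq0 _ _ _ hH.

(** The sum of the orbits of the vectors of [s] under the commutant of M. It is invariant under the
    commutant, so the projection onto its closure lies in M and has a trace. *)
Fixpoint cyc (s : seq H) : set H :=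
  if s is x :: s' then [set v | exists T w, [/\ commutant M T, cyc s' w & v = T x + w]]
  else [set 0].

Let lM U : M U -> linear U. Proof. exact: M_linear hM U. Qed.

Lemma commutant_M_adj T : commutant M T -> commutant M (adj dot T).
Proof. by apply: (commutant_adj hH); [exact: M_bounded hM|exact: M_adj hM]. Qed.

Lemma cyc_subspace s : csubspace (cyc s).
Proof.
elim: s => [|x s [IH0 IH1]].
  by split => // c u v -> ->; rewrite scaler0 addr0.
have c0 : commutant M 0.
  have := commutant_lin hH (-1) lM (commutant_id hH lM) (commutant_id hH lM).
  by rewrite (_ : -1 *: _ + _ = 0) // scaleN1r addNr.
split; first by exists 0, 0; split => //; rewrite addr0.
move=> c u v [T [w [hT hw ->]]] [T' [w' [hT' hw' ->]]].
exists (c *: T + T'), (c *: w + w'); split; [exact: commutant_lin|exact: IH1|].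
by rewrite -[(c *: T + T') x]/(c *: T x + T' x); lmod_ring R[i].
Qed.

Lemma cyc_invariant s T w : commutant M T -> cyc s w -> cyc s (T w).
Proof.
move=> hT; have lT : linear T by case: hT => bT _; exact: bounded_linear.
elim: s w => [|x s IH] w /=; first by move=> ->; rewrite (lin0 lT).
move=> [U [w' [hU hw' ->]]]; exists (T \o U), (T w'); split; last by rewrite (linD lT).
  exact: commutant_comp.
exact: IH.
Qed.

Lemma cyc_head x s : cyc (x :: s) x.
Proof.
exists idfun, 0; split; [exact: commutant_id|by case: (cyc_subspace s)|by rewrite addr0].
Qed.

Lemma cyc_kill s z : M z -> (forall x, x \in s -> z x = 0) -> forall w, cyc s w -> z w = 0.
Proof.
move=> Mz; elim: s => [|x s IH] h w /=; first by move=> ->; rewrite (lin0 (lM Mz)).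
move=> [T [w' [/commutantP [bT hT] hw' ->]]].
rewrite (linD (lM Mz)) -(hT _ Mz) h ?inE ?eqxx // (lin0 (bounded_linear bT)) add0r.
by apply: IH => // y ys; apply: h; rewrite inE ys orbT.
Qed.

Definition oproj (W : set H) (e : H -> H) :=
  [/\ linear e, forall v, sqn_closure dot W (e v), forall v w, W w -> rdot (v - e v) w = 0 &
      forall v y, sqn_closure dot W y -> (forall w, W w -> rdot (v - y) w = 0) -> e v = y].

Lemma oproj_sa_M W e : csubspace W -> (forall T w, commutant M T -> W w -> W (T w)) ->
  oproj W e -> sa e.
Proof.
move=> sW inv he; have [le _ _ _] := he.
apply: (saP hH hM); last exact: (oproj_sa hd he).
apply: (in_M hM).
  apply: (bounded_lbounded hH le (C := 1)) => v; rewrite mul1r; exact: (oproj_contract hd he).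
move=> T hT v; have bT : bounded_op T by case: hT.
have [C _ hC] := bounded_ex hH bT.
apply: (oproj_comm hd he (s := adj dot T) (bounded_linear bT) hC).
- by move=> x y; exact: rdot_adj.
- by move=> w; exact: inv.
- by move=> w; apply: inv; exact: commutant_M_adj.
Qed.

Lemma oproj_rdot W e v : oproj W e -> rdot (e v) v = sqn (e v).
Proof. by move=> he; rewrite -{1}(oproj_idem hd he) (oproj_sa hd he). Qed.

(** Exhaustion by trace: take finite lists whose projections have trace tending to the supremum, and
    enumerate all their vectors. A nonzero z killing all of them would allow one more vector and a
    trace above the supremum. *)
Lemma separating_sequence : exists xi : nat -> H,
  forall z, M z -> (forall n, z (xi n) = 0) -> z = 0.
Proof.
have /choice [e he] : forall s, exists e, oproj (cyc s) e.
  by move=> s; exact: (ortho_projection hd hc nd (cyc_subspace s)).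
have esa s : sa (e s).
  by apply: (oproj_sa_M (cyc_subspace s)) => // T w; exact: cyc_invariant.
pose A := [set rtau (e s) | s in [set: seq H]].
have hA : has_sup A.
  split; first by exists (rtau (e [::])); exists [::].
  exists 1 => _ [s _ <-]; rewrite -(rtau_id ht); apply: (rtau_mono hH hM ht) => //.
    exact: (sa_id hH hM).
  by move=> v; rewrite (oproj_rdot _ (he s)); exact: (oproj_contract hd (he s)).
have ex n : exists s, sup A - invS R n < rtau (e s).
  have n0 : 0 < invS R n by rewrite invr_gt0 ltr0n.
  by have [_ [s _ <-] h] := sup_adherent n0 hA; exists s.
have [s hs] := choice ex.
(* Vector i of the n-th list sits at the code of (n, i); every other index gives 0, at which nothing
   has to be checked. *)
pose xi k := if @choice.unpickle (nat * nat)%type k is Some (n, i) then nth 0 (s n) i else 0 : H.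
exists xi => z Mz hz.
have lz := lM Mz.
have zs n x : x \in s n -> z x = 0.
  move=> xs; have := hz (@choice.pickle (nat * nat)%type (n, index x (s n))).
  by rewrite /xi choice.pickleK nth_index.
apply/funext => eta; apply/eqP/negP => /negP zeta.
pose K := [set v | z v = 0].
have sK : csubspace K.
  by split; [exact: lin0 lz|move=> c u v /= hu hv; rewrite /K /= lz hu hv scaler0 addr0].
have invK T w : commutant M T -> K w -> K (T w).
  move=> /commutantP [bT hT]; rewrite /K /= => hw.
  by rewrite -(hT _ Mz) hw (lin0 (bounded_linear bT)).
have [f hf] := ortho_projection hd hc nd sK.
have [C C0 bz] := bounded_ex hH (M_bounded hM Mz).
have Kcl v : sqn_closure dot K v -> K v.
  move=> hv; rewrite /K /=; apply: nd; apply: le_anti; rewrite (sqn_ge0 hd) andbT.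
  apply: (@le0_small _ _ C) => // d d0; have [w Kw hw] := hv _ d0.
  have -> : z v = z (v - w) by rewrite (linB lz) Kw subr0.
  by apply: le_trans (bz _) _; rewrite ler_wpM2l.
(* The component of eta orthogonal to the kernel of z; it is nonzero because z et = z eta. *)
pose et := eta - f eta.
have zet : z et = z eta.
  rewrite /et (linB lz); have [_ cf _ _] := hf.
  by have -> : z (f eta) = 0; [exact: (Kcl _ (cf eta))|rewrite subr0].
have etK k : K k -> rdot et k = 0 by move=> Kk; case: hf => _ _ h _; exact: h.
pose g := rtau (e [:: et]).
have sproj x t : trace_sq dot tau (e (x :: t)) = rtau (e (x :: t)).
  rewrite /trace_sq (proj2 (esa _)); congr rtau; apply/funext => v /=; exact: (oproj_idem hd (he _)).
have g0 : 0 < g.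
  rewrite lt_neqAle /g -sproj (tsq_ge0 ht) ?andbT; last by case: (esa [:: et]).
  apply/eqP => /esym h0; have := tsq_eq0 ht (proj1 (esa [:: et])) h0 => e0.
  have := oproj_id hd (he [:: et]) (cyc_head et [::]); rewrite e0 /= => et0.
  by move: zeta; rewrite -zet -et0 (lin0 lz) eqxx.
have [n hn] := invS_small g0; have {}hn := hn n (leqnn n).
(* z vanishes on the closed span of the orbits of s n, while the orbit of et is orthogonal to the
   kernel of z. The two ranges are orthogonal, and adding et raises the trace by at least g,
   independently of n. *)
have key : rtau (e (s n)) + g <= rtau (e (et :: s n)).
  rewrite /g -(rtauD ht); [|by case: (esa (s n))|by case: (esa [:: et])].
  apply: (rtau_mono hH hM ht) => //; first by apply: (sa_add hH hM).
  move=> v; rewrite -[(e (s n) + _) v]/(e (s n) v + e [:: et] v) (rdotDl hd).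
  rewrite !(oproj_rdot _ (he _)).
  set a := e (s n) v; set b := e [:: et] v; set c := e (et :: s n) v.
  have acl : sqn_closure dot (cyc (s n)) a by case: (he (s n)) => _ h _ _; exact: h.
  have bcl : sqn_closure dot (cyc [:: et]) b by case: (he [:: et]) => _ h _ _; exact: h.
  have aK : K a.
    apply: Kcl => d d0; have [w hw h] := acl _ d0; exists w => //.
    exact: (cyc_kill Mz (zs n)).
  have ab : rdot a b = 0.
    apply: (closure_ortho hd bcl) => w [T [w' [hT -> ->]]]; rewrite addr0.
    have bT : bounded_op T by case: hT.
    rewrite (rdotC hd) (rdot_adj hH) // etK //; apply: invK => //; exact: commutant_M_adj.
  have yab : sqn (a + b) = sqn a + sqn b by rewrite (sqnD hd) ab mulr0 addr0.
  have sub1 w : cyc (s n) w -> cyc (et :: s n) w.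
    move=> hw; exists 0, w; split => //; last by rewrite add0r.
    have := commutant_lin hH (-1) lM (commutant_id hH lM) (commutant_id hH lM).
    by rewrite (_ : -1 *: _ + _ = 0) // scaleN1r addNr.
  have sub2 w : cyc [:: et] w -> cyc (et :: s n) w.
    move=> [T [w' [hT -> ->]]]; exists T, 0; split => //; by case: (cyc_subspace (s n)).
  have ycl : sqn_closure dot (cyc (et :: s n)) (a + b).
    rewrite -[a]scale1r; apply: (sqn_closure_lin hd (cyc_subspace _)).
      by move=> d d0; have [w hw h] := acl _ d0; exists w => //; exact: sub1.
    by move=> d d0; have [w hw h] := bcl _ d0; exists w => //; exact: sub2.
  have va : rdot v a = sqn a by rewrite (rdotC hd) (oproj_rdot _ (he _)).
  have vb : rdot v b = sqn b by rewrite (rdotC hd) (oproj_rdot _ (he _)).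
  have cy : rdot c (a + b) = sqn (a + b).
    have := oproj_pyth hd (he (et :: s n)) v ycl; rewrite -/c (rdotBl hd) => /eqP.
    by rewrite subr_eq0 => /eqP <-; rewrite (rdotDr hd) va vb yab.
  have := cauchy_schwarz hd c (a + b); rewrite cy -yab.
  have := sqn_ge0 hd (a + b); have := sqn_ge0 hd c.
  move: (sqn (a + b)) (sqn c) => Y Z Z0 Y0 YZ.
  have [->//|nz] := eqVneq Y 0.
  have Yp : 0 < Y by rewrite lt_neqAle eq_sym nz.
  by rewrite -(ler_pM2r Yp) -expr2.
have : rtau (e (et :: s n)) <= sup A by apply: (sup_upper_bound hA); exists (et :: s n).
have := hs n; lra.
Qed.

End Separating.

(** * Absolute continuity of the trace and approximation in 2-norm *)

Section Continuity.
Variables (R : realType) (H : completeNormedModType R[i]).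
Variable dot : {dot H for (@conjc R)}.
Hypothesis hH : hilbert dot.
Local Notation sqn := (sqnorm dot).
Local Notation rdot := (re_dot dot).
Let hd := prehilbert_dot hH.
Variable M : set (H -> H).
Hypothesis hM : von_neumann_algebra dot M.
Variable tau : (H -> H) -> R[i].
Hypothesis ht : faithful_normal_trace dot M tau.
Local Notation sa := (self_adjoint dot M).
Local Notation fle := (fle dot).
Local Notation rtau := (re_trace tau).

Lemma half_pow_le n : (2^-1 : R) ^+ n <= invS R n.
Proof.
rewrite exprVn lef_pV2 ?posrE ?exprn_gt0 ?ltr0n // -natrX ler_nat; exact: ltn_expl.
Qed.

Lemma exists_expr_le (r e : R) : 0 <= r -> r < 1 -> 0 < e -> exists N, r ^+ N <= e.
Proof.
move=> r0 r1 e0; have : (fun n => r ^+ n) @ \oo --> (0 : R).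
  by apply: cvg_expr; rewrite ger0_norm.
move/cvgrPdist_le => /(_ e e0) [N _ h]; exists N; have := h N (leqnn N).
by rewrite sub0r normrN ger0_norm // exprn_ge0.
Qed.

Definition compl (T : H -> H) : H -> H := idfun - T.

Lemma compl_rdot T v : rdot (compl T v) v = sqn v - rdot (T v) v.
Proof. by rewrite -[compl T v]/(v - T v) (rdotBl hd). Qed.

Lemma compl_sa T : sa T -> sa (compl T).
Proof. by move=> h; apply: (sa_sub hH hM) => //; exact: (sa_id hH hM). Qed.

Lemma compl_anti S T : fle S T -> fle (compl T) (compl S).
Proof. by move=> h v; rewrite !compl_rdot lerD2l lerN2. Qed.

Lemma compl_ge0 T : fle T idfun -> fle 0 (compl T).
Proof. by move=> h v; rewrite compl_rdot (rdot0l hd) subr_ge0; exact: h. Qed.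

Lemma compl_le1 T : fle 0 T -> fle (compl T) idfun.
Proof. by move=> h v; have := h v; rewrite compl_rdot (rdot0l hd) -[rdot (idfun v) v]/(sqn v); lra. Qed.

(* Otherwise take x_n violating the bound with summable vector states; the decreasing sequence
   z_n = sup_m y (x_n + ... + x_(n+m)), where y S = 1 - (1 + S)^-1, has trace at least eps/2, but its
   infimum is killed by the separating sequence. *)
Lemma trace_abs_continuous (xi : nat -> H) (eps : R) :
  (forall z, M z -> (forall n, z (xi n) = 0) -> z = 0) -> 0 < eps ->
  exists n (d : R), 0 < d /\ forall x, sa x -> fle 0 x -> fle x idfun ->
    (forall i, (i < n)%N -> rdot (x (xi i)) (xi i) <= d) -> rtau x <= eps.
Proof.
move=> sep eps0; apply: contrapT => hn.
have /choice [x hx] : forall n : nat, exists x, [/\ sa x, fle 0 x, fle x idfun,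
    forall i, (i < n)%N -> rdot (x (xi i)) (xi i) <= (2^-1) ^+ n & eps < rtau x].
  move=> n; apply: contrapT => h; apply: hn; exists n, ((2^-1) ^+ n); split.
    by rewrite exprn_gt0 // invr_gt0.
  move=> x sx px cx hx; rewrite leNgt; apply/negP => lt; apply: h; exists x; by split.
pose fix S n m : H -> H := if m is k.+1 then S n k + x (n + k)%N else 0.
have SE n m v : rdot (S n m v) v = \sum_(k < m) rdot (x (n + k)%N v) v.
  elim: m => [|m IH]; first by rewrite big_ord0 (rdot0l hd).
  by rewrite big_ord_recr /= -IH -[(S n m + _) v]/(S n m v + x (n + m)%N v) (rdotDl hd).
have xpos n v : 0 <= rdot (x n v) v by have [_ p _ _ _] := hx n; have := p v; rewrite (rdot0l hd).
have Ssa n m : sa (S n m).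
  elim: m => [|m IH]; first exact: (sa_zero hH hM).
  by apply: (sa_add hH hM) => //; case: (hx (n + m)%N).
have Spos n m : fle 0 (S n m).
  by move=> v; rewrite SE (rdot0l hd); apply: sumr_ge0.
have Smono n m : fle (S n m) (S n m.+1).
  by move=> v; rewrite !SE big_ord_recr /= lerDl.
have Sshift n m : fle (S n.+1 m) (S n m.+1).
  move=> v; rewrite !SE big_ord_recl /=; apply: ler_wpDl => //.
  by apply: ler_sum => k _; rewrite /bump /= addSnnS.
have /choice [Q0 hQ0] : forall nm : nat * nat, exists Q, resolvent dot M (S nm.1 nm.2) Q.
  by move=> nm; exact: resolvent_exists.
pose Q n m := Q0 (n, m); have hQ n m : resolvent dot M (S n m) (Q n m) by exact: (hQ0 (n, m)).
(* The sums S n m need not stay bounded as m grows. The monotone transform 1 - (1 + S)^-1 keeps them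
   between 0 and 1, so the strong limits z_n exist. *)
pose y n m := compl (Q n m).
have ysa n m : sa (y n m) by apply: compl_sa; case: (hQ n m).
have y0 n m : fle 0 (y n m) by apply: compl_ge0; apply: (resolvent_le1 hH (Spos n m) (hQ n m)).
have y1 n m : fle (y n m) idfun by apply: compl_le1; apply: (resolvent_ge0 hH (Spos n m) (hQ n m)).
have ymono n m m' : fle (S n m) (S n m') -> fle (y n m) (y n m').
  by move=> h; apply: compl_anti; apply: (resolvent_anti hH hM (Ssa n m) (Spos n m) h).
have yshift n m : fle (y n.+1 m) (y n m.+1).
  by apply: compl_anti; apply: (resolvent_anti hH hM (Ssa n.+1 m) (Spos n.+1 m) (Sshift n m)).
have yinc n m m' : (m <= m')%N -> fle (y n m) (y n m').
  move=> /subnK <-; elim: (m' - m)%N => [|k IH] v; first exact: lexx.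
  by apply: le_trans (IH v) _; apply: ymono; exact: Smono.
have /choice [z hz] : forall n, exists s, [/\ sa s, forall v, sqn_cvg dot (fun m => y n m v) (s v) &
   forall m, fle (y n m) s].
  by move=> n; apply: monotone_limit => //; exact: yinc.
have zle n v c : (forall m, rdot (y n m v) v <= c) -> rdot (z n v) v <= c.
  move=> h; have [_ hc _] := hz n.
  by apply: (sqn_cvg_rdot_le hd (N0 := 0%N) (hc v)) => m _; exact: h.
have zsa n : sa (z n) by case: (hz n).
have yz n m : fle (y n m) (z n) by case: (hz n).
have z0 n : fle 0 (z n) by move=> v; apply: le_trans (y0 n 0%N v) (yz n 0%N v).
have z1 n : fle (z n) idfun by move=> v; apply: zle => m; exact: y1.
have zdec n : fle (z n.+1) (z n).
  by move=> v; apply: zle => m; apply: le_trans (yshift n m v) (yz n m.+1 v).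
have ztr n : eps / 2 <= rtau (z n).
  have [sx px cx _ tx] := hx n.
  have h : fle ((2^-1)%:C *: x n) (z n).
    move=> v; apply: le_trans (yz n 1%N v).
    rewrite -[((2^-1)%:C *: x n) v]/((2^-1)%:C *: x n v) (rdotZl hd) compl_rdot.
    have hQ1 : resolvent dot M (x n) (Q n 1%N).
      by have := hQ n 1%N; rewrite /= add0r addn0.
    have := resolvent_half hH hM v sx px cx hQ1; lra.
  have := rtau_mono hH hM ht _ (zsa n) h; rewrite (rtauZ hH hM ht); last by case: sx.
  have sx2 := sa_lin hH hM (2^-1) sx (sa_zero hH hM); rewrite addr0 in sx2.
  by move=> /(_ sx2); lra.
pose b n := compl (z n).
have bsa n : sa (b n) by exact: compl_sa.
have binc m n : (m <= n)%N -> fle (b m) (b n).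
  move=> /subnK <-; elim: (n - m)%N => [|k IH] v; first exact: lexx.
  by apply: le_trans (IH v) _; apply: compl_anti; exact: zdec.
have [w [wsa wc bw]] : exists s, [/\ sa s, forall v, sqn_cvg dot (fun m => b m v) (s v) &
   forall m, fle (b m) s].
  by apply: monotone_limit => // n; [exact: compl_ge0|exact: compl_le1].
(* From 1 - (1 + S)^-1 <= S, which is [resolvent_ge], and the geometric series for the tail at
   xi_i. *)
have zxi n i : (i < n)%N -> rdot (z n (xi i)) (xi i) <= 2 * (2^-1) ^+ n.
  move=> lin; apply: zle => m; rewrite compl_rdot.
  have := resolvent_ge hH hM (xi i) (Ssa n m) (Spos n m) (hQ n m).
  suff : rdot (S n m (xi i)) (xi i) <= (2^-1) ^+ n * (2 - 2 * (2^-1) ^+ m).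
    have : 0 <= (2^-1 : R) ^+ n by rewrite exprn_ge0 // invr_ge0.
    have : 0 <= (2^-1 : R) ^+ m by rewrite exprn_ge0 // invr_ge0.
    nra.
  elim: m => [|m IH]; first by rewrite (rdot0l hd) expr0 mulr1 subrr mulr0.
  rewrite -[S n m.+1 (xi i)]/(S n m (xi i) + x (n + m)%N (xi i)) (rdotDl hd).
  have [_ _ _ h _] := hx (n + m)%N; have := h i (leq_trans lin (leq_addr _ _)).
  rewrite exprD exprS; move: IH.
  set A := (2^-1 : R) ^+ n; set B := (2^-1 : R) ^+ m.
  have -> : A * (2 - 2 * (2^-1 * B)) = A * (2 - 2 * B) + A * B by field.
  lra.
have w1 : fle w idfun.
  move=> v; apply: (sqn_cvg_rdot_le hd (N0 := 0%N) (wc v)) => n _; exact: (compl_le1 (z0 n)).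
have wz : compl w = 0.
  have cs := compl_sa wsa; apply: sep; first by case: cs.
  move=> i; apply: (sqn_eq0 hH); apply: le_anti; rewrite (sqn_ge0 hd) andbT.
  have p0 : fle 0 w by move=> v; apply: le_trans (compl_ge0 (z1 0%N) v) (bw 0%N v).
  apply: le_trans (contraction_sqn hH hM (xi i) cs (compl_ge0 w1) (compl_le1 p0)) _.
  apply: (@le0_small _ _ 2) => // e e0; have [N hN] := invS_small e0.
  pose n := maxn N i.+1; have {}hN := hN n (leq_maxl _ _).
  have h1 := zxi n i (leq_maxr _ _); have h2 := half_pow_le n.
  have := bw n (xi i); rewrite !compl_rdot; lra.
have w_id : w = idfun.
  apply/funext => v; have : compl w v = 0 by rewrite wz.
  by rewrite -[compl w v]/(v - w v) => /eqP; rewrite subr_eq0 => /eqP <-.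
(* The b_n = 1 - z_n increase to 1, so normality gives some n with tau(z_n) <= eps / 4, against the
   lower bound eps / 2 of [ztr]. *)
have e4 : 0 < eps / 4 by lra.
have [n hn'] := rtau_limit hH hM ht bsa wsa bw binc wc e4.
move: hn'; rewrite w_id (rtau_id ht) (rtauB hH hM ht) ?(rtau_id ht); last 2 first.
- exact: (M_id hH hM).
- by case: (zsa n).
have := ztr n; lra.
Qed.

Variable X : {fset (H -> H)}.
Hypothesis gen : generates dot X M.

Lemma fset_bounded (x : X) : bounded_op (val x).
Proof. by apply: (M_bounded hM); case: gen => h _; apply: h; exact: (valP x). Qed.

Local Notation ev := (nc_ev (letter (X := X)) (letter_adj dot (X := X))).

Lemma M_sub_bicommutant : M `<=` commutant (commutant (nc_alg dot X)).
Proof.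
have bA T : nc_alg dot X T -> bounded_op T.
  by move=> [P _ <-]; exact: (nc_ev_bounded hH fset_bounded).
case: gen => _; apply.
  apply: (bicommutant_vn hH bA) => _ [P _ <-].
  by rewrite (nc_ev_adjE hH fset_bounded); exists (nc_adj P).
move=> x /= xX; apply: (sub_bicommutant bA).
exists (nc_var R (FSetSub xX)) => //; apply/funext => v; by rewrite nc_ev_var.
Qed.

Lemma nc_ev_M P : M (ev P).
Proof.
have Mx (x : X) : M (val x) by case: gen => h _; apply: h; exact: (valP x).
have Mw (w : seq (X * bool)) : M (word_ev (letter (X := X)) (letter_adj dot (X := X)) w).
  elim: w => [|[x b] w IH] /=; first exact: (M_id hH hM).
  by apply: (M_comp hH hM) => //; case: b; [apply: (M_adj hM)|]; exact: Mx.
elim: P => [|t P IH].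
  rewrite (_ : ev [::] = 0); first exact: (M_zero hH hM).
  by apply/funext => v; rewrite /nc_ev big_nil.
rewrite (_ : ev (t :: P) = t.1 *: word_ev (letter (X := X)) (letter_adj dot (X := X)) t.2 + ev P).
  exact: (M_lin hH hM).
by apply/funext => v; rewrite /nc_ev big_cons.
Qed.

(** Strong approximation at finitely many separating vectors is upgraded to the 2-norm by
    [trace_abs_continuous]; this needs G - p to be bounded uniformly in the polynomial. [L] is any
    bound on the letters, in particular one that also covers the matrices of microstates. *)
Lemma projection_approx (p : H -> H) (L d : R) : projection dot M p -> 0 <= L ->
  (forall x, lbounded dot L (letter (X := X) x)) ->
  (forall x, lbounded dot L (letter_adj dot (X := X) x)) -> 0 < d ->
  exists N P, trace_sq dot tau (ev (nc_kap L N P) - p) <= d.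
Proof.
move=> [Mp pp ap] L0 bx bxs d0.
have psa : sa p by split.
have lp := M_linear hM Mp.
have ppv v : p (p v) = p v by rewrite -[p (p v)]/((p \o p) v) pp.
have pc v : sqn (p v) <= sqn v.
  have e : rdot (p v) v = sqn (p v) by rewrite -{1}ppv (sa_rdot hH hM _ _ psa).
  have := cauchy_schwarz hd (p v) v; rewrite e.
  have := sqn_ge0 hd (p v); have := sqn_ge0 hd v.
  move: (sqn (p v)) (sqn v) => A B B0 A0 h.
  have [->//|nz] := eqVneq A 0.
  have Ap : 0 < A by rewrite lt_neqAle eq_sym nz.
  by rewrite -(ler_pM2l Ap) -expr2.
have [xi sep] := separating_sequence hH hM ht.
(* 18 = 2 * 8 + 2 bounds the squared norm of D = G - p, so adj D o D divided by 18 is a positive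
   contraction. *)
have d18 : 0 < d / 18 by lra.
have [n [d' [d'0 hx]]] := trace_abs_continuous sep d18.
(* [nc_kap_sub] wants closeness at a vector and at its image under p; its constant 88 fixes the
   precision below. *)
pose eta (s : 'I_n + 'I_n) := match s with inl i => xi i | inr i => p (xi i) end.
have e0 : 0 < d' / 88 by lra.
have [P hP] := nc_sym_density hH fset_bounded eta (M_sub_bicommutant Mp) (fun u v => sa_rdot hH hM u v psa) e0.
pose K := \sum_(i < n) sqn (p (xi i)).
have K0 : 0 <= K by apply: sumr_ge0 => i _; exact: sqn_ge0.
have t0 : 0 < d' / (K + 1) by rewrite divr_gt0 //; lra.
have LB0 : 0 <= nc_bound L (nc_sym P) by exact: nc_bound_ge0.
have [N hN] := exists_expr_le (kap_rho_ge0 _) (kap_rho_lt1 LB0) t0.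
exists N, P; set G := ev _.
have lx := letter_lin fset_bounded; have lxs := letter_adj_lin hH fset_bounded.
have ax := letter_adjP hH fset_bounded.
have MG : M G by exact: nc_ev_M.
have MD : M (G - p) by exact: (M_sub hH hM).
have Dv v : (G - p) v = G v - p v by [].
have bD v : sqn ((G - p) v) <= 18 * sqn v.
  rewrite Dv; apply: le_trans (sqnB_le hd _ _) _.
  have := nc_kap_bound lx lxs hd ax L0 bx bxs N P v; have := pc v; rewrite -/G; lra.
have sD := tsq_sa hH hM MD.
have := sa_lin hH hM (18^-1) sD (sa_zero hH hM); rewrite addr0; set x := _ *: _ => sx.
have xv v : rdot (x v) v = 18^-1 * sqn ((G - p) v).
  by rewrite -[x v]/((18^-1)%:C *: (adj dot (G - p) \o (G - p)) v) (rdotZl hd) (tsq_form hH hM).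
have : rtau x <= d / 18.
  apply: hx => //.
  - by move=> v; rewrite xv (rdot0l hd) mulr_ge0 ?invr_ge0 //; exact: sqn_ge0.
  - by move=> v; rewrite xv -[leRHS]/(sqn v); have := bD v; lra.
  move=> i ilt; rewrite xv Dv.
  have h1 := hP (inl (Ordinal ilt)); have h2 := hP (inr (Ordinal ilt)); rewrite /= ppv in h2.
  have := nc_kap_sub lx lxs hd ax L0 bx bxs N lp ppv h1 h2; rewrite -/G.
  have Ki : sqn (p (xi i)) <= K.
    rewrite /K (bigD1 (Ordinal ilt)) //= lerDl; apply: sumr_ge0 => j _; exact: sqn_ge0.
  have p0 := sqn_ge0 hd (p (xi i)).
  have : kap_rho (nc_bound L (nc_sym P)) ^+ N * sqn (p (xi i)) <= d' / (K + 1) * K.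
    apply: ler_pM => //; exact: exprn_ge0 (kap_rho_ge0 _).
  have : d' / (K + 1) * K <= d' by rewrite mulrAC ler_pdivrMr; nra.
  rewrite -mulrA; lra.
rewrite (rtauZ hH hM ht); last by case: sD.
rewrite -/(trace_sq dot tau (G - p)); lra.
Qed.

End Continuity.

Local Open Scope sesquilinear_scope.

(** * Matrices *)

Section MatrixDot.
Variables (R : realType).
Local Notation C := R[i].

Definition dotm m n (A B : 'M[C]_(m, n)) : C := \sum_i \sum_j A i j * Num.conj (B i j).

Lemma nsqE (z : C) : z * Num.conj z = (nsq z)%:C.
Proof. by case: z => a b; apply/eqP; rewrite eq_complex /nsq /=; apply/andP; split; apply/eqP; ring. Qed.

Lemma Re_dotm m n (A B : 'M[C]_(m, n)) :
  re_dot (@dotm m n) A B = \sum_i \sum_j complex.Re (A i j * Num.conj (B i j)).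
Proof. by rewrite /re_dot Re_sum; apply: eq_bigr => i _; rewrite Re_sum. Qed.

Lemma sqn_dotm m n (A : 'M[C]_(m, n)) : sqnorm (@dotm m n) A = \sum_i \sum_j nsq (A i j).
Proof. by rewrite /sqnorm Re_dotm; apply: eq_bigr => i _; apply: eq_bigr => j _; rewrite nsqE. Qed.

Lemma prehilbert_dotm m n : prehilbert (@dotm m n).
Proof.
split.
- move=> c u v w; rewrite mulr_sumr -big_split; apply: eq_bigr => i _.
  rewrite mulr_sumr -big_split; apply: eq_bigr => j _ /=.
  by rewrite !mxE mulrDl mulrA.
- move=> u v; change (dotm v u = Num.conj (dotm u v)).
  rewrite rmorph_sum; apply: eq_bigr => i _.
  rewrite rmorph_sum; apply: eq_bigr => j _ /=.
  by rewrite rmorphM /= conjCK mulrC.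
- move=> u; rewrite -/(re_dot (@dotm m n) u u) -/(sqnorm _ u) sqn_dotm.
  by apply: sumr_ge0 => i _; apply: sumr_ge0 => j _; exact: nsq_ge0.
Qed.

Local Notation fro := (sqnorm (@dotm _ _)).
Local Notation hdm := (@prehilbert_dotm _ _).

Lemma nsqM (a b : C) : nsq (a * b) = nsq a * nsq b.
Proof. by case: a => a1 a2; case: b => b1 b2; rewrite /nsq /=; ring. Qed.

Lemma nsq_eq0 (z : C) : nsq z = 0 -> z = 0.
Proof.
case: z => a b; rewrite /nsq /= => h; apply/eqP; rewrite eq_complex /=.
have a0 : a ^+ 2 = 0 by have := sqr_ge0 a; have := sqr_ge0 b; lra.
have b0 : b ^+ 2 = 0 by have := sqr_ge0 a; have := sqr_ge0 b; lra.
by rewrite -sqrf_eq0 a0 eqxx -sqrf_eq0 b0 eqxx.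
Qed.

Lemma fro_eq0 m n (A : 'M[C]_(m, n)) : fro A = 0 -> A = 0.
Proof.
rewrite sqn_dotm => h; apply/matrixP => i j; rewrite mxE; apply: nsq_eq0.
apply: le_anti; rewrite nsq_ge0 andbT -h (bigD1 i) //= (bigD1 j) //=.
rewrite -addrA lerDl addr_ge0 //; first by apply: sumr_ge0 => l _; exact: nsq_ge0.
by apply: sumr_ge0 => l _; apply: sumr_ge0 => p _; exact: nsq_ge0.
Qed.

Lemma nsq_conj (z : C) : nsq (Num.conj z) = nsq z.
Proof. by case: z => a b; rewrite /nsq /= sqrrN. Qed.

Lemma fro_adj m n (A : 'M[C]_(m, n)) : fro (A^t*) = fro A.
Proof.
rewrite !sqn_dotm exchange_big; apply: eq_bigr => i _; apply: eq_bigr => j _.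
by rewrite !mxE nsq_conj.
Qed.

Lemma dotm_adj m n p (A : 'M[C]_(m, n)) (u : 'M[C]_(n, p)) (v : 'M[C]_(m, p)) :
  dotm (A *m u) v = dotm u (A^t* *m v).
Proof.
rewrite /dotm.
transitivity (\sum_i \sum_j \sum_l A i l * u l j * Num.conj (v i j)).
  by apply: eq_bigr => i _; apply: eq_bigr => j _; rewrite mxE mulr_suml.
transitivity (\sum_l \sum_j \sum_i A i l * u l j * Num.conj (v i j)).
  under eq_bigr do rewrite exchange_big.
  rewrite exchange_big; apply: eq_bigr => l _.
  by rewrite exchange_big.
apply: eq_bigr => l _; apply: eq_bigr => j _.
rewrite mxE rmorph_sum mulr_sumr; apply: eq_bigr => i _.
by rewrite !mxE rmorphM /= conjCK; ring.
Qed.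

Lemma rdotm_adj m n p (A : 'M[C]_(m, n)) (u : 'M[C]_(n, p)) (v : 'M[C]_(m, p)) :
  re_dot (@dotm _ _) (A *m u) v = re_dot (@dotm _ _) u (A^t* *m v).
Proof. by rewrite /re_dot dotm_adj. Qed.

(** As in [lbounded], the constant bounds the square of the operator norm. *)
Definition mxbd m n (c : R) (A : 'M[C]_(m, n)) := forall v : 'cV[C]_n, fro (A *m v) <= c * fro v.

Lemma fro_cols m n (A : 'M[C]_(m, n)) : fro A = \sum_j fro (col j A).
Proof.
rewrite sqn_dotm exchange_big; apply: eq_bigr => j _; rewrite sqn_dotm.
by apply: eq_bigr => i _; rewrite big_ord1 mxE.
Qed.

Lemma fro_mul_l m n p c (A : 'M[C]_(m, n)) (B : 'M[C]_(n, p)) : mxbd c A -> fro (A *m B) <= c * fro B.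
Proof.
move=> h; rewrite !fro_cols mulr_sumr; apply: ler_sum => j _.
by rewrite !colE -mulmxA; exact: h.
Qed.

Lemma adjmxM m n p (A : 'M[C]_(m, n)) (B : 'M[C]_(n, p)) : (A *m B)^t* = B^t* *m A^t*.
Proof. by rewrite trmx_mul map_mxM. Qed.

Lemma fro_mul_r m n p c (A : 'M[C]_(m, n)) (B : 'M[C]_(n, p)) :
  mxbd c (B^t*) -> fro (A *m B) <= c * fro A.
Proof.
move=> h; rewrite -fro_adj -[fro A]fro_adj adjmxM; exact: fro_mul_l.
Qed.

Lemma mxbd_adj m n c (A : 'M[C]_(m, n)) : 0 <= c -> mxbd c A -> mxbd c (A^t*).
Proof.
move=> c0 h v; set w := A^t* *m v.
have [->|nz] := eqVneq (fro w) 0; first by rewrite mulr_ge0 //; exact: (sqn_ge0 hdm).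
have p : 0 < fro w by rewrite lt_neqAle eq_sym nz; exact: (sqn_ge0 hdm).
rewrite -(ler_pM2l p) -expr2 {1}/sqnorm {2}/w -rdotm_adj.
apply: le_trans (cauchy_schwarz hdm _ _) _.
rewrite mulrA [_ * c]mulrC; apply: ler_wpM2r; [exact: (sqn_ge0 hdm)|exact: h].
Qed.

Lemma mxbd_le m n c d (A : 'M[C]_(m, n)) : c <= d -> mxbd c A -> mxbd d A.
Proof. by move=> h hA v; apply: le_trans (hA v) _; apply: ler_wpM2r => //; exact: (sqn_ge0 hdm). Qed.

Lemma fro_unitary_l k p (U : 'M[C]_k) (A : 'M[C]_(k, p)) : U^t* *m U = 1%:M -> fro (U *m A) = fro A.
Proof. by move=> h; rewrite {1}/sqnorm rdotm_adj mulmxA h mul1mx. Qed.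

Lemma fro_unitary_r k p (U : 'M[C]_k) (A : 'M[C]_(p, k)) : U *m U^t* = 1%:M -> fro (A *m U) = fro A.
Proof.
by move=> h; rewrite -fro_adj adjmxM fro_unitary_l ?fro_adj // trmxCK.
Qed.

(** A crude bound; it makes the set behind [opnorm] bounded, so that its supremum is an upper
    bound. *)
Lemma mxbd_fro m n (A : 'M[C]_(m, n)) : mxbd (fro A) A.
Proof.
move=> v; rewrite [leLHS]sqn_dotm [fro A]sqn_dotm mulr_suml; apply: ler_sum => i _.
rewrite big_ord1 mxE.
pose r : 'cV[C]_n := \col_j Num.conj (A i j).
have e : \sum_j A i j * v j 0 = dotm v r.
  by apply: eq_bigr => j _; rewrite big_ord1 !mxE conjCK mulrC.
have fr : \sum_j nsq (A i j) = fro r.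
  by rewrite sqn_dotm; apply: eq_bigr => j _; rewrite big_ord1 mxE nsq_conj.
rewrite e fr; set z := dotm v r.
have [z0|nz] := eqVneq (nsq z) 0; first by rewrite z0 mulr_ge0 //; exact: (sqn_ge0 hdm).
have zp : 0 < nsq z by rewrite lt_neqAle eq_sym nz nsq_ge0.
have : re_dot (@dotm _ _) (Num.conj z *: v) r = nsq z.
  by rewrite /re_dot (dotZl hdm) -/z mulrC nsqE.
have := cauchy_schwarz hdm (Num.conj z *: v) r; rewrite (sqnZ hdm) -/(nsq _) nsq_conj => cs e2.
by move: cs; rewrite e2 expr2 -mulrA ler_pM2l // mulrC.
Qed.

Lemma normc_sqr (z : C) : ComplexField.Normc.normc z ^+ 2 = nsq z.
Proof. by case: z => a b; rewrite /= sqr_sqrtr // addr_ge0 ?sqr_ge0. Qed.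

Lemma l2normE k (v : 'cV[C]_k) : l2norm v = Num.sqrt (fro v).
Proof.
congr Num.sqrt; rewrite sqn_dotm; apply: eq_bigr => i _; by rewrite big_ord1 normc_sqr.
Qed.

Lemma opnorm_bd k (A : 'M[C]_k) r : opnorm A <= r -> mxbd (r ^+ 2) A.
Proof.
move=> h.
pose S := [set l2norm (A *m v) | v in [set v : 'cV[C]_k | l2norm v <= 1]].
have sub1 v : l2norm v <= 1 -> l2norm (A *m v) <= r.
  move=> hv; apply: le_trans h; apply: (@sup_upper_bound _ S); last by exists v.
  split; first by exists (l2norm (A *m v)), v.
  exists (Num.sqrt (fro A)) => _ [w /= hw <-]; rewrite l2normE; apply: ler_wsqrtr.
  apply: le_trans (mxbd_fro A w) _.
  have w1 : fro w <= 1.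
    move: hw; rewrite l2normE -{1}(sqrtr1 R) => hw.
    by rewrite -(ler_psqrt (sqn_ge0 hdm w)) ?nnegrE.
  by rewrite -[leRHS]mulr1; apply: ler_wpM2l => //; exact: (sqn_ge0 hdm).
move=> v; have v0 := sqn_ge0 hdm v.
have r0 : 0 <= r.
  have z0 : l2norm (0 : 'cV[C]_k) = 0 by rewrite l2normE (sqn0 hdm) sqrtr0.
  by have := sub1 0; rewrite mulmx0 z0; apply; exact: ler01.
have [fv|nz] := eqVneq (fro v) 0.
  by rewrite (fro_eq0 fv) mulmx0 (sqn0 hdm) mulr0.
have vp : 0 < fro v by rewrite lt_neqAle eq_sym nz.
pose t := (Num.sqrt (fro v))^-1.
have t2 : t ^+ 2 * fro v = 1 by rewrite exprVn sqr_sqrtr // mulVf.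
have := sub1 (t%:C *: v); rewrite !l2normE (sqnZr hdm) t2 sqrtr1 lexx => /(_ isT).
rewrite -scalemxAr (sqnZr hdm) => h2.
have : Num.sqrt (t ^+ 2 * fro (A *m v)) ^+ 2 <= r ^+ 2.
  by apply: lerXn2r => //; rewrite nnegrE ?sqrtr_ge0.
rewrite sqr_sqrtr; last by rewrite mulr_ge0 ?sqr_ge0 //; exact: (sqn_ge0 hdm).
move=> h3; have : fro v * (t ^+ 2 * fro (A *m v)) <= fro v * r ^+ 2 by apply: ler_wpM2l.
by rewrite mulrA [fro v * _]mulrC t2 mul1r mulrC.
Qed.

Lemma tr_adj_mul k (A : 'M[C]_k) : complex.Re (\tr (A^t* *m A)) = fro A.
Proof.
rewrite sqn_dotm exchange_big /mxtrace Re_sum; apply: eq_bigr => j _.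
rewrite mxE Re_sum; apply: eq_bigr => i _.
by rewrite !mxE mulrC nsqE.
Qed.

Lemma Re_tr_norm k (A : 'M[C]_k) : complex.Re (tr_norm A) = complex.Re (\tr A) / k%:R.
Proof.
rewrite /tr_norm (_ : (k%:R : C)^-1 = (k%:R^-1 : R)%:C) 1?mulrC ?ReZ 1?mulrC //.
by rewrite fmorphV /= rmorph_nat.
Qed.

Lemma norm2E (I : finType) k (a : {ffun I -> 'M[C]_k}) :
  norm2 a = Num.sqrt (\sum_l fro (a l) / k%:R).
Proof. by congr Num.sqrt; apply: eq_bigr => l _; rewrite Re_tr_norm tr_adj_mul. Qed.

(** Cauchy-Schwarz against the identity matrix, whose squared Frobenius norm is k. *)
Lemma Re_tr_sqr_le k (A : 'M[C]_k) : complex.Re (\tr A) ^+ 2 <= k%:R * fro A.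
Proof.
have e : complex.Re (\tr A) = re_dot (@dotm _ _) A 1%:M.
  rewrite Re_dotm Re_sum; apply: eq_bigr => i _; rewrite (bigD1 i) //= big1 ?addr0.
    by rewrite mxE eqxx rmorph1 mulr1.
  by move=> j ji; rewrite mxE eq_sym (negPf ji) rmorph0 mulr0.
rewrite e; apply: le_trans (cauchy_schwarz hdm _ _) _; rewrite mulrC.
apply: ler_wpM2r; first exact: (sqn_ge0 hdm).
rewrite sqn_dotm (eq_bigr (fun=> 1)) ?sumr_const ?card_ord //= => i _.
rewrite (bigD1 i) //= big1 ?addr0; first by rewrite mxE eqxx /nsq /= expr1n expr0n addr0.
by move=> j ji; rewrite mxE eq_sym (negPf ji) /nsq /= expr0n addr0.
Qed.

End MatrixDot.

(** * Spectral projections and truncation of matrices *)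

Section Spectral.
Variables (R : realType).
Local Notation C := R[i].
Local Notation fro := (sqnorm (@dotm R _ _)).
Local Notation hdm := (@prehilbert_dotm R _ _).

Definition rdiag k (b : 'I_k -> R) : 'M[C]_k := diag_mx (\row_s (b s)%:C).

Lemma mxBE m n (A B : 'M[C]_(m, n)) s t : (A - B) s t = A s t - B s t.
Proof. by rewrite mxE [(- B) s t]mxE. Qed.

Lemma rdiag_mull k p (b : 'I_k -> R) (A : 'M[C]_(k, p)) s t :
  (rdiag b *m A) s t = (b s)%:C * A s t.
Proof. by rewrite mul_diag_mx !mxE. Qed.

Lemma rdiag_mulr k p (b : 'I_k -> R) (A : 'M[C]_(p, k)) s t :
  (A *m rdiag b) s t = A s t * (b t)%:C.
Proof. by rewrite mul_mx_diag !mxE. Qed.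

Lemma rdiag_adj k (b : 'I_k -> R) : (rdiag b)^t* = rdiag b.
Proof.
apply/matrixP => i j; rewrite !mxE rmorphMn /= eq_sym.
case: eqP => [->|_]; rewrite ?mulr0n ?mulr1n //; exact: conjc_real.
Qed.

Lemma nsq_real (r : R) : nsq r%:C = r ^+ 2.
Proof. by rewrite /nsq /= expr0n addr0. Qed.

Lemma nsq_sum (I : finType) (F : I -> C) : nsq (\sum_i F i) <= #|I|%:R * \sum_i nsq (F i).
Proof.
have e (z : C) : nsq z = fro (const_mx z : 'M[C]_(1, 1)) by rewrite sqn_dotm !big_ord1 mxE.
rewrite e; have -> : const_mx (\sum_i F i) = \sum_i const_mx (F i) :> 'M[C]_(1, 1).
  by apply/matrixP => i j; rewrite summxE mxE; apply: eq_bigr => l _; rewrite mxE.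
apply: le_trans (sqn_sum hdm _) _; rewrite (eq_bigr (fun i => nsq (F i))) //.
Qed.

Lemma hermitian_diag k (B : 'M[C]_k) : B^t* = B ->
  exists (U : 'M[C]_k) (b : 'I_k -> R), [/\ U *m U^t* = 1%:M, U^t* *m U = 1%:M & U *m B = rdiag b *m U].
Proof.
move=> hB; have hs : B \is hermsymmx by rewrite qualifE /= expr0 scale1r hB.
have /orthomx_spectralP hE := hermitian_normalmx hs.
have hr := hermitian_spectral_diag_real hs.
have hU := spectral_unitarymx B; set U := spectralmx B in hE hU *.
have UU : U *m U^t* = 1%:M by apply/unitarymxP.
have UU' : U^t* *m U = 1%:M by apply: mulmx1C.
exists U, (fun s => complex.Re (spectral_diag B 0 s)); split => //.
have -> : rdiag (fun s => complex.Re (spectral_diag B 0 s)) = diag_mx (spectral_diag B).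
  congr diag_mx; apply/matrixP => i j; rewrite mxE ord1.
  by apply: RRe_real; have /mxOverP := hr; apply.
by rewrite {1}hE (invmx_unitary hU) !mulmxA UU mul1mx.
Qed.

Section Close.
Variables (k : nat) (U B : 'M[C]_k) (b : 'I_k -> R) (J : finType) (lam : J -> R) (cl : 'I_k -> J).
Hypotheses (UU : U *m U^t* = 1%:M) (UU' : U^t* *m U = 1%:M) (UB : U *m B = rdiag b *m U).
Hypothesis hcl : forall s j, j != cl s -> 2^-1 <= `|b s - lam j|.

(** The spectral projection of [B] for the eigenvalues labelled j. *)
Definition spec_proj j : 'M[C]_k := U^t* *m rdiag (fun s => (cl s == j)%:R) *m U.

Lemma spec_proj_mulU j : U *m spec_proj j = rdiag (fun s => (cl s == j)%:R) *m U.
Proof. by rewrite /spec_proj !mulmxA UU mul1mx. Qed.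

Lemma spec_proj_bd j : mxbd 1 (spec_proj j).
Proof.
move=> v; rewrite mul1r -(fro_unitary_l (U := U)) // mulmxA spec_proj_mulU -mulmxA.
rewrite -(fro_unitary_l v UU') !sqn_dotm; apply: ler_sum => s _; apply: ler_sum => t _.
rewrite rdiag_mull nsqM nsq_real; case: (_ == _); rewrite ?expr1n ?mul1r //.
by rewrite expr0n mul0r nsq_ge0.
Qed.

Lemma spec_proj_adj j : (spec_proj j)^t* = spec_proj j.
Proof. by rewrite /spec_proj !adjmxM trmxCK rdiag_adj mulmxA. Qed.

Lemma tr_spec_proj j : complex.Re (\tr (spec_proj j)) = #|[pred s | cl s == j]|%:R.
Proof.
rewrite /spec_proj mxtrace_mulC mulmxA UU mul1mx /mxtrace Re_sum.
rewrite -sum1_card natr_sum [RHS]big_mkcond /=; apply: eq_bigr => s _.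
by rewrite !mxE eqxx inE mulr1n; case: (_ == _).
Qed.

(** In the eigenbasis, row s of U (B - lam_i) g_i is (b_s - lam_i) times row s of U g_i. For i other
    than the label of s the factor is at least 1/2, so that row of U g_i is small; since the g_i sum
    almost to 1, the remaining one is close to row s of U. Inverting the factor costs 4, which gives
    8 n^2. *)
Lemma spec_proj_close (g : J -> 'M[C]_k) (th : R) j :
  (forall i, fro ((B - (lam i)%:C%:M) *m g i) <= th) -> fro (\sum_i g i - 1%:M) <= th ->
  fro (g j - spec_proj j) <= (2 + 8 * #|J|%:R ^+ 2) * th.
Proof.
move=> h1 h2; set n := #|J|%:R : R.
have n1 : 1 <= n by rewrite ler1n; apply/card_gt0P; exists j.
pose h i := U *m g i; pose E := U *m (\sum_i g i - 1%:M).
have hent i s t : (U *m ((B - (lam i)%:C%:M) *m g i)) s t = (b s - lam i)%:C * h i s t.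
  rewrite mulmxA mulmxBr UB mul_mx_scalar mulmxBl -mulmxA -scalemxAl -/(h i).
  by rewrite mxBE rdiag_mull [((lam i)%:C *: h i) s t]mxE -mulrBl -rmorphB.
pose w i s t := if i != cl s then nsq (h i s t) else 0.
have w0 i s t : 0 <= w i s t by rewrite /w; case: ifP => // _; exact: nsq_ge0.
have wle i s t : w i s t <= 4 * nsq ((U *m ((B - (lam i)%:C%:M) *m g i)) s t).
  rewrite /w; case: ifP => [ic|_]; last by rewrite mulr_ge0 ?nsq_ge0.
  rewrite hent nsqM nsq_real; have := hcl ic => h4.
  have : (2^-1) ^+ 2 <= `|b s - lam i| ^+ 2 by apply: lerXn2r => //; rewrite nnegrE ?normr_ge0 ?invr_ge0.
  rewrite real_normK ?num_real // => h5.
  have := nsq_ge0 (h i s t); set z := nsq _; set y := (b s - lam i) ^+ 2 in h5 *.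
  have e4 : (2^-1 : R) ^+ 2 = 1/4 by field.
  rewrite e4 in h5; nra.
have wsum i : \sum_s \sum_t w i s t <= 4 * th.
  apply: le_trans (_ : 4 * fro (U *m ((B - (lam i)%:C%:M) *m g i)) <= _); last first.
    by rewrite (fro_unitary_l _ UU') ler_pM2l.
  rewrite sqn_dotm mulr_sumr; apply: ler_sum => s _; rewrite mulr_sumr; apply: ler_sum => t _.
  exact: wle.
have ent s t : nsq ((U *m (g j - spec_proj j)) s t) <= 2 * nsq (E s t) + 2 * n * \sum_i w i s t.
  have S0 : 0 <= \sum_i w i s t by apply: sumr_ge0.
  rewrite mulmxBr spec_proj_mulU mxBE rdiag_mull -/(h j).
  have [jc|jc] := eqVneq (cl s) j; last first.
    rewrite mul0r subr0; have : w j s t <= \sum_i w i s t.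
      by rewrite (bigD1 j) //= lerDl sumr_ge0.
    rewrite {1}/w eq_sym jc; have := nsq_ge0 (E s t); nra.
  rewrite mul1r; pose F i := if i != cl s then h i s t else 0.
  have -> : h j s t - U s t = E s t - \sum_i F i.
    have -> : E s t = \sum_i h i s t - U s t.
      by rewrite /E mulmxBr mulmx1 mxBE mulmx_sumr summxE.
    rewrite [\sum_i h i s t](bigD1 j) //= [\sum_i F i](bigD1 j) //= {1}/F -jc eqxx add0r jc.
    have -> : \sum_(i | i != j) F i = \sum_(i | i != j) h i s t.
      by apply: eq_bigr => i ij; rewrite /F jc ij.
    by ring.
  have nF : nsq (\sum_i F i) <= n * \sum_i w i s t.
    apply: le_trans (nsq_sum _) _; rewrite (eq_bigr (fun i => w i s t)) // => i _.
    by rewrite /F /w; case: ifP => // _; rewrite /nsq /= expr0n addr0.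
  have nB (x y : C) : nsq (x - y) <= 2 * nsq x + 2 * nsq y.
    case: x => x1 x2; case: y => y1 y2; rewrite /nsq /=.
    have := sqr_ge0 (x1 + y1); have := sqr_ge0 (x2 + y2); nra.
  apply: le_trans (nB _ _) _; rewrite -mulrA; lra.
rewrite -(fro_unitary_l (U := U)) // [leLHS]sqn_dotm.
apply: (@le_trans _ _ (\sum_s \sum_t (2 * nsq (E s t) + 2 * n * \sum_i w i s t))).
  by apply: ler_sum => s _; apply: ler_sum => t _; exact: ent.
under eq_bigr do rewrite big_split /= -!mulr_sumr.
rewrite big_split /= -!mulr_sumr -sqn_dotm (fro_unitary_l _ UU').
have -> : \sum_s \sum_t \sum_i w i s t = \sum_i \sum_s \sum_t w i s t.
  under eq_bigr do rewrite exchange_big.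
  by rewrite exchange_big.
have : \sum_i \sum_s \sum_t w i s t <= \sum_(i : J) 4 * th by apply: ler_sum.
rewrite sumr_const -mulr_natl -/n.
set Z := \sum_i _ => hZ.
have : 2 * n * Z <= 2 * n * (n * (4 * th)) by apply: ler_wpM2l => //; lra.
have -> : 2 * n * (n * (4 * th)) = 8 * n ^+ 2 * th by ring.
rewrite mulrDl; lra.
Qed.

(** The part of a, written in the eigenbasis, in the blocks rejected by [S]. With the support
    relation for [S], this part is shown to be small and is never coded; [on_mask] is what gets
    rounded. *)
Definition off_mask (S : J -> J -> bool) (a : 'M[C]_k) : 'M[C]_k :=
  \matrix_(s, t) (if S (cl s) (cl t) then 0 else (U *m a *m U^t*) s t).

Definition on_mask (S : J -> J -> bool) (a : 'M[C]_k) : 'M[C]_k :=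
  \matrix_(s, t) (if S (cl s) (cl t) then (U *m a *m U^t*) s t else 0).

Lemma fro_conjU a : fro (U *m a *m U^t*) = fro a.
Proof. by rewrite fro_unitary_r ?trmxCK // fro_unitary_l. Qed.

Lemma on_off_mask S a : U *m a *m U^t* = on_mask S a + off_mask S a.
Proof.
apply/matrixP => s t; rewrite [RHS]mxE [on_mask _ _ _ _]mxE [off_mask _ _ _ _]mxE.
by case: ifP; rewrite ?addr0 ?add0r.
Qed.

Lemma off_maskB S a a' : off_mask S (a - a') = off_mask S a - off_mask S a'.
Proof.
apply/matrixP => s t; rewrite mxBE [LHS]mxE [off_mask S a s t]mxE [off_mask S a' s t]mxE.
by rewrite mulmxBr mulmxBl mxBE; case: ifP => _; rewrite ?subr0.
Qed.

Lemma off_mask_le S a : fro (off_mask S a) <= fro a.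
Proof.
rewrite -(fro_conjU a) !sqn_dotm; apply: ler_sum => s _; apply: ler_sum => t _.
rewrite [off_mask _ _ _ _]mxE; case: ifP => // _.
by rewrite /nsq /= expr0n addr0 addr_ge0 ?sqr_ge0.
Qed.

Lemma fro_spec_block i j a : fro (spec_proj i *m a *m spec_proj j) =
  \sum_(s | cl s == i) \sum_(t | cl t == j) nsq ((U *m a *m U^t*) s t).
Proof.
have -> : spec_proj i *m a *m spec_proj j =
  U^t* *m (rdiag (fun s => (cl s == i)%:R) *m (U *m a *m U^t*) *m rdiag (fun s => (cl s == j)%:R)) *m U.
  by rewrite /spec_proj; move: (rdiag _) (rdiag _) (U^t*) => D E W; rewrite !mulmxA.
rewrite fro_unitary_r // fro_unitary_l ?trmxCK // sqn_dotm [RHS]big_mkcond.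
apply: eq_bigr => s _; rewrite [\sum_(t | _) _ in RHS]big_mkcond /=.
case: (cl s == i) (rdiag_mull (fun s => (cl s == i)%:R) (U *m a *m U^t*) s) => hs.
  apply: eq_bigr => t _; rewrite rdiag_mulr hs mul1r.
  by case: (_ == _); rewrite ?mulr1 ?mulr0 // /nsq /= expr0n addr0.
by apply: big1 => t _; rewrite rdiag_mulr hs !mul0r /nsq /= expr0n addr0.
Qed.

Lemma off_mask_blocks S a : fro (off_mask S a) =
  \sum_i \sum_(j | ~~ S i j) fro (spec_proj i *m a *m spec_proj j).
Proof.
rewrite sqn_dotm.
under [RHS]eq_bigr do under eq_bigr do rewrite fro_spec_block.
under [RHS]eq_bigr do rewrite exchange_big /=.
rewrite (partition_big cl predT) //=; apply: eq_bigr => i _.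
apply: eq_bigr => s /eqP csi.
rewrite (partition_big cl predT) //= [RHS]big_mkcond; apply: eq_bigr => j _ /=.
have [Sij|nSij] := boolP (S i j).
  apply: big1 => t /eqP ctj; rewrite mxE csi ctj Sij /nsq /= expr0n addr0 //.
by apply: eq_bigr => t /eqP ctj; rewrite mxE csi ctj (negPf nSij).
Qed.

End Close.

Definition mpow k (X : 'M[C]_k) n := iter n (mulmx X) 1%:M.

Lemma rdiag_mpow k (X U : 'M[C]_k) (b : 'I_k -> R) n : U *m X = rdiag b *m U ->
  U *m mpow X n = rdiag (fun s => b s ^+ n) *m U.
Proof.
move=> h; apply/matrixP => s t; rewrite rdiag_mull.
elim: n s t => [|n IH] s t; first by rewrite mulmx1 rmorph1 mul1r.
rewrite /mpow iterS mulmxA h -mulmxA rdiag_mull -/(mpow X n) IH.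
by rewrite exprS rmorphM mulrA.
Qed.

Lemma Re_diag_form (x y : R) (z : C) :
  complex.Re (x%:C * z * Num.conj (y%:C * (x%:C * z))) = x ^+ 2 * y * nsq z.
Proof. by case: z => u v; rewrite /nsq /=; ring. Qed.

(** A is cut on the right by the spectral projection of A^* A for eigenvalues at most rho. A
    discarded eigenvalue b satisfies b <= b^(n+1) / rho^n, so one high moment controls the error
    whatever the norm of A. *)
Lemma truncation k (A : 'M[C]_k) (rho : R) n : 0 < rho ->
  exists A', mxbd rho A' /\ fro (A - A') <= complex.Re (\tr (mpow (A^t* *m A) n.+1)) / rho ^+ n.
Proof.
move=> rho0; have hB : (A^t* *m A)^t* = A^t* *m A by rewrite adjmxM trmxCK.
have [U [b [UU UU' UB]]] := hermitian_diag hB.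
pose Y := A *m U^t*.
have YY : Y^t* *m Y = rdiag b.
  by rewrite /Y adjmxM trmxCK -[U *m A^t* *m _]mulmxA [A^t* *m _]mulmxA mulmxA UB -mulmxA UU mulmx1.
have bE s : b s = \sum_i nsq (Y i s).
  have := congr1 (fun Z : 'M[C]_k => complex.Re (Z s s)) YY.
  rewrite !mxE eqxx mulr1n /= => <-; rewrite Re_sum; apply: eq_bigr => i _.
  by rewrite !mxE mulrC nsqE.
have b0 s : 0 <= b s by rewrite bE; apply: sumr_ge0 => i _; exact: nsq_ge0.
pose e s : R := (b s <= rho)%R%:R.
exists (A *m (U^t* *m rdiag e *m U)); split.
  move=> v; have -> : A *m (U^t* *m rdiag e *m U) *m v = Y *m (rdiag e *m (U *m v)).
    by rewrite /Y !mulmxA.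
  set w := U *m v; rewrite {1}/sqnorm rdotm_adj [Y^t* *m _]mulmxA YY Re_dotm.
  rewrite -(fro_unitary_l v UU') -/w sqn_dotm mulr_sumr; apply: ler_sum => s _.
  rewrite mulr_sumr; apply: ler_sum => t _.
  rewrite !rdiag_mull Re_diag_form; apply: ler_wpM2r; first exact: nsq_ge0.
  rewrite /e; case: (leP (b s) rho) => h; first by rewrite expr1n mul1r.
  by rewrite expr0n mul0r ltW.
have -> : fro (A - A *m (U^t* *m rdiag e *m U)) = fro (Y - Y *m rdiag e).
  rewrite -(fro_unitary_r (U := U^t*)) ?trmxCK // mulmxBl; congr (fro (_ - _)).
  by rewrite /Y -!mulmxA UU mulmx1.
have tr n' : complex.Re (\tr (mpow (A^t* *m A) n')) = \sum_s b s ^+ n'.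
  have -> : mpow (A^t* *m A) n' = U^t* *m (rdiag (fun s => b s ^+ n') *m U).
    by rewrite -(rdiag_mpow n' UB) mulmxA UU' mul1mx.
  rewrite mxtrace_mulC -mulmxA UU mulmx1 /mxtrace Re_sum; apply: eq_bigr => s _.
  by rewrite !mxE eqxx mulr1n.
rewrite tr sqn_dotm exchange_big /= mulr_suml; apply: ler_sum => s _.
have -> : \sum_i nsq ((Y - Y *m rdiag e) i s) = (1 - e s) ^+ 2 * b s.
  rewrite bE mulr_sumr; apply: eq_bigr => i _; rewrite mxBE rdiag_mulr.
  by case: (Y i s) => x y; rewrite /nsq /=; ring.
rewrite ler_pdivlMr ?exprn_gt0 // /e; case: (leP (b s) rho) => h.
  by rewrite subrr expr0n !mul0r exprn_ge0.
rewrite subr0 expr1n mul1r exprS; apply: ler_wpM2l => //.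
by apply: lerXn2r; rewrite ?nnegrE; [exact: ltW|exact: b0|exact: ltW].
Qed.

End Spectral.

(** * Rounding to a lattice *)

Section Lattice.
Variable R : realType.

Lemma geometric_le (y : R) n : 0 <= y -> y < 1 -> \sum_(i < n) y ^+ i <= (1 - y)^-1.
Proof.
move=> y0 y1; have p : 0 < 1 - y by rewrite subr_gt0.
rewrite -[leRHS]mul1r ler_pdivlMr //.
have -> : (\sum_(i < n) y ^+ i) * (1 - y) = 1 - y ^+ n.
  elim: n => [|n IH]; first by rewrite big_ord0 mul0r expr0 subrr.
  by rewrite big_ord_recr /= mulrDl IH exprS; ring.
by rewrite gerBl exprn_ge0.
Qed.

(** From exp(2x) >= 1 + 2x and (1 + 2x) (1 - x) = 1 + x (1 - 2x) >= 1. *)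
Lemma expr_lower (x : R) N : 0 <= x -> x <= 2^-1 -> 1 <= expR (2 * x * N%:R) * (1 - x) ^+ N.
Proof.
move=> x0 x1; have h : 1 <= expR (2 * x) * (1 - x).
  have := expR_ge1Dx (2 * x) => h1.
  have : (1 + 2 * x) * (1 - x) <= expR (2 * x) * (1 - x) by apply: ler_wpM2r => //; lra.
  nra.
by rewrite expRM_natr -exprMn; apply: exprn_ege1.
Qed.

(* Lattice points are stored as sign and absolute value; [ord0] with sign [false] is the point 0. *)
Definition code_fun (J : finType) (N : nat) (s : R) (t : J -> R) : {ffun J -> bool * 'I_N.+1} :=
  [ffun j => (Num.floor (t j / s) < 0, inord `|Num.floor (t j / s)|%N)].

(** An l^1 ball of lattice points supported in [S]; the l^1 norm is what makes the generating
    function of [code_set_card] a product over coordinates. *)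
Definition code_set (J : finType) (N : nat) (S : pred J) : {set {ffun J -> bool * 'I_N.+1}} :=
  finset (fun f : {ffun J -> bool * 'I_N.+1} =>
    [forall j, S j || (f j == (false, ord0))] && (\sum_j val (f j).2 <= N)%N).

(* Each lattice point f satisfies y^N <= y^(sum_j |f j|), and the right-hand sides sum to a product of
   geometric series. *)
Lemma code_set_card (J : finType) (N : nat) (S : pred J) (y : R) : 0 <= y -> y < 1 ->
  #|code_set N S|%:R * y ^+ N <= (2 / (1 - y)) ^+ #|S|.
Proof.
move=> y0 y1; have p : 0 < 1 - y by rewrite subr_gt0.
pose Q j := fun v : bool * 'I_N.+1 => S j || (v == (false, ord0)).
rewrite -sum1_card natr_sum mulr_suml.
apply: (@le_trans _ _ (\sum_(f in family Q) \prod_j y ^+ (val (f j).2))).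
  rewrite [leLHS]big_mkcond [leRHS]big_mkcond /=; apply: ler_sum => f _.
  have q0 : 0 <= \prod_j y ^+ (val (f j).2) by apply: prodr_ge0 => j _; exact: exprn_ge0.
  rewrite inE; case: ifP => [/andP[/forallP h1 h2]|_]; last by case: ifP.
  have -> : f \in family Q by apply/familyP => j; exact: h1.
  rewrite mul1r prodrXr; apply: ler_wiXn2l => //; exact: ltW.
rewrite -(bigA_distr_big_dep Q (fun j (v : bool * 'I_N.+1) => y ^+ val v.2)) /=.
rewrite -prodr_const [leRHS]big_mkcond; apply: ler_prod => j _.
apply/andP; split; first by apply: sumr_ge0 => v _; exact: exprn_ge0.
rewrite /Q -[j \in _]/(S j); case: (S j) => /=; last first.
  by rewrite big_pred1_eq expr0.
rewrite -(pair_bigA _ (fun (b : bool) (i : 'I_N.+1) => y ^+ i)) /= big_bool /=.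
have := geometric_le N.+1 y0 y1; rewrite -[2]/(1 + 1) mulrDl mul1r; lra.
Qed.

(** The l^2 bound T k becomes an l^1 bound N at the chosen mesh, and the l^1 ball is counted. The
    code [cd] is fixed before the support S, because in the application S depends on an earlier
    code; only the set of values depends on S. *)
Lemma lattice_code (J : finType) (k : nat) (c T D : R) : (0 < k)%N -> 0 < c -> c <= 1 ->
  0 <= T -> 1 <= D ->
  exists (T' : finType) (cd : (J -> R) -> T'), forall S : pred J, #|S|%:R <= D * k%:R ^+ 2 ->
    exists A : {set T'},
    [/\ #|A|%:R <= expR (k%:R ^+ 2 + #|S|%:R * ln (8 * (2 * D + T) / c)),
       forall t, (forall j, ~~ S j -> t j = 0) -> \sum_j t j ^+ 2 <= T * k%:R -> cd t \in A &
       forall t t', (forall j, ~~ S j -> t j = 0) -> \sum_j t j ^+ 2 <= T * k%:R ->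
         (forall j, ~~ S j -> t' j = 0) -> \sum_j t' j ^+ 2 <= T * k%:R -> cd t = cd t' ->
         forall j, (t j - t' j) ^+ 2 <= c ^+ 2 / k%:R].
Proof.
move=> k0 c0 c1 T0 D1; pose K := 2 * D + T; have K2 : 2 <= K by rewrite /K; lra.
have kr : 0 < k%:R :> R by rewrite ltr0n.
(* With this mesh the squared error is at most c^2 / k per coordinate, hence c^2 k over k^2
   coordinates. *)
pose s := c / Num.sqrt k%:R.
have sk : 0 < Num.sqrt k%:R :> R by rewrite sqrtr_gt0.
have s0 : 0 < s by rewrite divr_gt0.
have s2 : s ^+ 2 = c ^+ 2 / k%:R by rewrite exprMn exprVn sqr_sqrtr // ltW.
pose M := K * k%:R ^+ 2 / c; have M0 : 0 <= M by rewrite divr_ge0 ?mulr_ge0 ?ltW ?exprn_gt0 //; lra.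
pose N := Num.truncn M; have NM : N%:R <= M by rewrite truncn_le.
exists {ffun J -> bool * 'I_N.+1}, (code_fun N s) => S hS; exists (code_set N S).
have fl (x : R) : `|Num.floor x|%N%:R <= `|x| + 1.
  have [h1 h2] : (Num.floor x)%:~R <= x /\ x < (Num.floor x + 1)%:~R.
    by have /andP := floor_itv x.
  rewrite -[_%:R]/(`|Num.floor x|%N%:~R) -[(Posz _)]/(`|Num.floor x|%N : int) abszE intr_norm.
  rewrite intrD in h2; rewrite ler_norml; have := ler_norm x; have := ler_norm (- x); rewrite normrN => a b.
  by apply/andP; split; lra.
have total t : (forall j, ~~ S j -> t j = 0) -> \sum_j t j ^+ 2 <= T * k%:R ->
    (\sum_j `|Num.floor (t j / s)| <= N)%N.
  move=> tS tT; rewrite -(ler_nat R) natr_sum.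
  suff h : \sum_j `|Num.floor (t j / s)|%N%:R <= M.
    by rewrite -natr_sum in h *; rewrite ler_nat /N truncn_ge_nat.
  (* On the support, |x| + 1 <= 1 + 1/(2c) + (c/2) x^2; the weight c makes the sum of either part of
     order k^2 / c. *)
  apply: (@le_trans _ _ (\sum_j ((S j)%:R * (1 + (2 * c)^-1) + (c / 2) * (t j / s) ^+ 2))).
    apply: ler_sum => j _; case: (boolP (S j)) => Sj; last first.
      by rewrite tS // mul0r floor0 absz0 mul0r add0r expr0n mulr0.
    rewrite mul1r; apply: le_trans (fl _) _.
    set x := t j / s; have xx : `|x| ^+ 2 = x ^+ 2 by rewrite real_normK ?num_real.
    have : 0 <= (c * `|x| - 1) ^+ 2 / (2 * c) by rewrite divr_ge0 ?sqr_ge0 //; lra.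
    have -> : (c * `|x| - 1) ^+ 2 / (2 * c) = c / 2 * `|x| ^+ 2 - `|x| + (2 * c)^-1 by field; rewrite lt0r_neq0.
    rewrite xx; lra.
  rewrite big_split /= -mulr_suml -mulr_sumr.
  have -> : \sum_j (S j)%:R = #|S|%:R :> R.
    by rewrite -sum1_card natr_sum [RHS]big_mkcond; apply: eq_bigr => j _; rewrite -[j \in _]/(S j); case: (S j).
  have -> : \sum_j (t j / s) ^+ 2 = (k%:R / c ^+ 2) * \sum_j t j ^+ 2.
    rewrite mulr_sumr; apply: eq_bigr => j _; rewrite exprMn exprVn s2; field.
    by rewrite !lt0r_neq0.
  have cn : 0 <= 1 + (2 * c)^-1 by rewrite addr_ge0 // invr_ge0; lra.
  apply: (@le_trans _ _ (D * k%:R ^+ 2 * (1 + (2 * c)^-1) + c / 2 * (k%:R / c ^+ 2 * (T * k%:R)))).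
    apply: lerD; first by rewrite ler_wpM2r.
    rewrite ler_wpM2l //; first lra.
    by rewrite ler_wpM2l // divr_ge0 ?ltW // exprn_gt0.
  rewrite /M ler_pdivlMr //.
  have -> : (D * k%:R ^+ 2 * (1 + (2 * c)^-1) + c / 2 * (k%:R / c ^+ 2 * (T * k%:R))) * c
    = k%:R ^+ 2 * (D * c + D / 2 + T / 2) by field; rewrite lt0r_neq0.
  rewrite [leRHS]mulrC; apply: ler_wpM2l; first exact: sqr_ge0.
  have : D * c <= D * 1 by apply: ler_wpM2l => //; lra.
  rewrite /K; lra.
(* No coordinate exceeds N, so [inord] in [code_fun] never falls back to its default value. *)
have each t j : (forall j, ~~ S j -> t j = 0) -> \sum_j t j ^+ 2 <= T * k%:R ->
    (`|Num.floor (t j / s)| < N.+1)%N.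
  by move=> h1 h2; rewrite ltnS; apply: leq_trans (total t h1 h2); rewrite (bigD1 j) //= leq_addr.
split.
(* With y = 1 - x in [code_set_card], 2 / (1 - y) is 8 K / c and (1 - x)^-N is at most exp(k^2 /
   2). *)
- pose x := c / (4 * K).
  have x0 : 0 < x by rewrite divr_gt0 //; lra.
  have x1 : x <= 2^-1 by rewrite /x ler_pdivrMr; lra.
  have := @code_set_card J N S (1 - x); rewrite subr_ge0 gtrBl x0 => /(_ _ isT) h.
  have {}h : #|code_set N S|%:R * (1 - x) ^+ N <= (8 * K / c) ^+ #|S|.
    apply: le_trans (h _) _; first lra.
    by rewrite opprB addrC subrK /x le_eqVlt; apply/orP; left; apply/eqP; congr (_ ^+ _); field; rewrite !lt0r_neq0 //; lra.
  have L0 : 0 < 8 * K / c by rewrite divr_gt0 //; lra.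
  rewrite expRD expRM_natl lnK ?posrE //.
  have e1 := expr_lower N (ltW x0) x1.
  have e2 : expR (2 * x * N%:R) <= expR (k%:R ^+ 2).
    rewrite ler_expR; apply: (@le_trans _ _ (2 * x * M)).
      by apply: ler_wpM2l => //; lra.
    rewrite (_ : 2 * x * M = k%:R ^+ 2 / 2); last by rewrite /x /M; field; rewrite !lt0r_neq0 //; lra.
    have := sqr_ge0 (k%:R : R); lra.
  have e3 := expR_gt0 (2 * x * N%:R).
  apply: (@le_trans _ _ (#|code_set N S|%:R * (expR (2 * x * N%:R) * (1 - x) ^+ N))).
    by rewrite ler_peMr.
  rewrite mulrCA; apply: ler_pM => //.
  by rewrite mulr_ge0 // exprn_ge0 //; lra.
- move=> t h1 h2; rewrite inE; apply/andP; split.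
    apply/forallP => j; case: (boolP (S j)) => //= Sj; rewrite ffunE h1 // mul0r floor0 ltxx absz0.
    by apply/eqP; congr (_, _); apply: val_inj; rewrite /= inordK.
  rewrite (eq_bigr (fun j => `|Num.floor (t j / s)|%N)); first exact: total.
  by move=> j _; rewrite ffunE /= inordK //; exact: each.
- move=> t t' h1 h2 h1' h2' ecd j; rewrite -s2.
  have /ffunP /(_ j) := ecd; rewrite !ffunE => -[e1 e2].
  have {}e2 := congr1 val e2; rewrite /= !inordK ?each // in e2.
  have e : Num.floor (t j / s) = Num.floor (t' j / s).
    move: e1 e2; set a := Num.floor _; set b := Num.floor _ => e1 e2.
    by case: a b e1 e2 => a [] b //= _ => [->|[->]].
  have /andP [l1 u1] := floor_itv (t j / s); have /andP [l2 u2] := floor_itv (t' j / s).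
  rewrite -e !intrD in u1 u2 l2.
  have -> : t j - t' j = (t j / s - t' j / s) * s by rewrite mulrBl !divfK ?lt0r_neq0.
  rewrite exprMn -[leRHS]mul1r; apply: ler_wpM2r; first exact: sqr_ge0.
  move: (t j / s) (t' j / s) (_%:~R) l1 u1 l2 u2 => p q m *; nra.
Qed.

End Lattice.

Section Covering.
Variables (R : realType) (I : finType) (k : nat).
Local Notation MT := {ffun I -> 'M[R[i]]_k}.

(** One representative per code value that occurs, taken in [Y] because nets must lie in [Y]. *)
Lemma covering_le (e : R) (Y : set MT) (T : finType) (cd : MT -> T) (A : {set T}) :
  (forall y, Y y -> cd y \in A) ->
  (forall y y', Y y -> Y y' -> cd y = cd y' -> norm2 (y - y') < e) ->
  (covering_number e Y <= (#|A|%:R)%:E)%E.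
Proof.
move=> h1 h2.
pose hit z := `[< exists2 y, Y y & cd y = z >].
pose rep z : MT := xget 0 [set y | Y y /\ cd y = z].
have repP z : hit z -> Y (rep z) /\ cd (rep z) = z.
  move=> /asboolP [y Yy yz].
  by apply: (@xgetPex _ 0 [set y | Y y /\ cd y = z]); exists y.
pose S := [fset rep z | z in [seq z <- enum A | hit z]]%fset.
have SY : is_net e Y S.
  split.
    by move=> y /= /imfsetP [z /=]; rewrite mem_filter => /andP [/repP [? _] _] ->.
  move=> y Yy; have hy : hit (cd y) by apply/asboolP; exists y.
  have [Yr cr] := repP _ hy.
  exists (rep (cd y)); last exact: h2.
  by apply/imfsetP; exists (cd y) => //=; rewrite mem_filter hy mem_enum h1.
apply: (@le_trans _ _ (#|` S|%:R)%:E).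
  by apply: ereal_inf_lbound; exists S.
rewrite lee_fin ler_nat; apply: leq_trans (leq_imfset_card _ _ _) _ => /=.
apply: leq_trans (size_undup _) _.
rewrite cardE size_filter.
exact: count_size.
Qed.

End Covering.

(** * Microstates *)

Section MatrixEval.
Variables (R : realType) (I : finType) (k : nat) (a : {ffun I -> 'M[R[i]]_k}).
Local Notation C := R[i].
Local Notation fro := (sqnorm (@dotm R _ _)).
Local Notation hdm := (@prehilbert_dotm R _ _).

Definition mx_letter i (v : 'cV[C]_k) : 'cV[C]_k := a i *m v.
Definition mx_letter_adj i (v : 'cV[C]_k) : 'cV[C]_k := (a i)^t* *m v.
Definition mx_ev (P : ncpoly R I) : 'M[C]_k := \sum_(t <- P) t.1 *: mx_word a t.2.

Lemma mulmx_linear m n (A : 'M[C]_(m, n)) : linear (fun v : 'cV[C]_n => A *m v).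
Proof. by move=> c u v; rewrite mulmxDr -scalemxAr. Qed.

Lemma mx_letter_lin i : linear (mx_letter i). Proof. exact: mulmx_linear. Qed.
Lemma mx_letter_adj_lin i : linear (mx_letter_adj i). Proof. exact: mulmx_linear. Qed.

Lemma mx_letter_adjP i u v :
  re_dot (@dotm R _ _) (mx_letter i u) v = re_dot (@dotm R _ _) u (mx_letter_adj i v).
Proof. exact: rdotm_adj. Qed.

Lemma mx_wordE w v : mx_word a w *m v = word_ev mx_letter mx_letter_adj w v.
Proof.
elim: w v => [|[i b] w IH] v /=; first by rewrite mul1mx.
by rewrite -mulmxA IH; case: b.
Qed.

Lemma mx_evE P v : mx_ev P *m v = nc_ev mx_letter mx_letter_adj P v.
Proof.
rewrite /mx_ev mulmx_suml; apply: eq_bigr => t _.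
by rewrite -scalemxAl mx_wordE.
Qed.

Lemma mx_ext m n (A B : 'M[C]_(m, n)) : (forall v : 'cV[C]_n, A *m v = B *m v) -> A = B.
Proof.
move=> h; apply/matrixP => i j; have := h (delta_mx j 0).
by rewrite -!colE => /matrixP /(_ i 0); rewrite !mxE.
Qed.

Lemma mx_ev_mul P Q : mx_ev (nc_mul P Q) = mx_ev P *m mx_ev Q.
Proof.
apply: mx_ext => v; rewrite -mulmxA !mx_evE nc_ev_mul //; [exact: mx_letter_lin|exact: mx_letter_adj_lin].
Qed.

Lemma mx_ev_cat P Q : mx_ev (P ++ Q) = mx_ev P + mx_ev Q.
Proof. by rewrite /mx_ev big_cat. Qed.

Lemma mx_ev_scale c P : mx_ev (nc_scale c P) = c *: mx_ev P.
Proof. by rewrite /mx_ev big_map scaler_sumr; apply: eq_bigr => t _; rewrite scalerA. Qed.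

Lemma mx_ev_one : mx_ev (nc_one R I) = 1%:M.
Proof. by rewrite /mx_ev big_seq1 scale1r. Qed.

Lemma mx_ev_var i : mx_ev (nc_var R i) = a i.
Proof. by rewrite /mx_ev big_seq1 scale1r /= mulmx1. Qed.

Lemma adj_unique_mx (A B : 'M[C]_k) :
  (forall u v : 'cV[C]_k, re_dot (@dotm R _ _) (A *m u) v = re_dot (@dotm R _ _) u (B *m v)) -> A^t* = B.
Proof.
move=> h; apply: mx_ext => v; apply/eqP; rewrite -subr_eq0; apply/eqP; apply: fro_eq0.
by rewrite {1}/sqnorm (rdotBr hdm) -h -rdotm_adj subrr.
Qed.

Lemma mx_ev_adj P : (mx_ev P)^t* = mx_ev (nc_adj P).
Proof.
apply: adj_unique_mx => u v; rewrite !mx_evE; apply: (nc_ev_adj _ _ hdm).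
- exact: mx_letter_lin.
- exact: mx_letter_adj_lin.
- exact: mx_letter_adjP.
Qed.

Lemma mx_ev_kap L N P : 0 <= L -> (forall i, mxbd L (a i)) ->
  (mx_ev (nc_kap L N P))^t* = mx_ev (nc_kap L N P) /\ mxbd 8 (mx_ev (nc_kap L N P)).
Proof.
move=> L0 bx; have bxs i : mxbd L ((a i)^t*) by apply: mxbd_adj.
split.
  apply: adj_unique_mx => u v; rewrite !mx_evE; apply: (nc_kap_sa _ _ hdm).
  - exact: mx_letter_lin.
  - exact: mx_letter_adj_lin.
  - exact: mx_letter_adjP.
move=> v; rewrite mx_evE; apply: (nc_kap_bound _ _ hdm) => //.
- exact: mx_letter_lin.
- exact: mx_letter_adj_lin.
- exact: mx_letter_adjP.
Qed.

End MatrixEval.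

Section Moments.
Variables (R : realType) (H : completeNormedModType R[i]).
Variable dot : {dot H for (@conjc R)}.
Hypothesis hH : hilbert dot.
Local Notation rdot := (re_dot dot).
Let hd := prehilbert_dot hH.
Variable M : set (H -> H).
Hypothesis hM : von_neumann_algebra dot M.
Variable tau : (H -> H) -> R[i].
Hypothesis ht : faithful_normal_trace dot M tau.
Variable X : {fset (H -> H)}.
Hypothesis gen : generates dot X M.
Local Notation rtau := (re_trace tau).
Local Notation tsq := (trace_sq dot tau).
Local Notation ev := (nc_ev (letter (X := X)) (letter_adj dot (X := X))).
Local Notation fro := (sqnorm (@dotm R _ _)).
Local Notation hdm := (@prehilbert_dotm R _ _).

Definition nc_wt (I : Type) (P : ncpoly R I) : R := \sum_(t <- P) ComplexField.Normc.normc t.1.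

Lemma normc_ge0 (z : R[i]) : 0 <= ComplexField.Normc.normc z.
Proof. by case: z => x y; rewrite /= sqrtr_ge0. Qed.

Lemma Re_le_normc (z : R[i]) : `|complex.Re z| <= ComplexField.Normc.normc z.
Proof.
case: z => x y /=; rewrite -sqrtr_sqr; apply: ler_wsqrtr.
by rewrite lerDl sqr_ge0.
Qed.

Lemma nc_wt_ge0 (I : Type) (P : ncpoly R I) : 0 <= nc_wt P.
Proof. by apply: sumr_ge0 => t _; exact: normc_ge0. Qed.

Lemma tau_nc_ev P : tau (ev P) = \sum_(t <- P) t.1 * tau (op_word dot t.2).
Proof.
have Mw w : M (op_word dot (X := X) w).
  have := nc_ev_M hH hM gen [:: (1, w)].
  by rewrite (_ : ev [:: (1, w)] = op_word dot w) //; apply/funext => v; rewrite /nc_ev big_seq1 scale1r.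
elim: P => [|t P IH].
  rewrite big_nil (_ : ev [::] = 0); first exact: (tau_zero hH hM ht).
  by apply/funext => v; rewrite /nc_ev big_nil.
rewrite big_cons -IH (_ : ev (t :: P) = t.1 *: op_word dot t.2 + ev P).
  by apply: (tau_lin ht) => //; exact: nc_ev_M.
by apply/funext => v; rewrite /nc_ev big_cons.
Qed.

Lemma moment_le r m k g (a : {ffun X -> 'M[R[i]]_k}) P : microstates dot tau r m g a ->
  0 <= g -> (nc_deg P <= m)%N ->
  `|rtau (ev P) - complex.Re (\tr (mx_ev a P)) / k%:R| <= g * nc_wt P.
Proof.
move=> [_ ha] g0 hm.
have -> : complex.Re (\tr (mx_ev a P)) / k%:R = complex.Re (\sum_(t <- P) t.1 * tr_norm (mx_word a t.2)).
  rewrite -Re_tr_norm; congr complex.Re; rewrite /tr_norm /mx_ev raddf_sum mulr_suml.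
  by apply: eq_bigr => t _; rewrite /= mxtraceZ mulrA.
rewrite /re_trace tau_nc_ev -raddfB -sumrB.
apply: le_trans (Re_le_normc _) _.
rewrite /nc_wt mulr_sumr.
have hm' t : t \in P -> (size t.2 <= m)%N.
  move=> tP; apply: leq_trans hm; rewrite /nc_deg.
  by rewrite (big_rem t) //= leq_maxl.
elim: P {hm} hm' => [|t P IH] hm'.
  by rewrite !big_nil ComplexField.Normc.normc0.
rewrite !big_cons; apply: le_trans (le_normcD _ _) _; apply: lerD; last first.
  by apply: IH => s sP; apply: hm'; rewrite inE sP orbT.
rewrite -mulrBr ComplexField.Normc.normcM mulrC; apply: ler_wpM2r; first exact: normc_ge0.
by apply: ltW; apply: ha; apply: hm'; rewrite inE eqxx.
Qed.

(** Polynomial moments are linear combinations of word moments: the largest degree gives m, and the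
    total mass of the coefficients gives g. *)
Lemma moments_uniform (Ps : seq (ncpoly R X)) (d : R) : 0 < d ->
  exists m (g : R), 0 < g /\ forall r k (a : {ffun X -> 'M[R[i]]_k}), microstates dot tau r m g a ->
   forall P, P \in Ps -> `|rtau (ev P) - complex.Re (\tr (mx_ev a P)) / k%:R| <= d.
Proof.
move=> d0; pose W := \sum_(P <- Ps) nc_wt P.
have W0 : 0 <= W by apply: sumr_ge0 => P _; exact: nc_wt_ge0.
exists (\max_(P <- Ps) nc_deg P), (d / (W + 1)).
have W1 : 0 < W + 1 by rewrite ltr_wpDl.
split; first by rewrite divr_gt0.
move=> r k a ha P PPs.
have h1 : (nc_deg P <= \max_(P <- Ps) nc_deg P)%N by rewrite (big_rem P) //= leq_maxl.
have g0 : 0 <= d / (W + 1) by rewrite divr_ge0 ?ltW.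
apply: le_trans (moment_le ha g0 h1) _.
have h2 : nc_wt P <= W.
  rewrite /W (big_rem P) //= lerDl; apply: sumr_ge0 => Q _; exact: nc_wt_ge0.
rewrite mulrAC ler_pdivrMr //; apply: ler_wpM2l; [exact: ltW|lra].
Qed.

(** Its trace is a squared 2-norm, so 2-norm estimates in M pass to microstates as moments. *)
Definition nc_sq (P : ncpoly R X) := nc_mul (nc_adj P) P.

Lemma nc_sq_moment P k (a : {ffun X -> 'M[R[i]]_k}) d :
  `|rtau (ev (nc_sq P)) - complex.Re (\tr (mx_ev a (nc_sq P))) / k%:R| <= d ->
  (0 < k)%N -> fro (mx_ev a P) <= (tsq (ev P) + d) * k%:R.
Proof.
move=> h k0; have bX := fset_bounded hM gen.
have e1 : rtau (ev (nc_sq P)) = tsq (ev P).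
  rewrite /trace_sq (nc_ev_adjE hH bX); congr rtau; apply/funext => v.
  by rewrite nc_ev_mul //; [exact: letter_lin|exact: letter_adj_lin].
have e2 : complex.Re (\tr (mx_ev a (nc_sq P))) = fro (mx_ev a P).
  by rewrite mx_ev_mul -mx_ev_adj tr_adj_mul.
have kr : 0 < k%:R :> R by rewrite ltr0n.
rewrite -ler_pdivrMr //; move: h; rewrite e1 e2 ler_norml => /andP [h _].
by move: h; set q := fro _ / _; lra.
Qed.

End Moments.

(** * What a microstate inherits from the partition *)

Section Structure.
Variables (R : realType) (H : completeNormedModType R[i]).
Variable dot : {dot H for (@conjc R)}.
Hypothesis hH : hilbert dot.
Local Notation rdot := (re_dot dot).
Local Notation sqn := (sqnorm dot).
Let hd := prehilbert_dot hH.
Variable M : set (H -> H).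
Hypothesis hM : von_neumann_algebra dot M.
Variable tau : (H -> H) -> R[i].
Hypothesis ht : faithful_normal_trace dot M tau.
Variable X : {fset (H -> H)}.
Hypothesis gen : generates dot X M.
Local Notation rtau := (re_trace tau).
Local Notation tsq := (trace_sq dot tau).
Local Notation ev := (nc_ev (letter (X := X)) (letter_adj dot (X := X))).
Local Notation fro := (sqnorm (@dotm R _ _)).
Local Notation hdm := (@prehilbert_dotm R _ _).

Lemma tsq_sum_le (I : Type) (s : seq I) (F : I -> H -> H) : (forall i, M (F i)) ->
  M (\sum_(i <- s) F i) /\ tsq (\sum_(i <- s) F i) <= 2 ^+ size s * \sum_(i <- s) tsq (F i).
Proof.
move=> MF; elim: s => [|i s [IH1 IH2]].
  rewrite !big_nil mulr0; split; first exact: (M_zero hH hM).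
  have := tsq_mul_l hH hM ht (M_zero hH hM) (M_id hH hM) (C := 0); rewrite mul0r; apply.
  by move=> v; rewrite mul0r (sqn0 hd).
rewrite !big_cons; split; first exact: (M_add hH hM).
apply: le_trans (tsq_add_le hH hM ht (MF i) IH1) _.
have t0 := tsq_ge0 ht (MF i).
have S0 : 0 <= \sum_(i <- s) tsq (F i) by apply: sumr_ge0 => j _; exact: tsq_ge0 ht _ (MF j).
rewrite /= exprS mulrDr.
have : 1 <= 2 ^+ size s :> R by apply: exprn_ege1; lra.
move: IH2; set A := tsq (\sum_(j <- s) _); set c := 2 ^+ size s; set B := \sum_(j <- s) _ => IH2 c1.
nra.
Qed.

(** The norm bound on the n-th power gives, by Cauchy-Schwarz, the operator inequality with L^n
    times the identity; then the trace is monotone. *)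
Lemma rtau_pow_le (x : H -> H) (L : R) n : M x -> 0 <= L -> lbounded dot L x ->
  lbounded dot L (adj dot x) -> rtau (iter n (comp (adj dot x \o x)) idfun) <= L ^+ n.
Proof.
move=> Mx L0 bx bxs; set T := adj dot x \o x; set Tn := iter n _ _.
have sT : self_adjoint dot M T by exact: tsq_sa.
have bT : lbounded dot (L ^+ 2) T by rewrite expr2; exact: lbounded_comp.
have aux m : M (iter m (comp T) idfun) /\ lbounded dot ((L ^+ 2) ^+ m) (iter m (comp T) idfun).
  elim: m => [|m [IH1 IH2]]; first by split; [exact: (M_id hH hM)|move=> v; rewrite mul1r].
  rewrite iterS exprS; split; first by apply: (M_comp hH hM) => //; case: sT.
  by apply: lbounded_comp => //; exact: sqr_ge0.
have sTn : self_adjoint dot M Tn.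
  apply: (saP hH hM); first by case: (aux n).
  rewrite /Tn => u v; elim: n u v {Tn} => //= m IH u v.
  rewrite (sa_rdot hH hM _ _ sT) IH; congr (rdot u _).
  by elim: (m) => //= q ->.
have sL : self_adjoint dot M ((L ^+ n)%:C *: idfun).
  by have := sa_lin hH hM (L ^+ n) (sa_id hH hM) (sa_zero hH hM); rewrite addr0.
have le : fle dot Tn ((L ^+ n)%:C *: idfun).
  move=> v; rewrite -[((_ *: _) v)]/((L ^+ n)%:C *: v) (rdotZl hd) -/(sqn v).
  have cs := cauchy_schwarz hd (Tn v) v.
  have b : sqn (Tn v) * sqn v <= (L ^+ n * sqn v) ^+ 2.
    have -> : (L ^+ n * sqn v) ^+ 2 = (L ^+ 2) ^+ n * sqn v * sqn v.
      by rewrite exprMn -!exprM mulnC expr2 mulrA.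
    by apply: ler_wpM2r; [exact: sqn_ge0|case: (aux n)].
  have p : 0 <= L ^+ n * sqn v by rewrite mulr_ge0 ?exprn_ge0 //; exact: sqn_ge0.
  rewrite leNgt; apply/negP => lt.
  have : (L ^+ n * sqn v) ^+ 2 < rdot (Tn v) v ^+ 2.
    by rewrite ltr_pXn2r // nnegrE // ltW // (le_lt_trans p).
  lra.
have := rtau_mono hH hM ht sTn sL le.
by rewrite (rtauZ hH hM ht) ?(rtau_id ht) ?mulr1 //; exact: (M_id hH hM).
Qed.

Variable Pt : {fset (H -> H)}.
Hypothesis hP : projection_partition dot M Pt.

(* Integer labels are at distance 1, so an eigenvalue of sum_i [part_val i] G_i(a) selects one i. *)
Definition part_val (j : Pt) : R := (enum_rank j)%:R.

(** Everything the counting uses about a microstate, with [gm j] standing for the projection p_j.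
    Squared Frobenius norms are not normalised, hence the factors k. The last clause replaces a x by
    a matrix bounded by [kap] instead of the cut-off. *)
Definition micro_ok k (kap d : R) (a : {ffun X -> 'M[R[i]]_k}) (gm : Pt -> 'M[R[i]]_k) :=
  [/\ forall j, (gm j)^t* = gm j /\ mxbd 8 (gm j),
      (forall j, fro ((\sum_i (part_val i)%:C *: gm i - (part_val j)%:C%:M) *m gm j) <= kap * d * k%:R)
        /\ fro (\sum_i gm i - 1%:M) <= kap * d * k%:R,
      forall (x : X) (i j : Pt), val i \o val x \o val j = 0 ->
        fro (gm i *m a x *m gm j) <= kap * d * k%:R,
      forall j, (complex.Re (\tr (gm j)) / k%:R - rtau (val j)) ^+ 2 <= kap * d &
      forall x, fro (a x) <= kap * k%:R /\
        exists A, mxbd kap A /\ fro (a x - A) <= kap * d * k%:R].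

Definition nc_sum (F : Pt -> ncpoly R X) : ncpoly R X := flatten [seq F i | i <- index_enum Pt].

Lemma nc_ev_sum F v : ev (nc_sum F) v = \sum_i ev (F i) v.
Proof.
rewrite /nc_sum; elim: (index_enum Pt) => [|i s IH]; first by rewrite big_nil /nc_ev big_nil.
by rewrite big_cons /= nc_ev_cat IH.
Qed.

Lemma mx_ev_sum k (a : {ffun X -> 'M[R[i]]_k}) F : mx_ev a (nc_sum F) = \sum_i mx_ev a (F i).
Proof.
rewrite /nc_sum; elim: (index_enum Pt) => [|i s IH]; first by rewrite big_nil /mx_ev big_nil.
by rewrite big_cons /= mx_ev_cat IH.
Qed.

Lemma mx_ev_pow k (a : {ffun X -> 'M[R[i]]_k}) P n : mx_ev a (nc_pow P n) = mpow (mx_ev a P) n.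
Proof. by elim: n => [|n IH] /=; [exact: mx_ev_one|rewrite mx_ev_mul IH]. Qed.

Lemma part_M (j : Pt) : M (val j).
Proof. by case: hP => h _ _; case: (h _ (valP j)). Qed.

Lemma part_sum : \sum_(j : Pt) val j = idfun.
Proof. by case: hP => _ _ <-; rewrite [RHS]big_seq_fsetE. Qed.

Lemma part_mul (i j : Pt) : val i \o val j = if i == j then val j else 0.
Proof.
case: hP => h1 h2 _; case: eqP => [->|ne]; first by case: (h1 _ (valP j)).
by apply: h2; [exact: valP|exact: valP|apply/eqP => /val_inj].
Qed.

Lemma sum_apply (I : Type) (s : seq I) (F : I -> H -> H) v :
  (\sum_(i <- s) F i) v = \sum_(i <- s) F i v.
Proof. by elim: s => [|i s IH]; rewrite ?big_nil // !big_cons -IH. Qed.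

(** The order of quantifiers is the point: [kap] precedes d and r, while m, g and the polynomials
    may depend on both. Each clause is a 2-norm or trace estimate in M, transported by finitely many
    moments. *)
Lemma microstate_structure : exists kap : R, 1 <= kap /\ forall d r : R, 0 < d -> d <= 1 -> 0 < r ->
  exists m (g : R) (G : Pt -> ncpoly R X), 0 < g /\ forall k (a : {ffun X -> 'M[R[i]]_k}),
    (0 < k)%N -> microstates dot tau r m g a -> micro_ok kap d a (fun j => mx_ev a (G j)).
Proof.
have bX := fset_bounded hM gen.
have lx := letter_lin bX; have lxs := letter_adj_lin hH bX.
have ax := letter_adjP hH bX.
have [LH0 LH00 hLH0] := letter_bound hH bX.
pose LH := LH0 + 1; have LH1 : 1 <= LH by rewrite /LH; lra.
have bLH x : lbounded dot LH (letter x) /\ lbounded dot LH (letter_adj dot (X := X) x).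
  have [h1 h2] := hLH0 x; have le : LH0 <= LH by rewrite /LH; lra.
  by split; apply: (lbounded_le hd le).
pose lam := part_val.
pose hop : H -> H := \sum_i (lam i)%:C *: (val i : H -> H).
have Mhop : M hop.
  rewrite /hop; have := @tsq_sum_le _ (index_enum Pt) (fun i => (lam i)%:C *: (val i : H -> H)).
  by case=> // i; apply: (M_scale hH hM); exact: part_M.
have Mid := M_id hH hM.
have Mhj j : M (hop - (lam j)%:C *: idfun) by apply: (M_sub hH hM) => //; exact: (M_scale hH hM).
have /choice [Ch hCh] : forall j, exists C : R, 0 <= C /\ lbounded dot C (hop - (lam j)%:C *: idfun).
  by move=> j; have [C C0 hC] := bounded_ex hH (M_bounded hM (Mhj j)); exists C.
pose CH := \sum_j Ch j.
have CH0 : 0 <= CH by apply: sumr_ge0 => j _; case: (hCh j).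
have bh j : lbounded dot CH (hop - (lam j)%:C *: idfun).
  apply: (lbounded_le hd _ (proj2 (hCh j))).
  by rewrite /CH (bigD1 j) //= lerDl sumr_ge0 // => i _; case: (hCh i).
pose sz := size (index_enum Pt).
pose cl := 2 ^+ sz * \sum_(i : Pt) lam i ^+ 2.
pose KB := 2 ^+ sz * \sum_(i : Pt) (1 : R).
have two0 : 0 <= 2 ^+ sz :> R by apply: exprn_ge0.
have cl0 : 0 <= cl by rewrite mulr_ge0 // sumr_ge0 // => i _; exact: sqr_ge0.
have KB0 : 0 <= KB by rewrite mulr_ge0 // sumr_ge0.
(* One group per estimate: 16 cl + 2 CH for the eigenvalue relation, KB for the sum of the G_i, 18
   LH for vanishing blocks; the last summand leaves room for moment errors and traces. *)
pose kap := 16 * cl + 2 * CH + KB + 18 * LH + 10.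
have k1 : 16 * cl + 2 * CH + 1 <= kap by rewrite /kap; clear - hd hM ht gen hP cl0 CH0 KB0 LH1; lra.
have k2 : KB + 1 <= kap by rewrite /kap; clear - hd hM ht gen hP cl0 CH0 KB0 LH1; lra.
have k3 : 18 * LH + 1 <= kap by rewrite /kap; clear - hd hM ht gen hP cl0 CH0 KB0 LH1; lra.
have k4 : 4 <= kap by rewrite /kap; clear - hd hM ht gen hP cl0 CH0 KB0 LH1; lra.
have k5 : 2 * LH <= kap by rewrite /kap; clear - hd hM ht gen hP cl0 CH0 KB0 LH1; lra.
have k0 : 1 <= kap by clear - hd hM ht gen hP k4; lra.
have LH0' : 0 <= LH by clear - hd hM ht gen hP LH1; lra.
have LHp : 0 < LH by clear - hd hM ht gen hP LH1; lra.
have kp0 : 0 <= kap by clear - hd hM ht gen hP k0; lra.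
clearbody kap.
exists kap; split; first exact: k0.
move=> d r d0 d1 r0.
(* [L] covers the squared norms of the operators and, through r^2, those of the matrices; the bound
   8 of [nc_kap] does not see it. *)
pose L := LH + r ^+ 2; have L0 : 0 <= L by rewrite addr_ge0 ?sqr_ge0.
have bL x : lbounded dot L (letter x) /\ lbounded dot L (letter_adj dot (X := X) x).
  have le : LH <= L by rewrite lerDl sqr_ge0.
  by have [h1 h2] := bLH x; split; apply: (lbounded_le hd le).
have /choice [G0 hG0] : forall j : Pt, exists G, exists N P, G = nc_kap L N P /\ tsq (ev G - val j) <= d.
  move=> j; have [N [P hN]] := projection_approx hH hM ht gen
    (let: And3 h _ _ := hP in h _ (valP j)) L0 (fun x => proj1 (bL x)) (fun x => proj2 (bL x)) d0.
  by exists (nc_kap L N P), N, P.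
pose G := G0.
(* Truncating at squared norm 2 LH with the moment of order N + 1, whose trace in M is at most
   LH^(N+1), leaves an error of order LH / 2^N. *)
have [N hN] : exists N, (2^-1 : R) ^+ N <= d by apply: exists_expr_le => //; clear - hd hM ht gen hP; lra.
pose PA (j : Pt) := nc_mul (nc_sum (fun i => nc_scale (lam i)%:C (G i)) ++ nc_scale (- (lam j)%:C) (nc_one R X)) (G j).
pose PB := nc_sum G ++ nc_scale (-1) (nc_one R X).
pose PC (t : X * Pt * Pt) := nc_mul (nc_mul (G t.1.2) (nc_var R t.1.1)) (G t.2).
pose PF (x : X) := nc_pow (nc_sq (nc_var R x)) N.+1.
pose Ps : seq (ncpoly R X) := [seq nc_sq (PA j) | j <- enum {: Pt}] ++ [:: nc_sq PB] ++
  [seq nc_sq (PC t) | t <- enum {: X * Pt * Pt}] ++ [seq G j | j <- enum {: Pt}] ++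
  [seq nc_sq (nc_var R x) | x <- enum {: X}] ++ [seq PF x | x <- enum {: X}].
have inPA (j : Pt) : nc_sq (PA j) \in Ps.
  have h : nc_sq (PA j) \in [seq nc_sq (PA j) | j <- enum {: Pt}] by apply: (map_f (fun j => nc_sq (PA j))); rewrite mem_enum.
  by rewrite /Ps !mem_cat h ?orbT.
have inPB : nc_sq PB \in Ps by rewrite /Ps !mem_cat inE eqxx ?orbT.
have inPC (t : X * Pt * Pt) : nc_sq (PC t) \in Ps.
  have h : nc_sq (PC t) \in [seq nc_sq (PC t) | t <- enum {: X * Pt * Pt}] by apply: (map_f (fun t => nc_sq (PC t))); rewrite mem_enum.
  by rewrite /Ps !mem_cat h ?orbT.
have inG (j : Pt) : G j \in Ps.
  have h : G j \in [seq G j | j <- enum {: Pt}] by apply: (map_f (fun j => G j)); rewrite mem_enum.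
  by rewrite /Ps !mem_cat h ?orbT.
have inV (x : X) : nc_sq (nc_var R x) \in Ps.
  have h : nc_sq (nc_var R x) \in [seq nc_sq (nc_var R x) | x <- enum {: X}] by apply: (map_f (fun x => nc_sq (nc_var R x))); rewrite mem_enum.
  by rewrite /Ps !mem_cat h ?orbT.
have inPF (x : X) : PF x \in Ps.
  have h : PF x \in [seq PF x | x <- enum {: X}] by apply: (map_f (fun x => PF x)); rewrite mem_enum.
  by rewrite /Ps !mem_cat h ?orbT.
have [m [g [g0 hm]]] := moments_uniform hH hM ht gen Ps d0.
exists m, g, G; split => // k a kp ha.
have kr : 0 < k%:R :> R by rewrite ltr0n.
have hmP P : P \in Ps -> `|rtau (ev P) - complex.Re (\tr (mx_ev a P)) / k%:R| <= d by exact: (hm r k a ha).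
have gJ j : [/\ M (ev (G j)), lbounded dot 8 (ev (G j)), lbounded dot 8 (adj dot (ev (G j))) &
    tsq (ev (G j) - val j) <= d].
  have [N' [P' [hG' hd']]] := hG0 j.
  have b8 : lbounded dot 8 (ev (G j)).
    rewrite /G hG'; apply: (nc_kap_bound lx lxs hd ax L0) => x; by case: (bL x).
  split => //; first exact: nc_ev_M.
  rewrite (_ : adj _ _ = ev (G j)) //; apply: (adj_unique hH).
    by apply: (M_bounded hM); exact: nc_ev_M.
  by rewrite /G hG'; exact: (nc_kap_sa lx lxs hd ax).
have MG j : M (ev (G j)) by case: (gJ j).
have Md j : M (ev (G j) - val j) by apply: (M_sub hH hM) => //; exact: part_M.
have bd j : tsq (ev (G j) - val j) <= d by case: (gJ j).
have mxa x : mxbd L (a x).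
  case: ha => h _; apply: (mxbd_le _ (opnorm_bd (h x))); by rewrite /L lerDr.
have tid : tsq idfun = 1.
  by rewrite /trace_sq (adj_id hH) -(rtau_id ht).
have b1 (j : Pt) : lbounded dot 1 (val j : H -> H).
  move=> v; rewrite mul1r.
  have sj : self_adjoint dot M (val j) by case: hP => h _ _; case: (h _ (valP j)).
  have idem w : val j (val j w) = val j w.
    by have := part_mul j j; rewrite eqxx => /(congr1 (fun f => f w)).
  have e : rdot (val j v) v = sqn (val j v) by rewrite -{1}idem (sa_rdot hH hM _ _ sj).
  have := cauchy_schwarz hd (val j v) v; rewrite e.
  have := sqn_ge0 hd (val j v); have := sqn_ge0 hd v.
  move: (sqn (val j v)) (sqn v) => A B B0 A0 h.
  have [->//|nz] := eqVneq A 0.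
  have Ap : 0 < A by rewrite lt_neqAle eq_sym nz.
  by rewrite -(ler_pM2l Ap) -expr2.
have scal t c (K : R) : t <= K * d -> K + 1 <= kap -> c <= (t + d) * k%:R -> c <= kap * d * k%:R.
  move=> h1 h2 h3; apply: le_trans h3 _; apply: ler_wpM2r; first exact: ltW.
  have : (K + 1) * d <= kap * d by apply: ler_wpM2r => //; exact: ltW.
  move=> h4; clear - hd hM ht gen hP h1 h4; lra.
split.
- move=> j; have [N' [P' [hG' _]]] := hG0 j; rewrite /G hG'; exact: mx_ev_kap.
- split.
  + move=> j; have hmj := hmP _ (inPA j).
    have eA : mx_ev a (PA j) = (\sum_i (lam i)%:C *: mx_ev a (G i) - (lam j)%:C%:M) *m mx_ev a (G j).
      rewrite mx_ev_mul mx_ev_cat mx_ev_sum mx_ev_scale mx_ev_one scaleNr scalemx1; congr ((_ - _) *m _).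
      by apply: eq_bigr => i _; rewrite mx_ev_scale.
    rewrite -eA; apply: (scal _ _ (16 * cl + 2 * CH) _ k1 (nc_sq_moment hH hM gen hmj kp)).
    pose D := \sum_i (lam i)%:C *: (ev (G i) - val i).
    have MDi i : M ((lam i)%:C *: (ev (G i) - val i)) by exact: (M_scale hH hM).
    have [MD tD] := @tsq_sum_le _ (index_enum Pt) _ MDi.
    (* With h the sum of the lam_i p_i, one has h p_j = lam_j p_j; the error splits into one term
       with the G_i - p_i and one with G_j - p_j. *)
    have E : ev (PA j) = (D \o ev (G j)) + ((hop - (lam j)%:C *: idfun) \o (ev (G j) - val j)).
      apply/funext => v; rewrite nc_ev_mul // nc_ev_cat nc_ev_sum nc_ev_scale nc_ev_one.
      set w := ev (G j) v.
      rewrite -[RHS]/(D w + (hop (w - val j v) - (lam j)%:C *: (w - val j v))).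
      have lhop := M_linear hM Mhop.
      have hp : hop (val j v) = (lam j)%:C *: val j v.
        rewrite /hop sum_apply (bigD1 j) //= big1 ?addr0.
          rewrite -[LHS]/((lam j)%:C *: (val j \o val j) v); congr (_ *: _).
          by rewrite part_mul eqxx.
        move=> i ij; rewrite -[LHS]/((lam i)%:C *: (val i \o val j) v).
        by rewrite part_mul (negPf ij) scaler0.
      have eD : D w + hop w = \sum_i ev (nc_scale (lam i)%:C (G i)) w.
        rewrite /D /hop !sum_apply -big_split; apply: eq_bigr => i _; rewrite nc_ev_scale.
        rewrite -[LHS]/((lam i)%:C *: (ev (G i) w - val i w) + (lam i)%:C *: val i w).
        by lmod_ring R[i].
      by rewrite -eD (linB lhop) hp; lmod_ring R[i].
    have [MGj b8 b8' _] := gJ j.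
    have t1 : tsq (D \o ev (G j)) <= 8 * (cl * d).
      apply: le_trans (tsq_mul_r hH hM ht MD MGj b8') _; rewrite ler_pM2l //.
      apply: le_trans tD _; rewrite /cl -mulrA; apply: ler_wpM2l => //.
      rewrite mulr_suml; apply: ler_sum => i _.
      apply: (@le_trans _ _ (lam i ^+ 2 * tsq (ev (G i) - val i))); last first.
        by apply: ler_wpM2l => //; exact: sqr_ge0.
      apply: (tsq_fle hH hM ht) => // v.
      by rewrite -[((_ *: _) v)]/((lam i)%:C *: (ev (G i) - val i) v) (sqnZr hd).
    have t2 : tsq ((hop - (lam j)%:C *: idfun) \o (ev (G j) - val j)) <= CH * d.
      apply: le_trans (tsq_mul_l hH hM ht (Mhj j) (Md j) (bh j)) _; exact: ler_wpM2l.
    rewrite E; apply: le_trans (tsq_add_le hH hM ht _ _) _; [exact: (M_comp hH hM)|exact: (M_comp hH hM)|].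
    clear - hd hM ht gen hP t1 t2; lra.
  + have hmB := hmP _ inPB.
    have eB : mx_ev a PB = \sum_i mx_ev a (G i) - 1%:M.
      by rewrite mx_ev_cat mx_ev_sum mx_ev_scale mx_ev_one scaleN1r.
    rewrite -eB; apply: (scal _ _ KB _ k2 (nc_sq_moment hH hM gen hmB kp)).
    have [_ tD] := @tsq_sum_le _ (index_enum Pt) (fun i => ev (G i) - val i) Md.
    have -> : ev PB = \sum_i (ev (G i) - val i).
      rewrite sumrB part_sum; apply/funext => v.
      by rewrite nc_ev_cat nc_ev_sum nc_ev_scale nc_ev_one scaleN1r -[RHS]/((\sum_i ev (G i)) v - v) sum_apply.
    apply: le_trans tD _; rewrite /KB -mulrA; apply: ler_wpM2l => //.
    by rewrite mulr_suml; apply: ler_sum => i _; rewrite mul1r.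
- move=> x i j h0; have hmC := hmP _ (inPC (x, i, j)).
  have eC : mx_ev a (PC (x, i, j)) = mx_ev a (G i) *m a x *m mx_ev a (G j).
    by rewrite !mx_ev_mul mx_ev_var.
  rewrite -eC; apply: (scal _ _ (18 * LH) _ k3 (nc_sq_moment hH hM gen hmC kp)).
  have Mx : M (val x) by case: gen => h _; apply: h; exact: (valP x).
  have [MGi _ _ di] := gJ i; have [MGj _ b8' dj] := gJ j.
  have lpi := M_linear hM (part_M i); have lxx := M_linear hM Mx.
  (* Since p_i x p_j = 0, the product G_i x G_j is (G_i - p_i) x G_j + p_i x (G_j - p_j). *)
  have E : ev (PC (x, i, j)) = (((ev (G i) - val i) \o val x) \o ev (G j)) + (val i \o (val x \o (ev (G j) - val j))).
    apply/funext => v; rewrite !nc_ev_mul // nc_ev_var /=.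
    set w := ev (G j) v; set z := val x w.
    have e0 : val i (val x (val j v)) = 0 by have := congr1 (fun f => f v) h0.
    rewrite -[RHS]/((ev (G i) z - val i z) + val i (val x (w - val j v))).
    by rewrite -[LHS]/(ev (G i) z) (linB lxx) (linB lpi) e0 subr0 -/z; lmod_ring R[i].
  have [bx bxs] := bLH x.
  have t1 : tsq (((ev (G i) - val i) \o val x) \o ev (G j)) <= 8 * (LH * d).
    apply: le_trans (tsq_mul_r hH hM ht _ MGj b8') _; first exact: (M_comp hH hM).
    rewrite ler_pM2l //; apply: le_trans (tsq_mul_r hH hM ht (Md i) Mx bxs) _.
    exact: ler_wpM2l.
  have t2 : tsq (val i \o (val x \o (ev (G j) - val j))) <= LH * d.
    apply: le_trans (tsq_mul_l hH hM ht (part_M i) _ (b1 i)) _; first exact: (M_comp hH hM).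
    rewrite mul1r; apply: le_trans (tsq_mul_l hH hM ht Mx (Md j) bx) _.
    exact: ler_wpM2l.
  rewrite E; apply: le_trans (tsq_add_le hH hM ht _ _) _.
  + by apply: (M_comp hH hM) => //; exact: (M_comp hH hM).
  + by apply: (M_comp hH hM); [exact: part_M|exact: (M_comp hH hM)].
  + clear - hd hM ht gen hP t1 t2; lra.
- move=> j; have hmG := hmP _ (inG j).
  have [MGj _ _ _] := gJ j.
  have sGj : self_adjoint dot M (ev (G j)).
    have [N' [P' [hG' _]]] := hG0 j; apply: (saP hH hM) => //.
    by rewrite /G hG'; exact: (nc_kap_sa lx lxs hd ax).
  have sj : self_adjoint dot M (val j) by case: hP => h _ _; case: (h _ (valP j)).
  have := rtau_sqr_le hH hM ht (sa_sub hH hM sGj sj); rewrite (rtauB hH hM ht) //; last exact: part_M.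
  have := bd j; move: hmG; rewrite ler_norml => /andP [].
  set A := rtau (ev _); set B := _ / _; set C := rtau (val j).
  move=> h1 h2 h3 h4.
  have h5 : (A - B) ^+ 2 <= d by clear - hd hM ht gen hP h1 h2 d0 d1; nra.
  have := sqr_ge0 ((B - A) - (A - C)); have : 4 * d <= kap * d by apply: ler_wpM2r => //; exact: ltW.
  clear - hd hM ht gen hP h5 h4 h3; nra.
move=> x; have [bx bxs] := bLH x.
have Mx : M (val x) by case: gen => h _; apply: h; exact: (valP x).
have evx : ev (nc_var R x) = val x by apply/funext => v; rewrite nc_ev_var.
split.
  have hmx := hmP _ (inV x).
  have := nc_sq_moment hH hM gen hmx kp; rewrite mx_ev_var evx => h.
  apply: le_trans h _; apply: ler_wpM2r; first exact: ltW.
  have := tsq_mul_l hH hM ht Mx Mid bx; rewrite tid mulr1 => h.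
  have -> : tsq (val x) = tsq (val x \o idfun) by [].
  clear - hd hM ht gen hP h d1 k3 LH1; lra.
have hmF := hmP _ (inPF x).
have rho0 : 0 < 2 * LH by clear - hd hM ht gen hP LHp; lra.
have [A [bA hA]] := truncation (a x) N rho0.
exists A; split; first exact: (mxbd_le k5 bA).
apply: le_trans hA _.
have -> : mpow ((a x)^t* *m a x) N.+1 = mx_ev a (PF x).
  by rewrite mx_ev_pow /nc_sq mx_ev_mul -mx_ev_adj mx_ev_var.
have eF : rtau (ev (PF x)) <= LH ^+ N.+1.
  have -> : ev (PF x) = iter N.+1 (comp (adj dot (val x) \o val x)) idfun.
    rewrite /PF; elim: (N.+1) => [|q IH]; first by apply/funext => v; rewrite nc_ev_one.
    rewrite iterS -IH; apply/funext => v; rewrite /= nc_ev_mul // nc_ev_mul //.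
    by rewrite -(nc_ev_adjE hH bX) evx.
  exact: rtau_pow_le.
move: hmF; rewrite ler_norml => /andP [hF _].
rewrite ler_pdivrMr; last exact: exprn_gt0.
have hT : complex.Re (\tr (mx_ev a (PF x))) <= (LH ^+ N.+1 + 1) * k%:R.
  by rewrite -ler_pdivrMr //; clear - hd hM ht gen hP hF eF d1; lra.
apply: le_trans hT _; rewrite mulrAC; apply: ler_wpM2r; first exact: ltW.
have LN : 1 <= LH ^+ N by exact: exprn_ege1.
have -> : (2 * LH) ^+ N = 2 ^+ N * LH ^+ N by rewrite exprMn.
have dN : 1 <= d * 2 ^+ N.
  have : (2^-1) ^+ N * 2 ^+ N <= d * 2 ^+ N by apply: ler_wpM2r => //; exact: exprn_ge0.
  by rewrite exprVn mulVf // expf_neq0.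
rewrite exprS mulrA -[kap * d * _]mulrA.
have : kap * 1 <= kap * (d * 2 ^+ N) by apply: ler_wpM2l.
move: (d * 2 ^+ N) (LH ^+ N) LN => p q q1 h; have q0 : 0 <= q by clear - hd hM ht gen hP q1; lra.
have : kap * 1 * q <= kap * p * q by apply: ler_wpM2r.
have : 18 * LH * q + 1 * q <= kap * q by rewrite -mulrDl; apply: ler_wpM2r.
have : LH * 1 <= LH * q by apply: ler_wpM2l.
by move=> e1 e2 e3; clear - hd hM ht gen hP e1 e2 e3 q1 LH0' q0 LH1; nra.
Qed.

End Structure.

Lemma sumr_const_type (R : realType) (I : finType) (y : R) : \sum_(i : I) y = #|I|%:R * y.
Proof. by rewrite sumr_const mulr_natl. Qed.

Section HermitianCoordinates.
Variables (R : realType) (k : nat).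
Local Notation C := R[i].
Local Notation fro := (sqnorm (@dotm R _ _)).

(* Re is symmetric and Im antisymmetric on Hermitian matrices, so Re + Im is an isometric real
   coordinate system. *)
Definition herm_coord (B : 'M[C]_k) (st : 'I_k * 'I_k) : R :=
  complex.Re (B st.1 st.2) + complex.Im (B st.1 st.2).

Lemma herm_coordB B B' st : herm_coord (B - B') st = herm_coord B st - herm_coord B' st.
Proof. by rewrite /herm_coord mxBE; case: (B _ _) => x y; case: (B' _ _) => z w /=; ring. Qed.

Lemma herm_coord_sqr (B : 'M[C]_k) : B^t* = B -> \sum_st herm_coord B st ^+ 2 = fro B.
Proof.
move=> hB; rewrite sqn_dotm pair_bigA /=.
have sw s t : B t s = Num.conj (B s t) by rewrite -{1}hB !mxE.
pose z := \sum_(st : 'I_k * 'I_k) complex.Re (B st.1 st.2) * complex.Im (B st.1 st.2).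
have z0 : z = 0.
  have : z = - z.
    rewrite {1}/z -sumrN.
    rewrite (reindex_inj (h := fun st : 'I_k * 'I_k => (st.2, st.1))); last by move=> [a b] [a' b'] /= [-> ->].
    by apply: eq_bigr => -[s t] _ /=; rewrite sw; case: (B s t) => x y /=; ring.
  by lra.
have -> : \sum_st herm_coord B st ^+ 2 = \sum_st herm_coord B st ^+ 2 - 2 * z by rewrite z0; ring.
rewrite /z mulr_sumr -sumrB; apply: eq_bigr => -[s t] _; rewrite /herm_coord /nsq /=; ring.
Qed.

Lemma herm_sub (B B' : 'M[C]_k) : B^t* = B -> B'^t* = B' -> (B - B')^t* = B - B'.
Proof. by move=> h h'; rewrite -{2}h -{2}h' linearB map_mxB. Qed.

Lemma fro_one : fro (1%:M : 'M[C]_k) = k%:R.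
Proof.
rewrite sqn_dotm (eq_bigr (fun=> 1)) ?sumr_const ?card_ord //= => i _.
rewrite (bigD1 i) //= big1 ?addr0; first by rewrite mxE eqxx /nsq /= expr1n expr0n addr0.
by move=> j ji; rewrite mxE eq_sym (negPf ji) /nsq /= expr0n addr0.
Qed.

End HermitianCoordinates.

(** * Estimates for a single microstate *)

Section Estimate.
Variables (R : realType) (H : completeNormedModType R[i]).
Variable tau : (H -> H) -> R[i].
Variables X Pt : {fset (H -> H)}.
Local Notation C := R[i].
Local Notation rtau := (re_trace tau).
Local Notation fro := (sqnorm (@dotm R _ _)).
Local Notation hdm := (@prehilbert_dotm R _ _).
Local Notation lam := (part_val (R := R) (Pt := Pt)).

Lemma part_val_sep (i j : Pt) : i != j -> 1 <= `|lam i - lam j|.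
Proof.
move=> ij; rewrite /part_val; set a := enum_rank i; set b := enum_rank j.
have ab : (a : nat) != b by apply: contra ij => /eqP /val_inj /enum_rank_inj ->.
case: (ltngtP a b) ab => // h _.
  by rewrite distrC -natrB ?(ltnW h) // normr_nat ler1n subn_gt0.
by rewrite -natrB ?(ltnW h) // normr_nat ler1n subn_gt0.
Qed.

(** Labels are at distance at least 1, so every label but the nearest one is at distance at least
    1/2. *)
Lemma nearest_part (j0 : Pt) (b : R) : exists c : Pt, forall j, j != c -> 2^-1 <= `|b - lam j|.
Proof.
have [c hc] : exists c : Pt, forall j, `|b - lam c| <= `|b - lam j|.
  have [c _ hc] := @Order.TotalTheory.arg_minP _ _ _ j0 predT (fun j => `|b - lam j|) isT.
  by exists c => j; exact: hc.
exists c => j jc; have h3 := part_val_sep jc; have h := hc j.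
have h2 : `|lam j - lam c| <= `|b - lam j| + `|b - lam c|.
  by rewrite (distrC b (lam j)); apply: le_trans (ler_normD _ _); rewrite addrA subrK.
by rewrite -div1r ler_pdivrMr //; lra.
Qed.

Definition supp (x : X) (i j : Pt) : bool := val i \o val x \o val j != 0.

Section OneMicrostate.
Variables (k : nat) (kap d : R) (a : {ffun X -> 'M[C]_k}) (gm : Pt -> 'M[C]_k).
Variables (B0 U : 'M[C]_k) (b : 'I_k -> R) (cl : 'I_k -> Pt).
Hypotheses (k0 : (0 < k)%N) (kap1 : 1 <= kap) (d0 : 0 < d).
Hypothesis ok : micro_ok tau kap d a gm.
Hypothesis hB : fro (\sum_i (lam i)%:C *: gm i - B0) <= d * k%:R.
Hypotheses (UU : U *m U^t* = 1%:M) (UU' : U^t* *m U = 1%:M) (UB : U *m B0 = rdiag b *m U).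
Hypothesis hcl : forall s j, j != cl s -> 2^-1 <= `|b s - lam j|.
Local Notation Q := (spec_proj U cl).

Let n : R := #|{: Pt}|%:R.
(** The factor of [spec_proj_close] at threshold (16 + 2 kap) d k: 16 = 2 * 8 pays for replacing
    B(a) by its rounding [B0], and 2 kap for the relation in [micro_ok]. *)
Definition close_const : R := (2 + 8 * #|{: Pt}|%:R ^+ 2) * (16 + 2 * kap).
(** The first 2 kap is the truncation error. In each of at most n^2 blocks, 9 = 1 + 8 counts the two
    replacements of Q by [gm], and 65 = 64 + 1 the return from the truncation to a x and the
    vanishing block itself. *)
Definition off_const : R := 2 * kap + 2 * (#|{: Pt}|%:R * (#|{: Pt}|%:R * (4 * (9 * kap * close_const + 65 * kap)))).

Let kr : 0 < k%:R :> R. Proof. by rewrite ltr0n. Qed.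
Let kap0 : 0 <= kap. Proof. exact: le_trans ler01 kap1. Qed.
Let dk0 : 0 <= d * k%:R. Proof. by rewrite mulr_ge0 ?ltW. Qed.

Lemma gm_close j : fro (gm j - Q j) <= close_const * (d * k%:R).
Proof.
rewrite /close_const -mulrA; apply: (spec_proj_close (lam := lam) UU UU' UB hcl).
  move=> i; have [h1 [h2 _] _ _ _] := ok; have [hi bi] := h1 i.
  have -> : (B0 - (lam i)%:C%:M) *m gm i =
     (\sum_i (lam i)%:C *: gm i - (lam i)%:C%:M) *m gm i - (\sum_i (lam i)%:C *: gm i - B0) *m gm i.
    by rewrite -mulmxBl; congr (_ *m _); lmod_ring R[i].
  apply: le_trans (sqnB_le hdm _ _) _.
  have := h2 i; rewrite -mulrA => e1.
  have bi' : mxbd 8 ((gm i)^t*) by rewrite hi.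
  have e2 : fro ((\sum_i (lam i)%:C *: gm i - B0) *m gm i) <= 8 * (d * k%:R).
    by apply: le_trans (fro_mul_r _ bi') _; rewrite ler_pM2l.
  rewrite [leRHS]mulrDl; move: e1 e2; move: (d * k%:R) (fro _) (fro _) => y p q; lra.
have [_ [_ h3] _ _ _] := ok; apply: le_trans h3 _; rewrite -mulrA; apply: ler_wpM2r; first exact: dk0.
have := kap0; lra.
Qed.

Lemma off_estimate x : fro (off_mask U cl (supp x) (a x)) <= off_const * (d * k%:R).
Proof.
have [h1 _ h3 _ h5] := ok; have [_ [A [bA hA]]] := h5 x.
have -> : off_mask U cl (supp x) (a x) =
   off_mask U cl (supp x) (a x - A) + off_mask U cl (supp x) A by rewrite off_maskB subrK.
apply: le_trans (sqnD_le hdm _ _) _.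
have c0 : 0 <= close_const.
  by rewrite /close_const mulr_ge0 // ?addr_ge0 // mulr_ge0 // sqr_ge0.
have e1 : fro (off_mask U cl (supp x) (a x - A)) <= kap * (d * k%:R).
  by apply: le_trans; [exact: (off_mask_le cl UU')|rewrite mulrA].
have bA' : mxbd kap (A^t*) by exact: mxbd_adj.
have bQ' j : mxbd 1 ((Q j)^t*) by rewrite spec_proj_adj; exact: (spec_proj_bd cl UU UU').
have bg' j : mxbd 8 ((gm j)^t*) by have [-> ?] := h1 j.
have bg j : mxbd 8 (gm j) by case: (h1 j).
have blk i j : ~~ supp x i j ->
    fro (Q i *m A *m Q j) <= 4 * (9 * kap * close_const + 65 * kap) * (d * k%:R).
  move=> nS.
  (* Telescoping from Q_i A Q_j to G_i a_x G_j. Working with A rather than a_x keeps every norm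
     bounded independently of the cut-off. *)
  have -> : Q i *m A *m Q j = ((Q i - gm i) *m A *m Q j + gm i *m A *m (Q j - gm j))
      + (gm i *m (A - a x) *m gm j + gm i *m a x *m gm j).
    have q1 : Q i *m A *m Q j = (Q i - gm i) *m A *m Q j + gm i *m A *m Q j by rewrite -!mulmxDl subrK.
    have q2 : gm i *m A *m Q j = gm i *m A *m (Q j - gm j) + gm i *m A *m gm j by rewrite -mulmxDr subrK.
    have q3 : gm i *m A *m gm j = gm i *m (A - a x) *m gm j + gm i *m a x *m gm j.
      by rewrite -mulmxDl -mulmxDr subrK.
    by rewrite q1 q2 q3 addrA.
  have f1 : fro ((Q i - gm i) *m A *m Q j) <= kap * (close_const * (d * k%:R)).
    apply: le_trans (fro_mul_r _ (bQ' j)) _; rewrite mul1r.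
    apply: le_trans (fro_mul_r _ bA') _; rewrite (sqnBC hdm); apply: ler_wpM2l => //; exact: gm_close.
  have f2 : fro (gm i *m A *m (Q j - gm j)) <= 8 * (kap * (close_const * (d * k%:R))).
    rewrite -mulmxA; apply: le_trans (fro_mul_l _ (bg i)) _; rewrite ler_pM2l //.
    apply: le_trans (fro_mul_l _ bA) _; rewrite (sqnBC hdm); apply: ler_wpM2l => //; exact: gm_close.
  have f3 : fro (gm i *m (A - a x) *m gm j) <= 8 * (8 * (kap * (d * k%:R))).
    apply: le_trans (fro_mul_r _ (bg' j)) _; rewrite ler_pM2l //.
    apply: le_trans (fro_mul_l _ (bg i)) _; rewrite ler_pM2l // (sqnBC hdm).
    by rewrite mulrA.
  have f4 : fro (gm i *m a x *m gm j) <= kap * (d * k%:R).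
    by rewrite mulrA; apply: h3; apply/eqP; rewrite -[_ == _]negbK.
  apply: le_trans (sqnD_le hdm _ _) _.
  have g1 := sqnD_le hdm ((Q i - gm i) *m A *m Q j) (gm i *m A *m (Q j - gm j)).
  have g2 := sqnD_le hdm (gm i *m (A - a x) *m gm j) (gm i *m a x *m gm j).
  have -> : 4 * (9 * kap * close_const + 65 * kap) * (d * k%:R) =
     4 * (9 * (kap * (close_const * (d * k%:R))) + 65 * (kap * (d * k%:R))) by ring.
  move: f1 f2 f3 f4 g1 g2.
  move: (kap * (close_const * _)) (kap * (d * k%:R)) => y z.
  by do ![move: (fro _) => ?]; lra.
have e2 : fro (off_mask U cl (supp x) A) <= #|{: Pt}|%:R * (#|{: Pt}|%:R * (4 * (9 * kap * close_const + 65 * kap) * (d * k%:R))).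
  rewrite (off_mask_blocks cl UU); set y := 4 * _ * (d * k%:R).
  have y0 : 0 <= y by rewrite /y mulr_ge0 // mulr_ge0 // addr_ge0 // mulr_ge0 // mulr_ge0.
  apply: (@le_trans _ _ (\sum_(i : Pt) \sum_(j : Pt) y)).
    apply: ler_sum => i _; rewrite big_mkcond; apply: ler_sum => j _.
    by case: ifP => // h; exact: blk.
  by under eq_bigr do rewrite sumr_const_type; rewrite sumr_const_type.
rewrite /off_const; move: e1 e2; set Y := 4 * _; set N := #|_|%:R.
have -> : N * (N * (Y * (d * k%:R))) = N * (N * Y) * (d * k%:R) by ring.
move: (d * k%:R) (N * (N * Y)) => y z; move: (fro _) (fro _) => p q; lra.
Qed.

(** The trace of Q_j counts the eigenvalues labelled j, and [Re_tr_sqr_le] turns the Frobenius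
    estimate of Q_j - G_j into one for traces. *)
Lemma rank_estimate j : (#|[pred s | cl s == j]|%:R / k%:R - rtau (val j)) ^+ 2
   <= (2 * close_const + 2 * kap) * d.
Proof.
have [_ _ _ h4 _] := ok; have := h4 j.
rewrite -(tr_spec_proj cl UU j).
have := Re_tr_sqr_le (Q j - gm j).
have -> : \tr (Q j - gm j) = \tr (Q j) - \tr (gm j) by rewrite linearB.
move=> h.
have h2 : complex.Re (\tr (Q j)) - complex.Re (\tr (gm j)) = complex.Re (\tr (Q j) - \tr (gm j)).
  by case: (\tr (Q j)) => x1 y1; case: (\tr (gm j)) => x2 y2.
have g := gm_close j; rewrite (sqnBC hdm) in g.
set u := complex.Re (\tr (Q j)) in h2 *; set v := complex.Re (\tr (gm j)) in h2 *; set t := rtau _.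
have h3 : (u / k%:R - v / k%:R) ^+ 2 <= close_const * d.
  rewrite -mulrBl exprMn exprVn ler_pdivrMr ?exprn_gt0 // h2.
  apply: le_trans h _; have : k%:R * fro (Q j - gm j) <= k%:R * (close_const * (d * k%:R)).
    by apply: ler_wpM2l => //; exact: ltW.
  move/le_trans; apply; rewrite le_eqVlt; apply/orP; left; apply/eqP; ring.
move: h3; move: (u / _) (v / _) => p q h3 h4'.
have := sqr_ge0 ((p - q) - (q - t)); nra.
Qed.

End OneMicrostate.
End Estimate.

(** * Counting the block coordinates *)

Section Count.
Variables (R : realType) (H : completeNormedModType R[i]).
Variable tau : (H -> H) -> R[i].
Variables X Pt : {fset (H -> H)}.
Local Notation C := R[i].
Local Notation rtau := (re_trace tau).
Local Notation fro := (sqnorm (@dotm R _ _)).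
Local Notation hdm := (@prehilbert_dotm R _ _).
Local Notation lam := (part_val (R := R) (Pt := Pt)).

Definition coord_type k : finType := (X * 'I_k * 'I_k * bool)%type.

Definition supp_pred k (cl : 'I_k -> Pt) : pred (coord_type k) :=
  fun t => supp t.1.1.1 (cl t.1.1.2) (cl t.1.2).

Definition block_coord k (U : 'M[C]_k) (cl : 'I_k -> Pt) (a : {ffun X -> 'M[C]_k}) (t : coord_type k) : R :=
  let z := on_mask U cl (supp t.1.1.1) (a t.1.1.1) t.1.1.2 t.1.2 in
  if t.2 then complex.Re z else complex.Im z.

Lemma sum_coord k (F : coord_type k -> R) :
  \sum_t F t = \sum_x \sum_s \sum_u (F (x, s, u, true) + F (x, s, u, false)).
Proof.
rewrite (eq_bigr (fun t => F (t.1, t.2))); last by case.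
rewrite -(pair_bigA _ (fun t b => F (t, b))) /=.
rewrite (eq_bigr (fun t => (fun q u => F (q, u, true) + F (q, u, false)) t.1 t.2)); last first.
  by case=> q u _; rewrite big_bool.
rewrite -(pair_bigA _ (fun q u => F (q, u, true) + F (q, u, false))) /=.
rewrite (eq_bigr (fun q => (fun x s => \sum_u (F (x, s, u, true) + F (x, s, u, false))) q.1 q.2)); last by case.
by rewrite -(pair_bigA _ (fun x s => \sum_u (F (x, s, u, true) + F (x, s, u, false)))).
Qed.

Lemma supp_card k (cl : 'I_k -> Pt) : #|supp_pred cl|%:R =
  2 * \sum_(x : X) \sum_(i : Pt) \sum_(j : Pt | supp x i j)
    (#|[pred s | cl s == i]|%:R * #|[pred s | cl s == j]|%:R) :> R.
Proof.
rewrite -sum1_card natr_sum big_mkcond /=.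
rewrite (eq_bigr (fun t => (supp_pred cl t)%:R)); last first.
  by move=> t _; rewrite -[t \in _]/(supp_pred cl t); case: (supp_pred _ _).
rewrite sum_coord mulr_sumr; apply: eq_bigr => x _.
rewrite (partition_big cl predT) //= mulr_sumr; apply: eq_bigr => i _.
rewrite (eq_bigr (fun s => \sum_(j : Pt | supp x i j) 2 * #|[pred u | cl u == j]|%:R)); last first.
  move=> s /eqP csi; rewrite (partition_big cl predT) //= [RHS]big_mkcond; apply: eq_bigr => j _ /=.
  rewrite (eq_bigr (fun _ => 2 * (supp x i j)%:R)); last first.
    by move=> u /eqP cuj; rewrite /supp_pred /= csi cuj; ring.
  rewrite sumr_const -[_ *+ _]mulr_natl; case: ifP => _; last by rewrite mulr0 mulr0.
  by rewrite mulr1 mulrC.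
rewrite sumr_const -[_ *+ _]mulr_natl !mulr_sumr; apply: eq_bigr => j _.
by rewrite mulrCA.
Qed.

Lemma block_coord_supp k U (cl : 'I_k -> Pt) a t : ~~ supp_pred cl t -> block_coord U cl a t = 0.
Proof.
move: t => [[[x s] u] b]; rewrite /supp_pred /block_coord /= mxE => /negPf ->.
by case: b.
Qed.

Lemma block_coord_sqr0 k U (cl : 'I_k -> Pt) a :
  \sum_t block_coord U cl a t ^+ 2 = \sum_x fro (on_mask U cl (supp x) (a x)).
Proof.
rewrite sum_coord; apply: eq_bigr => x _; rewrite sqn_dotm.
by apply: eq_bigr => s _; apply: eq_bigr => u _; rewrite /block_coord /nsq /=.
Qed.

Lemma on_mask_le k U (cl : 'I_k -> Pt) S (a : 'M[C]_k) : U *m U^t* = 1%:M -> U^t* *m U = 1%:M ->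
  fro (on_mask U cl S a) <= fro a.
Proof.
move=> UU UU'; rewrite -(fro_conjU UU' a) !sqn_dotm; apply: ler_sum => s _; apply: ler_sum => t _.
rewrite [on_mask _ _ _ _ _ _]mxE; case: ifP => // _.
by rewrite /nsq /= expr0n addr0 addr_ge0 ?sqr_ge0.
Qed.

Definition block_mass : R :=
  \sum_(x : X) \sum_(i : Pt) \sum_(j : Pt | supp x i j) rtau (val i) * rtau (val j).

Lemma block_massE : block_mass = calI_part tau X Pt.
Proof.
rewrite /calI_part big_seq_fsetE; apply: eq_bigr => x _.
rewrite /calI_elt big_seq_fsetE; apply: eq_bigr => i _.
by rewrite big_seq_fsetE.
Qed.

(** The rank of label i is at most (tau(p_i) + w) k. As traces and w are at most 1, a product of two
    ranks exceeds tau(p_i) tau(p_j) k^2 by at most 3 w k^2; real and imaginary parts double this to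
    6. *)
Lemma supp_card_le k (cl : 'I_k -> Pt) (w : R) : (0 < k)%N -> 0 <= w -> w <= 1 ->
  (forall i : Pt, 0 <= rtau (val i) <= 1) ->
  (forall i : Pt, (#|[pred s | cl s == i]|%:R / k%:R - rtau (val i)) ^+ 2 <= w ^+ 2) ->
  #|supp_pred cl|%:R <= (2 * block_mass + 6 * (#|{: X}|%:R * (#|{: Pt}|%:R * #|{: Pt}|%:R)) * w) * k%:R ^+ 2 :> R.
Proof.
move=> k0 w0 w1 ht hr; have kr : 0 < k%:R :> R by rewrite ltr0n.
rewrite supp_card.
have rank i : #|[pred s | cl s == i]|%:R <= (rtau (val i) + w) * k%:R :> R.
  rewrite -ler_pdivrMr //; have := hr i; move: (_ / _) (rtau _) => p q h.
  rewrite leNgt; apply/negP => lt.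
  have : w ^+ 2 < (p - q) ^+ 2 by rewrite ltr_pXn2r ?nnegrE //; lra.
  lra.
pose y : R := 3 * w * k%:R ^+ 2.
have y0 : 0 <= y by rewrite /y !mulr_ge0 // ?sqr_ge0.
have pr i j : #|[pred s | cl s == i]|%:R * #|[pred s | cl s == j]|%:R <=
    rtau (val i) * rtau (val j) * k%:R ^+ 2 + y.
  have /andP [i0 i1] := ht i; have /andP [j0 j1] := ht j.
  apply: (@le_trans _ _ ((rtau (val i) + w) * k%:R * ((rtau (val j) + w) * k%:R))).
    by apply: ler_pM => //; exact: rank.
  have -> : (rtau (val i) + w) * k%:R * ((rtau (val j) + w) * k%:R) =
     (rtau (val i) * rtau (val j)) * k%:R ^+ 2 + (w * (rtau (val i) + rtau (val j) + w)) * k%:R ^+ 2 by ring.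
  rewrite lerD2l; apply: ler_wpM2r; first exact: sqr_ge0.
  by rewrite mulrC; apply: ler_wpM2r => //; lra.
have -> : (2 * block_mass + 6 * (#|{: X}|%:R * (#|{: Pt}|%:R * #|{: Pt}|%:R)) * w) * k%:R ^+ 2 =
   2 * (block_mass * k%:R ^+ 2 + #|{: X}|%:R * (#|{: Pt}|%:R * (#|{: Pt}|%:R * y))) by rewrite /y; ring.
rewrite ler_pM2l // /block_mass.
set n : R := #|{: Pt}|%:R; pose m (i j : Pt) : R := rtau (val i) * rtau (val j).
have row x i : \sum_(j : Pt | supp x i j) (#|[pred s | cl s == i]|%:R * #|[pred s | cl s == j]|%:R : R)
    <= (\sum_(j : Pt | supp x i j) m i j) * k%:R ^+ 2 + n * y.
  apply: (@le_trans _ _ (\sum_(j : Pt | supp x i j) (m i j * k%:R ^+ 2 + y))).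
    by apply: ler_sum => j _; exact: pr.
  rewrite big_split /= mulr_suml lerD2l -sumr_const_type big_mkcond.
  by apply: ler_sum => j _; case: ifP.
apply: (@le_trans _ _ (\sum_(x : X) \sum_(i : Pt) ((\sum_(j : Pt | supp x i j) m i j) * k%:R ^+ 2 + n * y))).
  by apply: ler_sum => x _; apply: ler_sum => i _; exact: row.
under eq_bigr do rewrite big_split /= sumr_const_type -mulr_suml.
by rewrite big_split /= sumr_const_type -mulr_suml.
Qed.

End Count.

(** * Covering the microstate space *)

Section NetBound.
Variables (R : realType) (H : completeNormedModType R[i]).
Variable tau : (H -> H) -> R[i].
Variables X Pt : {fset (H -> H)}.
Local Notation C := R[i].
Local Notation rtau := (re_trace tau).
Local Notation fro := (sqnorm (@dotm R _ _)).
Local Notation hdm := (@prehilbert_dotm R _ _).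
Local Notation lam := (part_val (R := R) (Pt := Pt)).

Definition herm_mass : R := 8 * (#|{: Pt}|%:R * \sum_(i : Pt) lam i ^+ 2).
(** The constant 8 (2 D + T) of [lattice_code], here with D = 1 and T = [herm_mass] for the
    coordinates of B(a), and in [net_const2] with D = 2 |X| + 1 and T = |X| kap for the blocks. *)
Definition net_const1 : R := 8 * (2 * 1 + herm_mass).
Definition net_const2 (kap : R) : R := 8 * (2 * (2 * #|{: X}|%:R + 1) + #|{: X}|%:R * kap).
Lemma net_const2_ge1 (kap : R) : 0 <= kap -> 1 <= net_const2 kap.
Proof.
move=> kap0; rewrite /net_const2; have : 0 <= #|{: X}|%:R * kap by rewrite mulr_ge0.
by move: (#|{: X}|%:R * kap) (ler0n R #|{: X}|) => p; move: (#|{: X}|%:R) => q; lra.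
Qed.

Definition net_exponent (w : R) : R :=
  2 * block_mass tau X Pt + 6 * (#|{: X}|%:R * (#|{: Pt}|%:R * #|{: Pt}|%:R)) * w.

Lemma nsqB_le (z1 z2 : C) (y : R) :
  (complex.Im z1 - complex.Im z2) ^+ 2 <= y -> (complex.Re z1 - complex.Re z2) ^+ 2 <= y ->
  nsq (z1 - z2) <= 2 * y.
Proof. by case: z1 z2 => r1 i1 [r2 i2]; rewrite /nsq /=; lra. Qed.

Section Herm.
Variables (k : nat) (gm : Pt -> 'M[C]_k).
Definition weighted_sum : 'M[C]_k := \sum_i (lam i)%:C *: gm i.

Lemma weighted_sum_herm : (forall j, (gm j)^t* = gm j) -> weighted_sum^t* = weighted_sum.
Proof.
move=> h; apply/matrixP => s t; rewrite !mxE !summxE rmorph_sum; apply: eq_bigr => i _.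
rewrite ![((lam i)%:C *: gm i) _ _]mxE rmorphM -{2}(h i) !mxE; congr (_ * _); exact: conjc_real.
Qed.

Lemma weighted_sum_fro : (forall j, mxbd 8 (gm j)) -> fro weighted_sum <= herm_mass * k%:R.
Proof.
move=> h; apply: le_trans (sqn_sum hdm _) _.
have -> : herm_mass * k%:R = #|{: Pt}|%:R * \sum_(i : Pt) lam i ^+ 2 * (8 * k%:R).
  by rewrite /herm_mass -mulr_suml; ring.
apply: ler_wpM2l => //; apply: ler_sum => i _; rewrite (sqnZr hdm).
apply: ler_wpM2l; first exact: sqr_ge0.
by rewrite -(@fro_one R k) -[gm i]mulmx1; exact: fro_mul_l.
Qed.
End Herm.

(** The cell z of B(a) fixes, through one representative, a basis [U z] and labels [cl z]; block
    coordinates are rounded in this common basis, so microstates with equal codes are compared entry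
    by entry. Each of the two codes contributes one of the summands in the constant 2. *)
Lemma net_bound k (kap c w e : R) (Y : set {ffun X -> 'M[C]_k}) (gm : {ffun X -> 'M[C]_k} -> Pt -> 'M[C]_k) (j0 : Pt) :
  (0 < k)%N -> 1 <= kap -> 0 < c -> c <= 1 -> 0 <= w -> w <= 1 -> 0 < e ->
  (forall i : Pt, 0 <= rtau (val i) <= 1) ->
  (forall a, Y a -> micro_ok tau kap (c ^+ 2) a (gm a)) ->
  (2 * close_const Pt kap + 2 * kap) * c ^+ 2 <= w ^+ 2 ->
  #|{: X}|%:R * ((4 + 8 * off_const Pt kap) * c ^+ 2) < e ^+ 2 ->
  (covering_number e Y <= (expR (k%:R ^+ 2 * (2 + ln (net_const1 / c)
     + net_exponent w * ln (net_const2 kap / c))))%:E)%E.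
Proof.
move=> k0 kap1 c0 c1 w0 w1 e0 ht ok hw he.
have kr : 0 < k%:R :> R by rewrite ltr0n.
have kap0 : 0 <= kap by exact: le_trans ler01 kap1.
have d0 : 0 < c ^+ 2 by rewrite exprn_gt0.
have hm0 : 0 <= herm_mass.
  by rewrite /herm_mass mulr_ge0 // mulr_ge0 // sumr_ge0 // => i _; exact: sqr_ge0.
pose Bm a := weighted_sum (gm a).
have Bherm a : Y a -> (Bm a)^t* = Bm a.
  by move=> /ok [h _ _ _ _]; apply: weighted_sum_herm => j; case: (h j).
have Bfro a : Y a -> fro (Bm a) <= herm_mass * k%:R.
  by move=> /ok [h _ _ _ _]; apply: weighted_sum_fro => j; case: (h j).
(* One diagonalisation is fixed per matrix; for a matrix that is not Hermitian the value is a dummy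
   about which nothing is claimed. *)
have /choice [sd hsd] : forall B : 'M[C]_k, exists D : 'M[C]_k * ('I_k -> R) * ('I_k -> Pt),
    B^t* = B -> [/\ D.1.1 *m D.1.1^t* = 1%:M, D.1.1^t* *m D.1.1 = 1%:M, D.1.1 *m B = rdiag D.1.2 *m D.1.1 &
      forall s j, j != D.2 s -> 2^-1 <= `|D.1.2 s - lam j|].
  move=> B; have [hB|nB] := pselect (B^t* = B); last by exists (0, (fun=> 0), (fun=> j0)).
  have [U [b [UU UU' UB]]] := hermitian_diag hB.
  have /choice [cl hcl] : forall s, exists c : Pt, forall j, j != c -> 2^-1 <= `|b s - lam j|.
    by move=> s; exact: nearest_part.
  by exists (U, b, cl).
have [T1 [cd1 h1]] := @lattice_code R ('I_k * 'I_k)%type k c herm_mass 1 k0 c0 c1 hm0 (lexx _).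
have p1 : #|(predT : pred ('I_k * 'I_k)%type)|%:R <= 1 * k%:R ^+ 2 :> R.
  by rewrite mul1r card_prod !card_ord natrM expr2.
have [A1 [cA1 inA1 sep1]] := h1 _ p1.
have nX0 : 0 <= #|{: X}|%:R :> R by [].
have T20 : 0 <= #|{: X}|%:R * kap by rewrite mulr_ge0.
(* The summand 1 keeps D >= 1 even when [X] is empty. *)
have D21 : 1 <= 2 * #|{: X}|%:R + 1 :> R by rewrite lerDr mulr_ge0.
have [T2 [cd2 h2]] := @lattice_code R (coord_type X k) k c (#|{: X}|%:R * kap) (2 * #|{: X}|%:R + 1) k0 c0 c1 T20 D21.
have cardc : #|{: coord_type X k}|%:R = 2 * #|{: X}|%:R * k%:R ^+ 2 :> R.
  rewrite !card_prod !card_ord card_bool !natrM; ring.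
have p2 (S : pred (coord_type X k)) : #|S|%:R <= (2 * #|{: X}|%:R + 1) * k%:R ^+ 2 :> R.
  apply: (@le_trans _ _ (#|{: coord_type X k}|%:R)); first by rewrite ler_nat max_card.
  by rewrite cardc; apply: ler_wpM2r; [exact: sqr_ge0|rewrite lerDl].
pose hit z := `[< exists2 a, Y a & cd1 (herm_coord (Bm a)) = z >].
pose rep z := xget 0 [set a | Y a /\ cd1 (herm_coord (Bm a)) = z].
have repP z : hit z -> Y (rep z) /\ cd1 (herm_coord (Bm (rep z))) = z.
  move=> /asboolP [a Ya az].
  by apply: (@xgetPex _ 0 [set a | Y a /\ cd1 (herm_coord (Bm a)) = z]); exists a.
pose Bz z := Bm (rep z).
pose U z := (sd (Bz z)).1.1; pose cl z := (sd (Bz z)).2.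
have /choice [A2 hA2] := fun z => h2 _ (p2 (supp_pred (X := X) (cl z))).
have Z a z : Y a -> cd1 (herm_coord (Bm a)) = z ->
   [/\ hit z, (Bz z)^t* = Bz z & fro (Bm a - Bz z) <= c ^+ 2 * k%:R].
  move=> Ya az; have hz : hit z by apply/asboolP; exists a.
  have [Yr cr] := repP _ hz.
  split => //; first exact: Bherm.
  rewrite -herm_coord_sqr; last by apply: herm_sub; exact: Bherm.
  apply: (@le_trans _ _ (\sum_(st : 'I_k * 'I_k) c ^+ 2 / k%:R)).
    apply: ler_sum => st _; rewrite herm_coordB.
    apply: sep1 => //; [|by rewrite herm_coord_sqr; [exact: Bfro|exact: Bherm]|by rewrite az].
    by rewrite herm_coord_sqr; [exact: Bfro|exact: Bherm].
  rewrite sumr_const_type card_prod !card_ord natrM le_eqVlt; apply/orP; left; apply/eqP.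
  by field; rewrite lt0r_neq0.
pose L2 := ln (net_const2 kap / c).
have L20 : 0 <= L2.
  apply: ln_ge0; rewrite ler_pdivlMr // mul1r; apply: le_trans c1 (net_const2_ge1 kap0).
pose bd2 := expR (k%:R ^+ 2 + net_exponent w * k%:R ^+ 2 * L2).
have card2 z : hit z -> #|A2 z|%:R <= bd2.
  move=> /asboolP [a Ya az]; have [hz hBz hf] := Z _ _ Ya az.
  have [q _ _] := hA2 z; apply: le_trans q _.
  rewrite ler_expR lerD2l; apply: ler_wpM2r; first exact: L20.
  have [UU UU' UB hcl] := hsd _ hBz.
  apply: (supp_card_le X k0 w0 w1 ht) => i.
  apply: le_trans hw; exact: (rank_estimate k0 kap1 d0 (ok _ Ya) hf UU UU' UB hcl).
(* Only cells containing a microstate are kept: the rank estimate, hence the bound [card2] on the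
   second factor, is available for them alone. *)
pose As : {set (T1 * T2)%type} := finset (fun zw => [&& zw.1 \in A1, hit zw.1 & zw.2 \in A2 zw.1]).
pose cd a := let z := cd1 (herm_coord (Bm a)) in (z, cd2 (block_coord (U z) (cl z) a)).
have bl a z : Y a -> cd1 (herm_coord (Bm a)) = z ->
    \sum_t block_coord (U z) (cl z) a t ^+ 2 <= #|{: X}|%:R * kap * k%:R.
  move=> Ya az; have [_ hBz _] := Z _ _ Ya az; have [UU UU' _ _] := hsd _ hBz.
  rewrite block_coord_sqr0 -mulrA -sumr_const_type; apply: ler_sum => x _.
  apply: le_trans (on_mask_le _ _ _ UU UU') _.
  by have [_ _ _ _ h5] := ok _ Ya; case: (h5 x).
have cov := @covering_le R X k e Y _ cd As.
apply: le_trans (cov _ _) _ => {cov}.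
- move=> a Ya; set z := cd1 (herm_coord (Bm a)).
  have [hz _ _] := Z a z Ya erefl.
  rewrite inE /=; apply/and3P; split => //.
    by apply: inA1 => //; rewrite herm_coord_sqr; [exact: Bfro|exact: Bherm].
  have [_ q _] := hA2 z; apply: q; last exact: bl.
  by move=> t; exact: block_coord_supp.
- move=> a a' Ya Ya' ecd; pose z := cd1 (herm_coord (Bm a)).
  have zz' : z = cd1 (herm_coord (Bm a')) := congr1 fst ecd.
  have e2 : cd2 (block_coord (U z) (cl z) a) = cd2 (block_coord (U z) (cl z) a').
    by have := congr1 snd ecd; rewrite /cd /= -zz'.
  have [hz hBz f1] := Z a z Ya erefl; have [_ _ f2] := Z a' z Ya' (esym zz').
  have [UU UU' UB hcl] := hsd _ hBz.
  have o1 := off_estimate k0 kap1 d0 (ok _ Ya) f1 UU UU' UB hcl.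
  have o2 := off_estimate k0 kap1 d0 (ok _ Ya') f2 UU UU' UB hcl.
  have [_ _ q] := hA2 z.
  have on x : fro (on_mask (U z) (cl z) (supp x) (a x) - on_mask (U z) (cl z) (supp x) (a' x))
      <= 2 * (c ^+ 2 * k%:R).
    rewrite sqn_dotm.
    apply: (@le_trans _ _ (\sum_(s < k) \sum_(u < k) 2 * (c ^+ 2 / k%:R))); last first.
      under eq_bigr do rewrite sumr_const_type; rewrite sumr_const_type card_ord.
      by rewrite le_eqVlt; apply/orP; left; apply/eqP; field; rewrite lt0r_neq0.
    apply: ler_sum => s _; apply: ler_sum => u _; rewrite mxBE.
    have g1 := q _ _ (fun t => block_coord_supp (U z) a (cl := cl z) (t := t)) (bl _ _ Ya erefl)
      (fun t => block_coord_supp (U z) a' (cl := cl z) (t := t)) (bl _ _ Ya' (esym zz')) e2.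
    have := g1 (x, s, u, true); have := g1 (x, s, u, false); rewrite /block_coord /=.
    by move: (on_mask _ _ _ (a x) s u) (on_mask _ _ _ (a' x) s u) => z1 z2; exact: nsqB_le.
  (* 4 = 2 * 2 comes from the rounded blocks, and 8 = 2 (2 + 2) from the two parts outside the
     support. *)
  have dist x : fro ((a - a') x) <= (4 + 8 * off_const Pt kap) * c ^+ 2 * k%:R.
    rewrite [(a - a') x]ffunE /= [(- a') x]ffunE -(fro_conjU UU').
    have -> : U z *m (a x - a' x) *m (U z)^t* =
       (on_mask (U z) (cl z) (supp x) (a x) - on_mask (U z) (cl z) (supp x) (a' x)) +
       (off_mask (U z) (cl z) (supp x) (a x) - off_mask (U z) (cl z) (supp x) (a' x)).
      by rewrite mulmxBr mulmxBl !(on_off_mask (U z) (cl z) (supp x)) opprD addrACA.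
    apply: le_trans (sqnD_le hdm _ _) _.
    have := sqnB_le hdm (off_mask (U z) (cl z) (supp x) (a x)) (off_mask (U z) (cl z) (supp x) (a' x)).
    have := o1 x; have := o2 x; have := on x.
    move: (fro _) (fro _) (fro _) (fro _) => v1 v2 v3 v4.
    have -> : (4 + 8 * off_const Pt kap) * c ^+ 2 * k%:R = 4 * (c ^+ 2 * k%:R) + 8 * (off_const Pt kap * (c ^+ 2 * k%:R)) by ring.
    move: (off_const Pt kap * (c ^+ 2 * k%:R)) => v5; move: (c ^+ 2 * k%:R) => v6 i1 i2 i3 i4.
    by clear - tau X Pt i1 i2 i3 i4; lra.
  have ee : e = Num.sqrt (e ^+ 2) by rewrite sqrtr_sqr ger0_norm ?ltW.
  rewrite norm2E.
  rewrite [ltRHS]ee.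
  rewrite ltr_sqrt; last exact: exprn_gt0.
  apply: le_lt_trans he.
  rewrite -sumr_const_type.
  apply: ler_sum => x _.
  rewrite ler_pdivrMr; last exact: kr.
  exact: dist.
rewrite lee_fin.
have -> : k%:R ^+ 2 * (2 + ln (net_const1 / c) + net_exponent w * ln (net_const2 kap / c)) =
   (k%:R ^+ 2 + k%:R ^+ 2 * ln (net_const1 / c)) + (k%:R ^+ 2 + net_exponent w * k%:R ^+ 2 * L2).
  by rewrite /L2; ring.
rewrite expRD -/bd2.
apply: (@le_trans _ _ (#|A1|%:R * bd2)); last first.
  apply: ler_wpM2r; first exact: expR_ge0.
  by apply: le_trans cA1 _; rewrite card_prod !card_ord natrM -expr2.
rewrite -!sum1_card !natr_sum big_mkcond [leRHS]mulr_suml [leRHS]big_mkcond /=.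
rewrite (eq_bigr (fun zw => (fun z w => if [&& z \in A1, hit z & w \in A2 z] then 1 else 0) zw.1 zw.2)); last first.
  by move=> [z w'] _; rewrite inE.
rewrite -(pair_bigA _ (fun z w => if [&& z \in A1, hit z & w \in A2 z] then 1 else 0)) /=.
apply: ler_sum => z _; case: (z \in A1) => /=; last by rewrite big1.
case: (boolP (hit z)) => hz /=; last by rewrite big1 // mul1r expR_ge0.
rewrite mul1r; apply: le_trans (card2 z hz).
by rewrite -sum1_card natr_sum [leRHS]big_mkcond.
Qed.

End NetBound.

(** * Free entropy dimension *)

Lemma limf_esup_le (R : realType) (T : choiceType) (P : filteredType T) (F : set (set P)) (f : P -> \bar R)
    (A : set P) b :
  F A -> (forall x, A x -> (f x <= b)%E) -> (limf_esup f F <= b)%E.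
Proof.
move=> FA h; rewrite limf_esupE.
apply: (@le_trans _ _ (ereal_sup (f @` A))).
  by apply: ereal_inf_lbound; exists A.
by apply: ge_ereal_sup => _ [x Ax <-]; exact: h.
Qed.

Section Limits.
Variables (R : realType) (H : completeNormedModType R[i]).
Variable dot : {dot H for (@conjc R)}.
Hypothesis hH : hilbert dot.
Variable M : set (H -> H).
Hypothesis hM : von_neumann_algebra dot M.
Variable tau : (H -> H) -> R[i].
Hypothesis ht : faithful_normal_trace dot M tau.
Variables X Pt : {fset (H -> H)}.
Hypothesis gen : generates dot X M.
Hypothesis hP : projection_partition dot M Pt.
Local Notation rtau := (re_trace tau).

(** For a projection of trace t, [rtau_sqr_le] reads t^2 <= t. *)
Lemma part_rtau (i : Pt) : 0 <= rtau (val i) <= 1.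
Proof.
have [pr _ _] := hP; have [Mp pp ap] := pr (val i) (valP i).
have := rtau_sqr_le hH hM ht (conj Mp ap).
rewrite /trace_sq ap pp; set t := re_trace _ _ => h.
have t0 : 0 <= t by apply: le_trans h; exact: sqr_ge0.
rewrite t0 /= leNgt; apply/negP => t1; move: h; apply/negP; rewrite -ltNge expr2.
by rewrite ltr_pMl //; apply: lt_trans t1.
Qed.

Lemma calI_part_ge0 : 0 <= calI_part tau X Pt.
Proof.
rewrite -block_massE; apply: sumr_ge0 => x _; apply: sumr_ge0 => i _; apply: sumr_ge0 => j _.
by have /andP [i0 _] := part_rtau i; have /andP [j0 _] := part_rtau j; exact: mulr_ge0.
Qed.

Lemma part_inhabited : exists j : Pt, true.
Proof.
have [j _|no] := pickP (fun _ : Pt => true); first by exists j.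
exfalso; have := rtau_id ht; rewrite -(part_sum hP) big_pred0 => [|j]; last by have := no j.
by rewrite /re_trace (tau_zero hH hM ht) /= => /eqP; rewrite eq_sym oner_eq0.
Qed.

Lemma lne_covering_le k (e : R) (Y : set {ffun X -> 'M[R[i]]_k}) (b : R) : (0 < k)%N ->
  (covering_number e Y <= (expR (k%:R ^+ 2 * b))%:E)%E ->
  ((k%:R ^- 2)%:E * lne (covering_number e Y) <= b%:E)%E.
Proof.
move=> k0 h; have kr : 0 < k%:R ^+ 2 :> R by rewrite exprn_gt0 // ltr0n.
have c0 : (0 <= covering_number e Y)%E.
  by apply: le_ereal_inf_tmp => _ [S _ <-]; rewrite lee_fin.
have : (lne (covering_number e Y) <= (k%:R ^+ 2 * b)%:E)%E.
  rewrite -[X in X%:E]expRK -lne_EFin ?expR_gt0 // lee_lne // in_itv /= ?c0 ?leey //=.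
  by rewrite lee_fin expR_ge0.
move=> /(lee_wpmul2l (x := (k%:R ^- 2)%:E)) -/(_ _).
rewrite lee_fin invr_ge0 (ltW kr) => /(_ isT) /le_trans; apply.
by rewrite -EFinM lee_fin mulKf // gt_eqF.
Qed.

(** The parameters are mesh c = beta e, precision d = c^2 and rank error w = W c. [C0] and [e0] are
    fixed before the cut-off r appears, so the bound passes to the supremum over r. *)
Lemma K_e_le (eta : R) : 0 < eta -> exists C0 e0 : R, [/\ 0 <= C0, 0 < e0, e0 <= 1 & forall e, 0 < e -> e < e0 ->
  (K_e dot tau X e <= (C0 + (1 + 2 * calI_part tau X Pt + eta) * `|ln e|)%:E)%E].
Proof.
move=> eta0; have [j0 _] := part_inhabited.
have [kap [kap1 structure]] := microstate_structure hH hM ht gen hP.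
have kap0 : 0 <= kap by apply: le_trans kap1.
set I := calI_part tau X Pt.
have cc0 : 0 <= close_const Pt kap by rewrite /close_const mulr_ge0 // addr_ge0 // mulr_ge0.
have oc0 : 0 <= off_const Pt kap.
  by rewrite /off_const; do ?[apply: addr_ge0 | apply: mulr_ge0].
pose Cc := 2 * close_const Pt kap + 2 * kap.
have Cc0 : 0 <= Cc by rewrite addr_ge0 // mulr_ge0.
pose Y := #|{: X}|%:R * (4 + 8 * off_const Pt kap).
have Y0 : 0 <= Y by rewrite mulr_ge0 // addr_ge0 // mulr_ge0.
(* Ensures Y beta^2 < 1, which brings microstates with equal codes closer than e. *)
pose beta := (1 + Y)^-1.
have Y1 : 0 < 1 + Y by lra.
have beta0 : 0 < beta by rewrite invr_gt0.
have beta1 : beta <= 1 by rewrite invf_le1; lra.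
pose Z := 6 * (#|{: X}|%:R * (#|{: Pt}|%:R * #|{: Pt}|%:R)) : R.
have Z0 : 0 <= Z by rewrite !mulr_ge0.
(* Ensures Cc <= W^2, which the rank estimate requires of w = W c. *)
pose W := Cc + 1.
have W0 : 0 < W by rewrite /W; lra.
(* The second entry gives w <= 1; the third makes the rank error in the exponent, Z w, at most
   eta. *)
pose e0 := Num.min 1 (Num.min W^-1 (eta / ((1 + Z) * W))).
have N1 : 0 < net_const1 Pt :> R.
  rewrite /net_const1 mulr_gt0 // ltr_wpDr ?mulr_gt0 // /herm_mass !mulr_ge0 //.
  by apply: sumr_ge0 => i _; exact: sqr_ge0.
have N2 : 1 <= net_const2 X kap by exact: net_const2_ge1.
have N20 : 0 < net_const2 X kap :> R by apply: lt_le_trans N2.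
have I0 : 0 <= I.
  by rewrite /I; exact: calI_part_ge0.
pose C0 := 2 + `|ln (net_const1 Pt / beta)| + (2 * I + eta) * `|ln (net_const2 X kap / beta)| : R.
exists C0, e0; split.
- apply: addr_ge0; first exact: addr_ge0.
  by apply: mulr_ge0 => //; apply: addr_ge0; [exact: mulr_ge0|exact: ltW].
- by rewrite /e0 !lt_min ltr01 invr_gt0 W0 divr_gt0 // mulr_gt0 //; lra.
- by rewrite /e0 ge_min lexx.
move=> e epos; rewrite /e0 !lt_min => /and3P [e1 eW eeta].
pose c := beta * e.
have c0 : 0 < c by rewrite mulr_gt0.
have ce : c <= e by rewrite /c -[leRHS]mul1r ler_wpM2r // ltW.
have c1 : c <= 1 by lra.
pose w := W * c.
have w0 : 0 <= w by rewrite mulr_ge0 // ltW.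
have we : w <= W * e by rewrite /w ler_pM2l.
have w1 : w <= 1.
  apply: le_trans we _; rewrite mulrC -ler_pdivlMr // div1r; exact: ltW.
have Zw : Z * w <= eta.
  move: eeta; rewrite ltr_pdivlMr ?mulr_gt0 //; last lra.
  have -> : e * ((1 + Z) * W) = W * e + Z * (W * e) by ring.
  have : Z * w <= Z * (W * e) by rewrite ler_wpM2l.
  have : 0 <= W * e by rewrite mulr_ge0 // ltW.
  lra.
have hw : (2 * close_const Pt kap + 2 * kap) * c ^+ 2 <= w ^+ 2.
  rewrite -/Cc /w (exprMn _ W c) ler_wpM2r ?sqr_ge0 // /W.
  by rewrite sqrrD1 -[leLHS]addr0; have := sqr_ge0 Cc; move: (Cc ^+ 2) => q; lra.
have he : #|{: X}|%:R * ((4 + 8 * off_const Pt kap) * c ^+ 2) < e ^+ 2.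
  rewrite mulrA -/Y /c (exprMn _ beta e) mulrA -[ltRHS]mul1r ltr_pM2r ?exprn_gt0 //.
  rewrite /beta exprVn ltr_pdivrMr ?exprn_gt0 //.
  by rewrite mul1r expr2; have : 0 <= Y * Y by [rewrite mulr_ge0]; lra.
pose L := `|ln e|.
have logdiv (a : R) : 0 < a -> ln (a / c) <= `|ln (a / beta)| + L.
  move=> a0; rewrite /c invfM mulrA lnM ?posrE ?divr_gt0 ?invr_gt0 //.
  apply: lerD; first exact: ler_norm.
  by rewrite lnV ?posrE // /L -normrN ler_norm.
have ln20 : 0 <= ln (net_const2 X kap / c).
  by apply: ln_ge0; rewrite ler_pdivlMr // mul1r; apply: le_trans N2.
have expo : net_exponent tau X Pt w <= 2 * I + eta.
  by rewrite /net_exponent block_massE -/I -/Z lerD2l.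
pose b := 2 + ln (net_const1 Pt / c) + net_exponent tau X Pt w * ln (net_const2 X kap / c).
have bb : b <= C0 + (1 + 2 * I + eta) * `|ln e|.
  have l1 := logdiv _ N1; have l2 := logdiv _ N20.
  have : net_exponent tau X Pt w * ln (net_const2 X kap / c) <=
     (2 * I + eta) * (`|ln (net_const2 X kap / beta)| + L).
    apply: (@le_trans _ _ ((2 * I + eta) * ln (net_const2 X kap / c))); first exact: ler_wpM2r.
    by apply: ler_wpM2l => //; rewrite addr_ge0 ?mulr_ge0 // ltW.
  rewrite /b /C0 mulrDr; move: l1 => {l2}; have -> : (1 + 2 * I + eta) * L = L + (2 * I + eta) * L by ring.
  move: ((2 * I + eta) * L) ((2 * I + eta) * _) (net_exponent _ _ _ _ * _) (`|_|) (ln _) => q1 q2 q3 q4 q5.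
  lra.
apply: (@le_trans _ _ b%:E); last by rewrite lee_fin.
apply: ge_ereal_sup => _ [r /= r0 <-].
have [m [g [G [g0 ok]]]] := structure (c ^+ 2) r (exprn_gt0 2 c0) (exprn_ile1 2 (ltW c0) c1) r0.
apply: (@le_trans _ _ (K_mg dot tau X e r m g)); first by apply: ereal_inf_lbound; exists (m, g).
apply: (@limf_esup_le _ _ _ _ _ [set k | (0 < k)%N]); first by exists 1%N.
move=> k /= k0; apply: lne_covering_le => //.
apply: (net_bound (gm := fun a j => mx_ev a (G j)) j0 k0 kap1 c0 c1 w0 w1 epos part_rtau) => //.
by move=> a Ya; exact: ok.
Qed.

Lemma delta0_le_part : (delta0 dot tau X <= (1 + 2 * calI_part tau X Pt)%:E)%E.
Proof.
apply/lee_addgt0Pr => eta eta0; rewrite -EFinD.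
have eta2 : 0 < eta / 2 by lra.
have [C0 [e0 [C00 e00 e01 hK]]] := K_e_le eta2.
set s := 1 + 2 * calI_part tau X Pt.
(* For e below q one has 2 C0 / eta < |ln e|, so C0 costs at most eta / 2 after division by |ln
   e|. *)
pose q := expR (- (2 * C0 / eta + 1)).
pose e1 := Num.min e0 q.
have e10 : 0 < e1 by rewrite lt_min e00 expR_gt0.
apply: (@limf_esup_le _ _ _ _ _ [set e | 0 < e /\ e < e1]).
  near=> e; split; first by [].
  by near: e; exact: nbhs_right_lt.
move=> e /= [epos]; rewrite lt_min => /andP [ee0 eq].
have lnq : ln e < - (2 * C0 / eta + 1).
  by rewrite -[ltRHS]expRK -/q ltr_ln ?posrE ?expR_gt0.
have L1 : 2 * C0 / eta + 1 < `|ln e|.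
  by rewrite -normrN; apply: lt_le_trans (ler_norm _); lra.
have L0 : 0 < `|ln e|.
  by apply: lt_trans L1; rewrite ltr_wpDl // divr_ge0 ?mulr_ge0 // ltW.
apply: le_trans (lee_wpmul2r _ (hK e epos ee0)) _; first by rewrite lee_fin invr_ge0.
rewrite -EFinM lee_fin ler_pdivrMr // -/s.
suff : C0 <= eta / 2 * `|ln e|.
  have -> : (s + eta) * `|ln e| = eta / 2 * `|ln e| + (s + eta / 2) * `|ln e| by field.
  by rewrite lerD2r.
rewrite mulrC -ler_pdivrMr //; apply: le_trans (ltW L1).
have -> : C0 / (eta / 2) = 2 * C0 / eta by field; rewrite gt_eqF.
by move: (2 * C0 / eta) => y; lra.
Unshelve. all: by end_near.
Qed.

End Limits.

(** Shows that the real infimum [calI] is taken over a nonempty set, so that its value can be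
    approached by partitions. *)
Lemma trivial_partition (R : realType) (H : completeNormedModType R[i])
    (dot : {dot H for (@conjc R)}) (M : set (H -> H)) :
  hilbert dot -> von_neumann_algebra dot M ->
  projection_partition dot M [fset (idfun : H -> H)]%fset.
Proof.
move=> hH hM; split => [p|p q|].
- by move=> /fset1P ->; split=> //; [exact: (M_id hH hM)|exact: (adj_id hH)].
- by move=> /fset1P -> /fset1P ->; rewrite eqxx.
- by rewrite big_seq_fset1.
Qed.

Theorem corollary8p5 (R : realType) (H : completeNormedModType R[i])
    (dot : {dot H for (@conjc R)}) (M : set (H -> H))
    (tau : (H -> H) -> R[i]) (X : {fset (H -> H)}) :
  hilbert dot -> II1_factor dot M tau -> generates dot X M ->
  (delta0 dot tau X <= (1 + 2 * calI dot M tau X)%:E)%E.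
Proof.
move=> hH [hM _ _ ht] gen.
apply/lee_addgt0Pr => eta eta0; rewrite -EFinD.
have hinf : has_inf [set calI_part tau X P | P in projection_partition dot M].
  split; first by exists (calI_part tau X [fset (idfun : H -> H)]%fset), [fset (idfun : H -> H)]%fset; [exact: trivial_partition|].
  by exists 0 => _ [P hP <-]; exact: (calI_part_ge0 hH hM ht).
have [|_ [P hP <-] lt] := inf_adherent (eps := eta / 2) _ hinf; first lra.
apply: le_trans (delta0_le_part hH hM ht gen hP) _; rewrite lee_fin.
by move: lt; rewrite -/(calI dot M tau X); move: (calI _ _ _ _) (calI_part _ _ _) => p q; lra.
Qed.
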